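(* (Strong law of large numbers.) Let $X$ be the $(P_t,\psi)$-superprocess described in the context. Assume: (1) the measure $\int_E\gamma(x,\mathrm{d}y)\,m(\mathrm{d}x)$ (a measure in $\mathrm{d}y$) belongs to the Kato class $\mathbf{K}(\xi)$; (2) the functions $x\mapsto a(x)$ and $x\mapsto\gamma(x,1)$ belong to $L^2(E,m)$; (3) there exist a constant $\lambda_1<0$ and strictly positive functions $h,\widehat h\in\mathcal{F}$, with $h$ bounded and continuous, $\|h\|_{L^2(E,m)}=1$ and $(h,\widehat h)=1$, such that $\mathcal{Q}(h,v)=\lambda_1(h,v)$ and $\mathcal{Q}(v,\widehat h)=\lambda_1(v,\widehat h)$ for all $v\in\mathcal{F}$; (4) the operators $f\mapsto\psi(\cdot,f)$ and $f\mapsto\gamma(\cdot,f)-a(\cdot)f(\cdot)$ preserve $\mathcal{C}^\xi_b(E)$; (5) there is $p\in(1,2]$ such that $\sup_{x\in E}h(x)^{-1}\int_{\mathcal{M}(E)^0}\nu(h)^pH(x,\mathrm{d}\nu)<+\infty$; (6) $\lim_{t\to+\infty}\sup_{x\in E}\operatorname{ess\,sup}_{y\in E}|\widetilde p(t,x,y)-1|=0$, where $\widetilde p(t,x,y)=\frac{e^{\lambda_1t}}{h(x)\widehat h(y)}\mathfrak{p}(t,x,y)$; (7) $\lim_{t\to0+}\|\widetilde P_t\phi-\phi\|_\infty=0$ for all $\phi\in C_0(E)$, where $\widetilde P_t\phi(x)=\frac{e^{\lambda_1t}}{h(x)}\mathfrak{P}_t(\phi h)(x)$. Then there exists an event $\Omega_0$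 with $\mathrm{P}_\mu(\Omega_0)=1$ for every $\mu\in\mathcal{M}(E)$ such that, on $\Omega_0$, for every $m$-almost everywhere continuous Borel function $f$ on $E$ with $f/h$ bounded, $$\lim_{t\to+\infty}e^{\lambda_1t}\langle f,X_t\rangle=(f,\widehat h)\,W^h_\infty(X),$$ where $W^h_\infty(X)$ is the limit as $t\to\infty$ (which exists and is finite $\mathrm{P}_\mu$-a.s. for every $\mu$) of the nonnegative martingale $W^h_t(X)=e^{\lambda_1t}\langle h,X_t\rangle$.
   Context: Setting. $E$ is a locally compact separable metric space with Borel $\sigma$-algebra $\mathcal{B}(E)$, $m$ is a $\sigma$-finite measure on $E$ with full support, and $E_\partial=E\cup\{\partial\}$ is the one-point compactification; functions on $E$ are extended by $f(\partial)=0$. $\mathcal{M}(E)$ is the space of finite Borel measures on $E$ with the weak topology, $\mathcal{M}(E)^0=\mathcal{M}(E)\setminus\{0\}$. Write $\langle f,\mu\rangle=\mu(f)=\int f\,\mathrm{d}\mu$, $(f,g)=\int_E fg\,\mathrm{d}m$, $\|f\|_\infty=\sup_{x\in E}|f(x)|$. $\mathcal{B}_b(E)$, $\mathcal{B}^+(E)$, $\mathcal{B}_b^+(E)$ denote bounded, nonnegative, and bounded nonnegative Borel functions; $C_0(E)$ is the space of bounded continuous functions on $E$ vanishing at $\partial$. A function $f(x,t)$ is locally bounded if $\sup_{t\le T}\sup_x|f(x,t)|<\infty$ for every $T\in(0,\infty)$. Essential suprema are with respect to $m$. Spatial motion. $\xi=(\xi_t,\Pi_x)$ is an $m$-symmetric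 Hunt process on $E$, with transition semigroup $P_tf(x)=\Pi_x[f(\xi_t)]$, associated with a regular symmetric Dirichlet form $(\mathcal{E},\mathcal{F})$ on $L^2(E,m)$; $\xi$ has a transition density $p(t,x,y)$ with respect to $m$, symmetric in $(x,y)$ for each $t>0$. A measurable function $f$ is finely continuous with respect to $\xi$ if $t\mapsto f(\xi_t)$ is a.s. right continuous on $[0,\infty)$; $\mathcal{C}^\xi_b(E)$ is the set of bounded measurable finely continuous functions (for $\psi$, which is defined on nonnegative functions, ''preserves'' refers to nonnegative $f\in\mathcal{C}^\xi_b(E)$). Superprocess. The branching mechanism is, for $x\in E$, $f\in\mathcal{B}_b^+(E)$, $$\psi(x,f)=a(x)f(x)+b(x)f(x)^2-\eta(x,f)+\int_{\mathcal{M}(E)^0}\big(e^{-\nu(f)}-1+\nu(\{x\})f(x)\big)H(x,\mathrm{d}\nu),$$ where $a\in\mathcal{B}_b(E)$, $b\in\mathcal{B}_b^+(E)$, $\eta(x,\mathrm{d}y)$ is a bounded kernel on $E$ (with $\eta(x,f)=\int f(y)\eta(x,\mathrm{d}y)$), and $H(x,\mathrm{d}\nu)$ is a $\sigma$-finite kernel from $E$ to $\mathcal{M}(E)^0$ with $\sup_{x}\int(\nu(1)\wedge\nu(1)^2+\nu_x(1))H(x,\mathrm{d}\nu)<\infty$; here $\nu_x$ is the restriction of $\nu$ to $E\setminus\{x\}$. Put $\gamma(x,\mathrm{d}y)=\eta(x,\mathrm{d}y)+\int_{\mathcal{M}(E)^0}\nu_x(\mathrm{d}y)H(x,\mathrm{d}\nu)$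 (a bounded kernel) and $\gamma(x,f)=\int f(y)\gamma(x,\mathrm{d}y)$. The $(P_t,\psi)$-superprocess $X=(X_t)_{t\ge0}$ is the $\mathcal{M}(E)$-valued Markov process, with law $\mathrm{P}_\mu$ when started from $\mu\in\mathcal{M}(E)$ (the symbol $\mathrm{P}_\mu$ also denotes expectation), satisfying $\mathrm{P}_\mu(e^{-\langle f,X_t\rangle})=e^{-\langle V_tf,\mu\rangle}$ for $f\in\mathcal{B}_b^+(E)$, where $V_tf$ is the unique nonnegative locally bounded solution of $V_tf(x)=P_tf(x)-\Pi_x[\int_0^t\psi(\xi_s,V_{t-s}f)\,\mathrm{d}s]$. $X$ is realized as the coordinate process on the space of right continuous paths from $[0,\infty)$ to $\mathcal{M}(E)$ having $0$ as a trap, and $(\mathcal{F}_t)$ is the filtration generated by the coordinate process, completed with the $\mathrm{P}_\mu$-negligible sets for every $\mu$. Under (1)-(3), $(W^h_t(X))$ is a nonnegative $\mathrm{P}_\mu$-martingale with respect to $(\mathcal{F}_t)$ for every $\mu$. Mean semigroup. For $f\in\mathcal{B}_b(E)$, $\mathrm{P}_\mu(\langle f,X_t\rangle)=\langle\mathfrak{P}_tf,\mu\rangle$, where $\mathfrak{P}_tf$ is the unique locally bounded solution of $\mathfrak{P}_tf(x)=P_tf(x)-\Pi_x[\int_0^ta(\xi_s)\mathfrak{P}_{t-s}f(\xi_s)\,\mathrm{d}s]+\Pi_x[\int_0^t\gamma(\xi_s,\mathfrak{P}_{t-s}f)\,\mathrm{d}s]$. $(\mathfrak{P}_t)$ is a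 semigroup and has a transition density $\mathfrak{p}(t,x,y)$ with respect to $m$. Kato class. A nonnegative measure $\mu$ on $E$ is a smooth measure of $\xi$ if there is a positive continuous additive functional $A^\mu$ of $\xi$ with $\int f\,\mathrm{d}\mu=\lim_{t\to0}\frac1t\int_E\Pi_x[\int_0^tf(\xi_s)\,\mathrm{d}A^\mu_s]m(\mathrm{d}x)$ for all $f\in\mathcal{B}^+(E)$; it belongs to $\mathbf{K}(\xi)$ if moreover $\lim_{t\downarrow0}\sup_{x\in E}\int_0^t\int_Ep(s,x,y)\mu(\mathrm{d}y)\,\mathrm{d}s=0$. Bilinear form. For $u,v\in\mathcal{F}$, $\mathcal{Q}(u,v)=\mathcal{E}(u,v)+\int_Ea(x)u(x)v(x)m(\mathrm{d}x)-\int_E\int_Eu(y)v(x)\gamma(x,\mathrm{d}y)m(\mathrm{d}x)$. *)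

(* Defs.v *)
From HB Require Import structures.
From mathcomp Require Import all_boot all_order all_algebra.
From mathcomp Require Import all_classical all_reals all_analysis.
From mathcomp Require Import measurable_realfun ess_sup_inf metric_structure one_point_compactification.

Set Implicit Arguments.
Unset Strict Implicit.
Unset Printing Implicit Defensive.

Import Order.TTheory GRing.Theory Num.Theory.
Import numFieldNormedType.Exports.

Local Open Scope classical_set_scope.
Local Open Scope ring_scope.

Notation borel T := (g_sigma_algebraType (@open T)).

(* Measurable types are nonempty in the library, hence the base point. *)
#[short(type="pmetricType")]
HB.structure Definition PMetric (R : realType) := {M of Metric R M & Pointed M}.

Section functions.
Context {R : realType} {E : pmetricType R}.
Implicit Types f g : E -> R.

Definition bounded_fct f := exists M : R, forall x, `|f x| <= M.

Definition Bb : set (E -> R) :=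
  [set f : E -> R | measurable_fun [set: borel E] f /\ bounded_fct f].

Definition Bplus : set (E -> R) :=
  [set f : E -> R | measurable_fun [set: borel E] f /\ forall x, 0 <= f x].

Definition Bbplus : set (E -> R) := Bb `&` Bplus.

Definition supnorm f : \bar R := ereal_sup (range (fun x => `|f x|%:E)).

Definition Ed := one_point_compactification E.

HB.instance Definition _ := Topological.on Ed.
HB.instance Definition _ := Pointed.on Ed.

(* functions on E are extended by 0 at the cemetery None *)
Definition ext f : Ed -> R := fun z => if z is Some x then f x else 0.

Definition C0 : set (E -> R) :=
  [set f : E -> R | [/\ continuous f, bounded_fct f & continuous (ext f)]].

Definition Cc : set (E -> R) :=
  [set f : E -> R | continuous f /\ compact (closure [set x | f x != 0])].

End functions.
Arguments Ed {R} E.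

Section finite_measures.
Context {R : realType}.
Variable E : pmetricType R.

Definition Cb := {f : E -> R | continuous f /\ bounded_fct f}.

Definition fmeas := {finite_measure set (borel E) -> \bar R}.

HB.instance Definition _ := gen_eqMixin fmeas.
HB.instance Definition _ := gen_choiceMixin fmeas.

Definition pairing (f : E -> R) (mu : fmeas) : R := \int[mu]_x f x.

Definition weak_eval (mu : fmeas) : {ptws Cb -> R} :=
  fun f => pairing (sval f) mu.

HB.instance Definition _ :=
  Topological.copy fmeas (initial_topology weak_eval).

Let mzeroE : @fin_num_fun _ (borel E) R mzero.
Proof. by move=> U _. Qed.

HB.instance Definition _ :=
  @Measure_isFinite.Build _ (borel E) R mzero mzeroE.

HB.instance Definition _ :=
  isPointed.Build fmeas (mzero : {finite_measure set (borel E) -> \bar R}).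

(* M(E)^0; the zero measure is characterized by its total mass since the
   values of a measure outside the sigma-algebra are unspecified *)
Definition nonzero : set fmeas := [set nu | nu setT != 0%E].

End finite_measures.

Section L2.
Context {R : realType} {E : pmetricType R}.
Variable m : {sigma_finite_measure set (borel E) -> \bar R}.
Implicit Types u v w : E -> R.

Definition L2 : set (E -> R) :=
  [set u : E -> R | measurable_fun [set: borel E] u /\
    @finite_norm _ (borel E) R m 2%:E u].

Definition ip u v : R := \int[m]_x (u x * v x).

(* Elements of the domain are functions, not classes: dom is saturated under
   m-a.e. equality and form does not depend on the chosen version. *)
Structure dirichlet_form := DirichletForm {
  dom : set (E -> R) ;
  form : (E -> R) -> (E -> R) -> R ;
  dom_L2 : dom `<=` L2 ;
  dom_ae : forall u v, dom u -> measurable_fun [set: borel E] v ->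
    (\forall x \ae m, u x = v x) ->
    dom v /\ forall w, dom w -> form u w = form v w ;
  dom0 : dom (cst 0) ;
  dom_lin : forall (c : R) u v, dom u -> dom v ->
    dom (fun x => c * u x + v x) ;
  dom_dense : forall u (e : R), L2 u -> 0 < e ->
    exists2 v, dom v & ip (u \- v) (u \- v) < e ;
  form_sym : forall u v, dom u -> dom v -> form u v = form v u ;
  form_lin : forall (c : R) u v w, dom u -> dom v -> dom w ->
    form (fun x => c * u x + v x) w = c * form u w + form v w ;
  form_ge0 : forall u, dom u -> 0 <= form u u ;
  form_closed : forall un : nat -> E -> R, (forall n, dom (un n)) ->
    (forall e : R, 0 < e -> exists N, forall n k, (N <= n)%N -> (N <= k)%N ->
      form (un n \- un k) (un n \- un k)
        + ip (un n \- un k) (un n \- un k) < e) ->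
    exists2 u, dom u &
      form (un n \- u) (un n \- u) + ip (un n \- u) (un n \- u)
        @[n --> \oo] --> (0 : R) ;
  form_markov : forall u, dom u ->
    dom (fun x => Num.min (Num.max (u x) 0) 1) /\
    form (fun x => Num.min (Num.max (u x) 0) 1)
         (fun x => Num.min (Num.max (u x) 0) 1) <= form u u
}.

Variable D : dirichlet_form.

Definition form1 u v : R := form D u v + ip u v.

Definition regular_form : Prop :=
  (forall u (e : R), dom D u -> 0 < e ->
     exists v, [/\ dom D v, Cc v & form1 (u \- v) (u \- v) < e]) /\
  (forall u (e : R), Cc u -> 0 < e ->
     exists v, [/\ dom D v, Cc v & forall x, `|u x - v x| < e]).

(* 1-capacity, to be used on open sets only *)
Definition capacity (G : set E) : \bar R :=
  ereal_inf [set (form1 u u)%:E | u in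
    [set u : E -> R | dom D u /\ \forall x \ae m, G x -> 1 <= u x]].

Definition quasi_continuous u : Prop :=
  forall e : R, 0 < e -> exists G : set E,
    [/\ open G, (capacity G < e%:E)%E & {within ~` G, continuous u}].

End L2.

Section hunt.
Context {R : realType}.
Variable E : pmetricType R.
Context d (Omega : measurableType d).

Definition stopping_time (F : R -> set (set Omega)) (sigma : Omega -> \bar R) :=
  (forall w, 0 <= sigma w)%E /\
  forall t : R, 0 <= t -> F t [set w | (sigma w <= t%:E)%E].

Definition stopped_algebra (F : R -> set (set Omega)) (sigma : Omega -> \bar R)
    : set (set Omega) :=
  [set A | measurable A /\
    forall t : R, 0 <= t -> F t (A `&` [set w | (sigma w <= t%:E)%E])].

(* Only the times t >= 0 are meaningful. *)
Structure hunt_process := HuntProcess {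
  pos : R -> Omega -> Ed E ;
  law : R.-pker (borel (Ed E)) ~> Omega ;
  shift : R -> Omega -> Omega ;
  filt : R -> set (set Omega) ;
  pos_normal : forall z, \forall w \ae law z, pos 0 w = z ;
  pos_shift : forall (s t : R) w, 0 <= s -> 0 <= t ->
    pos s (shift t w) = pos (t + s) w ;
  pos_cemetery : forall (s t : R) w, 0 <= s -> s <= t ->
    pos s w = None -> pos t w = None ;
  pos_right : forall (t : R) w, 0 <= t -> pos s w @[s --> t^'+] --> pos t w ;
  pos_left : forall (t : R) w, 0 < t -> exists z : Ed E, pos s w @[s --> t^'-] --> z ;
  filt_algebra : forall t : R, 0 <= t -> sigma_algebra setT (filt t) ;
  filt_sub : forall t : R, 0 <= t -> filt t `<=` measurable ;
  filt_right : forall t : R, 0 <= t ->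
    filt t = \bigcap_(s in [set s | t < s]) filt s ;
  filt_adapted : forall (t : R) (B : set (borel (Ed E))), 0 <= t -> measurable B ->
    filt t (pos t @^-1` B) ;
  (* strong Markov property, pos being evaluated on [sigma < +oo] only *)
  pos_markov : forall sigma z (s : R) (A : set Omega) (B : set (borel (Ed E))),
    stopping_time filt sigma -> 0 <= s ->
    stopped_algebra filt sigma A -> measurable B ->
    (law z (A `&` [set w | (sigma w < +oo)%E /\
                           B (pos (fine (sigma w) + s) w)]) =
     \int[law z]_(w in A `&` [set w | sigma w < +oo])
       law (pos (fine (sigma w)) w) (pos s @^-1` B))%E ;
  pos_quasi_left : forall (sn : nat -> Omega -> \bar R) sigma z,
    (forall n, stopping_time filt (sn n)) -> stopping_time filt sigma ->
    (forall w n, (sn n w <= sn n.+1 w)%E) ->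
    (forall w, sn n w @[n --> \oo] --> sigma w) ->
    \forall w \ae law z, (sigma w < +oo)%E ->
      pos (fine (sn n w)) w @[n --> \oo] --> pos (fine (sigma w)) w
}.

End hunt.
Arguments pos {R E d Omega}.
Arguments law {R E d Omega}.
Arguments shift {R E d Omega}.

Section motion.
Context {R : realType} {E : pmetricType R} {d} {Omega : measurableType d}.
Variables (m : {sigma_finite_measure set (borel E) -> \bar R})
  (xi : hunt_process E Omega).

Local Notation "'Pi_ x" := (law xi (Some x)) (at level 8, x at level 2).

Definition eP (t : R) (f : E -> R) (x : E) : \bar R :=
  (\int['Pi_ x]_w (ext f (pos xi t w))%:E)%E.

Definition Pt (t : R) (f : E -> R) (x : E) : R := fine (eP t f x).

Definition m_symmetric : Prop := forall (t : R) f g, 0 < t -> Bplus f -> Bplus g ->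
  (\int[m]_x (eP t f x * (g x)%:E) = \int[m]_x ((f x)%:E * eP t g x))%E.

(* D is the Dirichlet form, by approximation, of the strongly continuous semigroup on L^2(m)
   determined by the transition semigroup. *)
Definition associated (D : dirichlet_form m) : Prop :=
  (forall u, dom D u <->
     L2 m u /\ cvg (t^-1 * ip m (u \- Pt t u) u @[t --> 0^'+])) /\
  (forall u v, dom D u -> dom D v ->
     t^-1 * ip m (u \- Pt t u) v @[t --> 0^'+] --> form D u v).

Definition transition_density (p : R -> E -> E -> \bar R) : Prop :=
  [/\ measurable_fun [set z : R * (borel E * borel E) | 0 < z.1]
        (fun z => p z.1 z.2.1 z.2.2),
      forall (t : R) x y, 0 < t -> (0 <= p t x y)%E &
      forall (t : R) x (B : set (borel E)), 0 < t -> measurable B ->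
        ('Pi_ x (pos xi t @^-1` (Some @` B)) = \int[m]_(y in B) p t x y)%E].

Definition symmetric_density (p : R -> E -> E -> \bar R) : Prop :=
  forall (t : R) x y, 0 < t -> p t x y = p t y x.

Definition finely_continuous (f : E -> R) : Prop :=
  forall x, \forall w \ae 'Pi_ x, forall t : R, 0 <= t ->
    ext f (pos xi s w) @[s --> t^'+] --> ext f (pos xi t w).

Definition Cb_fine : set (E -> R) :=
  [set f : E -> R | Bb f /\ finely_continuous f].

(* I is the set of times; the filtrations at time t are I = `[0, t] *)
Definition natural_filt (I : set R) : set (set Omega) :=
  <<s \bigcup_(s in I)
        preimage_set_system setT (pos xi s : Omega -> borel (Ed E)) measurable >>.

Definition mixture_law (mu : probability (borel (Ed E)) R) (A : set Omega)
    : \bar R := (\int[mu]_z law xi z A)%E.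

Definition completed_filt (I : set R) : set (set Omega) :=
  [set A | forall mu : probability (borel (Ed E)) R,
     exists2 B, natural_filt I B & negligible (mixture_law mu) (A `+` B)].

Definition exceptional (N : set E) : Prop :=
  exists B : set (borel E), [/\ measurable B, N `<=` B &
    \forall x \ae m, \forall w \ae 'Pi_ x,
      forall t : R, 0 < t -> ~ (Some @` B) (pos xi t w)].

(* positive continuous additive functional of xi with defining set La; the
   condition xi_t <> None means t < zeta. *)
Definition pcaf (A : R -> Omega -> \bar R) (La : set Omega) : Prop :=
  [/\ forall (t : R) (B : set (\bar R)), 0 <= t -> measurable B ->
        completed_filt `[0, t] (A t @^-1` B),
      completed_filt `[0, +oo[ La,
      exists2 N, exceptional N & forall x, ~ N x -> \forall w \ae 'Pi_ x, La w,
      forall (t : R) w, 0 <= t -> La w -> La (shift xi t w) &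
      forall w, La w ->
        [/\ A 0 w = 0%E,
            forall t : R, 0 <= t -> (0 <= A t w)%E,
            {within `[0, +oo[, continuous (fun t => A t w)},
            (forall t : R, 0 <= t -> pos xi t w <> None -> (A t w < +oo)%E) /\
            (forall s t : R, 0 <= s -> s <= t -> pos xi s w = None ->
               A t w = A s w) &
            forall s t : R, 0 <= s -> 0 <= t ->
              A (t + s) w = (A t w + A s (shift xi t w))%E]].

(* mu is dF on the times where F is finite; what it does beyond them is
   irrelevant in smooth below since f vanishes at the cemetery. *)
Definition stieltjes (F : R -> \bar R) (mu : {measure set R -> \bar R}) : Prop :=
  forall s t : R, 0 <= s -> s <= t -> (F t < +oo)%E -> mu `]s, t]%classic = (F t - F s)%E.

(* A is adapted to the completed filtration only: the integral of a nonnegative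
   function being the supremum over the measurable simple functions below it, it
   agrees with the integral against the completed measure. *)
Definition smooth (mu : {measure set (borel E) -> \bar R}) : Prop :=
  exists A La (dA : Omega -> {measure set R -> \bar R}),
    [/\ pcaf A La,
        forall w, La w -> stieltjes (fun t => A t w) (dA w) &
        forall f, Bplus f ->
          (t^-1%:E *
           \int[m]_x \int['Pi_ x]_w \int[dA w]_(s in `]0%R, t])
             (ext f (pos xi s w))%:E)%E @[t --> 0^'+]
          --> (\int[mu]_x (f x)%:E)%E].

Definition kato (p : R -> E -> E -> \bar R)
    (mu : {measure set (borel E) -> \bar R}) : Prop :=
  smooth mu /\
  ereal_sup (range (fun x =>
    \int[lebesgue_measure]_(s in `]0%R, t]) \int[mu]_y p s x y))%E
    @[t --> 0^'+] --> 0%E.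

(* for functions on [0, +oo[ x E; joint measurability is implicit on paper *)
Definition locally_bounded (F : R -> E -> R) : Prop :=
  measurable_fun [set z : R * borel E | 0 <= z.1] (fun z => F z.1 z.2) /\
  forall T : R, 0 < T -> exists M : R, forall (t : R) x, 0 <= t -> t <= T ->
    `|F t x| <= M.

(* Pi_x[\int_0^t g_s(xi_s) ds] *)
Definition time_integral (t : R) (g : R -> E -> R) (x : E) : R :=
  \int['Pi_ x]_w \int[lebesgue_measure]_(s in `[0, t]) ext (g s) (pos xi s w).

End motion.

Section mixture.
Context {R : realType} {E : pmetricType R}.
Variables (m : {measure set (borel E) -> \bar R})
  (k : R.-ker (borel E) ~> (borel E)).

(* the measure \int m(dx) k(x, dy) *)
Definition kmix (A : set (borel E)) : \bar R := (\int[m]_x k x A)%E.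

Let kmix0 : kmix set0 = 0%E.
Proof. by rewrite /kmix integral0_eq. Qed.

Let kmix_ge0 A : (0 <= kmix A)%E.
Proof. exact: integral_ge0. Qed.

Let kmix_sigma_additive : semi_sigma_additive kmix.
Proof.
move=> F mF tF mUF; rewrite /kmix.
rewrite [X in _ --> X](_ : _ = \sum_(0 <= n <oo) \int[m]_x k x (F n))%E.
  by apply: is_cvg_ereal_nneg_natsum_cond => n _ _; exact: integral_ge0.
rewrite -integral_nneseries//; last by move=> n; exact: measurable_kernel.
by apply: eq_integral => x _; rewrite measure_semi_bigcup.
Qed.

HB.instance Definition _ := isMeasure.Build _ _ _ kmix
  kmix0 kmix_ge0 kmix_sigma_additive.

End mixture.

Section branching.
Context {R : realType}.
Variable E : pmetricType R.

Structure branching_mechanism := BranchingMechanism {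
  bra : E -> R ;
  brb : E -> R ;
  breta : R.-fker (borel E) ~> (borel E) ;
  brH : R.-sigmafker (borel E) ~> (borel (fmeas E)) ;
  bra_Bb : Bb bra ;
  brb_Bb : Bbplus brb ;
  brH0 : forall x, brH x (~` @nonzero R E) = 0%E ;
  brH_moment : (ereal_sup (range (fun x =>
    \int[brH x]_(nu in @nonzero R E)
      (Order.min (nu setT) (nu setT ^+ 2) + nu (~` [set x])))) < +oo)%E
}.

Variable br : branching_mechanism.

Definition psi (x : E) (f : E -> R) : R :=
  bra br x * f x + brb br x * f x ^+ 2 - \int[breta br x]_y f y
  + \int[brH br x]_(nu in @nonzero R E)
      (expR (- pairing f nu) - 1 + fine (nu [set x]) * f x).

Definition nonlocal_kernel (gamma : R.-fker (borel E) ~> (borel E)) : Prop :=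
  forall x (A : set (borel E)), measurable A ->
    (gamma x A = breta br x A
      + \int[brH br x]_(nu in @nonzero R E) nu (A `\ x))%E.

Section evolution.
Context {d} {Omega : measurableType d}.
Variables (xi : hunt_process E Omega) (gamma : R.-fker (borel E) ~> (borel E)).

(* V_t f(x) = V t f x; such a V is unique by Gronwall's inequality *)
Definition cumulant_semigroup (V : R -> (E -> R) -> E -> R) : Prop :=
  forall f, Bbplus f ->
    [/\ locally_bounded (V ^~ f),
        forall (t : R) x, 0 <= t -> 0 <= V t f x &
        forall (t : R) x, 0 <= t ->
          V t f x = Pt xi t f x
            - time_integral xi t (fun s y => psi y (V (t - s) f)) x].

Definition mean_semigroup (PP : R -> (E -> R) -> E -> R) : Prop :=
  forall f, Bb f ->
    locally_bounded (PP ^~ f) /\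
    forall (t : R) x, 0 <= t ->
      PP t f x = Pt xi t f x
        - time_integral xi t (fun s y => bra br y * PP (t - s) f y) x
        + time_integral xi t (fun s y => \int[gamma y]_z PP (t - s) f z) x.

End evolution.

Definition mean_density (m : {sigma_finite_measure set (borel E) -> \bar R})
    (PP : R -> (E -> R) -> E -> R) (pp : R -> E -> E -> \bar R) : Prop :=
  forall t : R, 0 < t ->
    [/\ measurable_fun [set: borel E * borel E] (fun z => pp t z.1 z.2),
        forall x y, (0 <= pp t x y)%E &
        forall f x, Bb f ->
          ((PP t f x)%:E = \int[m]_y (pp t x y * (f y)%:E))%E].

(* gamma may charge m-negligible sets, so this depends on the version of u:
   elements of the domain are to be taken quasi-continuous in the first
   argument. *)
Definition Qform (m : {sigma_finite_measure set (borel E) -> \bar R})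
    (D : dirichlet_form m) (gamma : R.-fker (borel E) ~> (borel E))
    (u v : E -> R) : R :=
  form D u v + \int[m]_x (bra br x * u x * v x)
  - \int[m]_x (\int[gamma x]_y (u y * v x)).

End branching.

Section paths.
Context {R : realType}.
Variable E : pmetricType R.

(* A path on [0, +oo[ is encoded as a function on R that is constant on the
   negative times. *)
Record mpath := Path {
  traj :> R -> fmeas E ;
  traj_neg : forall t : R, t < 0 -> traj t = traj 0 ;
  traj_right : forall t : R, 0 <= t -> traj s @[s --> t^'+] --> traj t ;
  traj_trap : forall s t : R, 0 <= s -> s <= t ->
    traj s setT = 0%E -> traj t setT = 0%E
}.

HB.instance Definition _ := gen_eqMixin mpath.
HB.instance Definition _ := gen_choiceMixin mpath.

Let zero_path : mpath.
Proof.
apply: (@Path (fun=> point)) => // t _; exact: cvg_cst.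
Defined.

HB.instance Definition _ := isPointed.Build mpath zero_path.

Definition coordinates (I : set R) : set (set mpath) :=
  \bigcup_(t in I)
    preimage_set_system setT (fun w : mpath => w t : borel (fmeas E)) measurable.

End paths.
Arguments coordinates {R} E I.
Notation path_space E := (g_sigma_algebraType (coordinates E `[0, +oo[)).

Section superprocess.
Context {R : realType} {E : pmetricType R}.

Structure is_superprocess (V : R -> (E -> R) -> E -> R)
    (P : R.-pker (borel (fmeas E)) ~> (path_space E)) : Prop := {
  super_start : forall mu : fmeas E, \forall w \ae P mu,
    forall A : set (borel E), measurable A -> traj w 0 A = mu A ;
  super_markov : forall (mu : fmeas E) (s t : R) (A : set (mpath E))
      (B : set (borel (fmeas E))), 0 <= s -> 0 <= t ->
    <<s coordinates E `[0, s] >> A -> measurable B ->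
    (P mu (A `&` [set w : mpath E | B (traj w (s + t)%R)]) =
     \int[P mu]_(w in A) P (traj w s) [set w' : mpath E | B (traj w' t)])%E ;
  super_laplace : forall (mu : fmeas E) (t : R) f, 0 <= t -> Bbplus f ->
    \int[P mu]_w expR (- pairing f (traj w t)) = expR (- pairing (V t f) mu)
}.

End superprocess.

Section normalization.
Context {R : realType} {E : pmetricType R}.
Variables (lambda1 : R) (h : E -> R).

(* p~(t, x, y) *)
Definition normalized_density (hhat : E -> R) (pp : R -> E -> E -> \bar R)
    (t : R) (x y : E) : \bar R :=
  ((expR (lambda1 * t) / (h x * hhat y))%:E * pp t x y)%E.

(* P~_t phi(x) *)
Definition normalized_semigroup (PP : R -> (E -> R) -> E -> R)
    (t : R) (phi : E -> R) (x : E) : R :=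
  expR (lambda1 * t) / h x * PP t (fun y => phi y * h y) x.

(* W^h_t on the path w, and its limit *)
Definition Wh (w : mpath E) (t : R) : R := expR (lambda1 * t) * pairing h (w t).

Definition Wh_infty (w : mpath E) : R := lim (Wh w t @[t --> +oo]).

End normalization.

(* Main.v *)
(* Write psi(x, f) = a f - gamma f + Rem(x, f), where Rem >= 0 is of second
   order, and PP for the mean semigroup, so that V f <= PP f.

   Ergodicity of the normalized density makes e^{lambda1 t} PP_t h / h converge
   uniformly to 1; by the semigroup property it is therefore equal to 1, so that
   W^h is a martingale and the eigenvalue equations are not needed.

   For theta small, the gap theta PP_t f - V_t(theta f) is at most
   C theta^q h when f <= h: over a step of length t/N the moment condition on H
   bounds it by theta^q h t/N up to O(1/N^2), and the steps telescope.

   For fixed r and T, M_t = <PP_{T-t} f, X_{r+t}> is a martingale, and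
   E rem2(theta (M_T - M_0)), where rem2 y = e^{-y} - 1 + y, is controlled by the
   gap. Since rem2 is bounded below off a neighbourhood of 0, Doob's maximal
   inequality bounds the probability that |M_t - M_0| exceeds 1/theta. With
   theta = e^{(lambda1 + rate) r} along r = n sigma, Borel-Cantelli shows that
   e^{lambda1 r} sup_t |M_t - M_0| -> 0 for countably many f, sigma and T at
   once. With f = h this yields the limit of W^h; with f = phi h, phi in C_0, the
   ergodicity identifies the limit of e^{lambda1 r} <PP_T f, X_r>, and strong
   continuity together with right continuity of the paths fills in the times
   between the grid points. Countably many continuous minorants then give all
   almost everywhere continuous functions. *)
From HB Require Import structures.
Require Import Defs.
From mathcomp Require Import all_boot all_order all_algebra.
From mathcomp Require Import all_classical all_reals all_analysis.
From mathcomp Require Import measurable_realfun ess_sup_inf metric_structure one_point_compactification.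
From mathcomp Require Import ring lra.

Set Implicit Arguments.
Unset Strict Implicit.
Unset Printing Implicit Defensive.

Import Order.TTheory GRing.Theory Num.Theory.
Import numFieldNormedType.Exports.

Local Open Scope classical_set_scope.
Local Open Scope ring_scope.

(** The moment hypothesis has order q in (1, 2], so second moments of X need not exist and L^2
    martingale bounds are not at hand. Fluctuations are measured by [rem2] instead: its mean is
    computed exactly from V and PP, and it is at most y^q for y >= 0, which is where q enters. The
    first-moment formula and the two semigroup laws are not hypotheses: the moment is the derivative
    at 0 of the Laplace functional, taken along theta = 1/(n+1), and the semigroup laws are the
    Markov property started from Dirac masses. PP_{T-t} f is not known to be continuous, so t -> M_t
    is not known to be right continuous; the maximal inequality is therefore stated on dyadic times,
    and right continuity is used only for <f, X_t> with f continuous. The almost sure event is a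
    countable intersection of conditions on the path alone, so that it serves every starting measure
    and every f at once. *)

(** * Integrals of bounded functions, with parameters, and against mixtures *)

Section bounded_integrals.
Context d (T : measurableType d) (R : realType).
Variables (mu : {measure set T -> \bar R}) (D : set T).
Hypotheses (mD : measurable D) (fD : (mu D < +oo)%E).
Implicit Types f : T -> R.

Lemma integrable_bounded f (M : R) : measurable_fun D f ->
  (forall x, D x -> `|f x| <= M) -> mu.-integrable D (EFin \o f).
Proof.
move=> mf fM; apply: measurable_bounded_integrable => //.
exists M; split; first exact: num_real.
by move=> x Mx y Dy; apply: le_trans (fM _ Dy) (ltW Mx).
Qed.

Lemma normr_Rintegral_le f (M : R) : measurable_fun D f ->
  (forall x, D x -> `|f x| <= M) ->
  `|\int[mu]_(x in D) f x| <= M * fine (mu D).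
Proof.
move=> mf fM; rewrite -Rintegral_cst//.
apply: le_trans (le_normr_Rintegral mD (integrable_bounded mf fM)) _.
apply: le_Rintegral => //.
- apply: (@integrable_bounded _ M); first exact: measurableT_comp.
  by move=> x Dx; rewrite normr_id fM.
- by apply: (@integrable_bounded _ `|M|) => // x _; rewrite normr_id.
Qed.

Lemma cvg_Rintegral_bounded (f_ : nat -> T -> R) f (M : R) :
  (forall n, measurable_fun D (f_ n)) ->
  (forall n x, D x -> `|f_ n x| <= M) ->
  (forall x, D x -> f_ n x @[n --> \oo] --> f x) ->
  \int[mu]_(x in D) f_ n x @[n --> \oo] --> \int[mu]_(x in D) f x.
Proof.
move=> mf fM ff.
have mf' : measurable_fun D f by apply: (measurable_fun_cvg mf).
have fM' x : D x -> `|f x| <= M.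
  move=> Dx; have nf : `|f_ n x| @[n --> \oo] --> `|f x|.
    by apply: cvg_norm; exact: ff.
  by apply: (cvgr_to_le nf); apply: nearW => n; exact: fM.
apply/fine_cvg.
rewrite fineK; last exact/integrable_fin_num/(integrable_bounded mf' fM').
have mF n : measurable_fun D (EFin \o f_ n) by exact/measurable_EFinP.
have mF' : measurable_fun D (EFin \o f) by exact/measurable_EFinP.
have Ff : {ae mu, forall x, D x -> (EFin \o f_ n) x @[n --> \oo] --> (EFin \o f) x}.
  by apply/aeW => x Dx; apply: cvg_EFin; [exact: nearW|exact: ff].
have Mint : mu.-integrable D (cst M%:E).
  exact: (@integrable_bounded (cst M) `|M|).
have FM : {ae mu, forall x n, D x -> `|(EFin \o f_ n) x| <= cst M%:E x}%E.
  by apply/aeW => x n Dx /=; rewrite lee_fin fM.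
by have [] := dominated_convergence mD mF mF' Ff Mint FM.
Qed.

End bounded_integrals.

Section parametric_integrals.
Context d1 d2 (T1 : measurableType d1) (T2 : measurableType d2) (R : realType).
Variable l : T1 -> {measure set T2 -> \bar R}.
Hypotheses (ml : forall U, measurable U -> measurable_fun setT (l ^~ U))
  (lfin : forall x, (l x setT < +oo)%E).

Lemma measurable_param_integral (f : T1 * T2 -> \bar R) :
  measurable_fun setT f -> (forall z, 0 <= f z)%E ->
  measurable_fun setT (fun x => \int[l x]_y f (x, y))%E.
Proof.
move=> mf f0.
(* the masses of the kernel need not be uniformly bounded: truncate them *)
pose X n := [set x | l x setT <= n%:R%:E]%E.
have mX n : measurable (X n).
  rewrite /X -[X in measurable X]setTI; apply: emeasurable_fun_infty_c => //.
  exact: ml.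
pose ln n x := if x \in X n then l x else mzero : {measure set T2 -> \bar R}.
have mln n U : measurable U -> measurable_fun setT (ln n ^~ U).
  move=> mU; rewrite (_ : ln n ^~ U = fun x => ((\1_(X n) x)%:E * l x U)%E).
    by apply: emeasurable_funM; [exact/measurable_EFinP|exact: ml].
  apply/funext => x; rewrite /ln indicE; case: ifP => _; first by rewrite mul1e.
  by rewrite mul0e.
have lnu n : measure_fam_uub (ln n).
  exists (n%:R + 1) => x; rewrite /ln; case: ifPn => [|_].
    by rewrite inE => /le_lt_trans; apply; rewrite lte_fin ltrDl.
  by rewrite lte_fin ltr_wpDl.
pose b1 n := isKernel.Build _ _ T1 T2 R (ln n) (mln n).
pose k1 n : R.-ker T1 ~> T2 := HB.pack (ln n) (b1 n).
pose b2 n := Kernel_isFinite.Build _ _ T1 T2 R (k1 n) (lnu n).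
pose k n : R.-fker T1 ~> T2 := HB.pack (Kernel.sort (k1 n)) (b2 n).
apply: (emeasurable_fun_cvg (fun n x => \int[k n x]_y f (x, y))%E).
  by move=> n; exact: measurable_fun_integral_finite_kernel.
move=> x _; apply: cvg_near_cst.
have lx : l x setT \is a fin_num by rewrite ge0_fin_numE.
have [N _ NP] := nbhs_infty_ger (fine (l x setT)).
exists N => // n /NP Nn /=; rewrite /ln ifT// inE /X /=.
by rewrite -[leLHS]fineK// lee_fin.
Qed.

(** The integral is by definition the difference of the integrals of the positive and negative
    parts, so measurability needs no integrability. *)
Lemma measurable_param_Rintegral (f : T1 * T2 -> R) : measurable_fun setT f ->
  measurable_fun setT (fun x => \int[l x]_y f (x, y)).
Proof.
move=> mf; apply: measurableT_comp; first exact: fine_measurable.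
have mp : measurable_fun setT (fun z => (EFin \o f)^\+ z)%E.
  exact/measurable_funepos/measurable_EFinP.
have mn : measurable_fun setT (fun z => (EFin \o f)^\- z)%E.
  exact/measurable_funeneg/measurable_EFinP.
rewrite [X in measurable_fun _ X](_ : _ = (fun x =>
    \int[l x]_y (EFin \o f)^\+ (x, y) - \int[l x]_y (EFin \o f)^\- (x, y))%E).
  apply: emeasurable_funB.
  - exact: (measurable_param_integral mp).
  - exact: (measurable_param_integral mn).
apply/funext => x; rewrite [LHS]integralE.
by congr (_ - _)%E; apply: eq_integral => y _; rewrite ?funeposE ?funenegE.
Qed.

End parametric_integrals.

Section mixtures.
Context d1 d2 (T1 : measurableType d1) (T2 : measurableType d2) (R : realType).
Variables (mu : {measure set T1 -> \bar R}) (D : set T1) (mD : measurable D)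
  (k : T1 -> {measure set T2 -> \bar R}) (nu : {measure set T2 -> \bar R}).
Hypotheses (mk : forall U, measurable U -> measurable_fun D (k ^~ U))
  (nuE : forall U, measurable U -> nu U = (\int[mu]_(x in D) k x U)%E).

Import HBNNSimple.

Let measurable_k_nnsfun (f : {nnsfun T2 >-> R}) :
  measurable_fun D (fun x => \int[k x]_z (f z)%:E)%E.
Proof.
under eq_fun do rewrite integralT_nnsfun sintegralE.
apply: emeasurable_fsum => // r.
by apply: measurable_funeM; exact: mk.
Qed.

Let integral_mixture_nnsfun (f : {nnsfun T2 >-> R}) :
  (\int[nu]_z (f z)%:E = \int[mu]_(x in D) \int[k x]_z (f z)%:E)%E.
Proof.
rewrite integralT_nnsfun sintegralE.
under [in RHS]eq_integral do rewrite integralT_nnsfun sintegralE.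
rewrite ge0_integral_fsum//; last 2 first.
- by move=> r; apply: measurable_funeM; exact: mk.
- by move=> r x _; exact: nnsfun_mulemu_ge0.
apply: eq_fsbigr => r _; rewrite nuE//.
(* A negative r is not a value of a nonnegative simple function, so its terms vanish on both
   sides. *)
have [r0|r0] := leP 0 r; first by rewrite ge0_integralZl//; exact: mk.
rewrite integral0_eq ?mule0; last by move=> x _; rewrite preimage_nnfun0.
by rewrite integral0_eq// => x _; rewrite preimage_nnfun0// measure0 mule0.
Qed.

(** The identity on sets gives simple functions, and monotone convergence is then applied at both
    levels of integration. This is how integrals against [gamma], image laws and conditional laws
    are computed. *)
Lemma integral_mixture (f : T2 -> \bar R) : (forall z, 0 <= f z)%E ->
  measurable_fun setT f ->
  (\int[nu]_z f z = \int[mu]_(x in D) \int[k x]_z f z)%E.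
Proof.
move=> f0 mf; pose f_ := nnsfun_approx measurableT mf.
have fE (m : {measure set T2 -> \bar R}) :
    (\int[m]_z f z = limn (fun n => \int[m]_z (f_ n z)%:E))%E.
  rewrite -monotone_convergence//.
  - by apply: eq_integral => z _; apply/esym/cvg_lim => //; exact: cvg_nnsfun_approx.
  - by move=> n; exact/measurable_EFinP.
  - by move=> n z _; rewrite lee_fin.
  - by move=> z _ a b ab; rewrite lee_fin; exact/lefP/nd_nnsfun_approx.
rewrite fE; under [in RHS]eq_integral do rewrite fE.
rewrite monotone_convergence//.
- by congr (limn _); apply/funext => n; exact: integral_mixture_nnsfun.
- by move=> n x _; apply: integral_ge0 => z _; rewrite lee_fin.
- move=> x _ a b ab; apply: ge0_le_integral => //.
  + by move=> z _; rewrite lee_fin.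
  + exact/measurable_EFinP.
  + exact/measurable_EFinP.
  + by move=> z _; rewrite lee_fin; exact/lefP/nd_nnsfun_approx.
Qed.

End mixtures.

(** * Borel functions, and the Borel structure of the space of finite measures *)

Section borel_functions.
Context {R : realType}.

Lemma cvg_minr {T} {F : set_system T} {FF : Filter F} (f g : T -> R) a b :
  f x @[x --> F] --> a -> g x @[x --> F] --> b ->
  Num.min (f x) (g x) @[x --> F] --> Num.min a b.
Proof.
move=> fa gb; under eq_fun do rewrite minr_absE; rewrite minr_absE.
by apply: cvgMl; apply: cvgB; [exact: cvgD|apply: cvg_norm; exact: cvgB].
Qed.

Lemma cvg_maxr {T} {F : set_system T} {FF : Filter F} (f g : T -> R) a b :
  f x @[x --> F] --> a -> g x @[x --> F] --> b ->
  Num.max (f x) (g x) @[x --> F] --> Num.max a b.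
Proof.
move=> fa gb; under eq_fun do rewrite maxr_absE; rewrite maxr_absE.
by apply: cvgMl; apply: cvgD; [exact: cvgD|apply: cvg_norm; exact: cvgB].
Qed.

Lemma open_borel (T : ptopologicalType) (U : set T) :
  open U -> measurable (U : set (borel T)).
Proof. exact: sub_sigma_algebra. Qed.

Lemma closed_borel (T : ptopologicalType) (U : set T) :
  closed U -> measurable (U : set (borel T)).
Proof.
by move=> cU; rewrite -(setCK U); apply: measurableC; apply: open_borel; exact: closed_openC.
Qed.

Lemma continuous_borel (T : ptopologicalType) (f : T -> R) :
  continuous f -> measurable_fun [set: borel T] f.
Proof.
move=> cf; apply: (measurability _ (RGenOInfty.measurableE R)) => //.
move=> _ [_ [a ->] <-]; apply: measurableI => //.
by apply: open_borel; apply: open_comp => [x _|]; [exact: cf|exact: interval_open].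
Qed.

Variable E : pmetricType R.
Implicit Types (f : E -> R) (U : set E).

Lemma lipschitz1_continuous f : (forall x y, f x <= mdist x y + f y) ->
  continuous f.
Proof.
move=> fL x; apply/cvgrPdist_le => e e0; near=> y.
have xy : mdist x y < e.
  have : ball x e y by near: y; exact: nbhsx_ballx.
  by rewrite ballEmdist.
have := fL x y; have := fL y x; rewrite metric_sym ler_distlC => yx xy'.
by apply/andP; split; lra.
Unshelve. all: by end_near. Qed.

(** The distance to the complement of U, truncated at 1. The element 1 also keeps the infimum over a
    nonempty set when U is the whole space. *)
Definition depth U (x : E) : R := inf (1 |` [set mdist x y | y in ~` U]).

Let depth_has_inf U x : has_inf (1 |` [set mdist x y | y in ~` U]).
Proof.
split; first by exists 1; left.
by exists 0 => _ [->//|[y _ <-]]; exact: mdist_ge0.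
Qed.

Lemma depth_ge0 U x : 0 <= depth U x.
Proof.
apply: lb_le_inf; first by exists 1; left.
by move=> _ [->//|[y _ <-]]; exact: mdist_ge0.
Qed.

Lemma depth_le1 U x : depth U x <= 1.
Proof. by apply: ge_inf; [exact: (depth_has_inf U x).2|left]. Qed.

Lemma depth_out U x : ~ U x -> depth U x = 0.
Proof.
move=> Ux; apply/le_anti/andP; split; last exact: depth_ge0.
apply: ge_inf; first exact: (depth_has_inf U x).2.
by right; exists x => //; rewrite mdistxx.
Qed.

Lemma depth_gt0 U x : open U -> U x -> 0 < depth U x.
Proof.
rewrite openE => /(_ x) /[apply] /nbhs_ballP[e /= e0 eU].
apply: (@lt_le_trans _ _ (Num.min 1 e)); first by rewrite lt_min ltr01.
apply: lb_le_inf; first by exists 1; left.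
move=> _ [->|[y Uy <-]]; first by rewrite ge_min lexx.
rewrite ge_min; apply/orP; right; rewrite leNgt; apply/negP => xy.
by apply: Uy; apply: eU; rewrite ballEmdist.
Qed.

Lemma depth_continuous U : continuous (depth U).
Proof.
apply: lipschitz1_continuous => x y; rewrite addrC -lerBlDr.
apply: lb_le_inf; first by exists 1; left.
move=> _ [->|[z Uz <-]].
  by rewrite lerBlDr (le_trans (depth_le1 U x))// lerDl mdist_ge0.
rewrite lerBlDr addrC; apply: le_trans (metric_triangle x y z).
apply: ge_inf; first exact: (depth_has_inf U x).2.
by right; exists z.
Qed.

Lemma cvg_depth_indic U x : open U ->
  Num.min 1 (n%:R * depth U x) @[n --> \oo] --> (\1_U x : R).
Proof.
move=> oU; rewrite indicE; apply: cvg_near_cst.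
case: (boolP (x \in U)) => [|/negP]; rewrite inE => Ux; last first.
  by apply: nearW => n; rewrite depth_out// mulr0; apply/min_idPr.
have d0 := depth_gt0 oU Ux.
have [N _ NP] := nbhs_infty_ger (depth U x)^-1.
exists N => // n /NP Nn; apply/min_idPl.
by rewrite -ler_pdivrMr// mul1r.
Qed.

End borel_functions.

Section finite_measure_space.
Context {R : realType} {E : pmetricType R}.
Implicit Types (f : E -> R) (nu : fmeas E).

Lemma fmeas_lty nu (A : set (borel E)) : measurable A -> (nu A < +oo)%E.
Proof. by move=> mA; rewrite -ge0_fin_numE//; exact: fin_num_measure. Qed.

(** The weak topology is initial for the map sending a measure to its pairings with [Cb], so pairing
    with one function is this map followed by an evaluation. *)
Lemma pairing_continuous f : continuous f -> bounded_fct f ->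
  continuous (fun nu : fmeas E => pairing f nu).
Proof.
move=> cf bf.
pose g : Cb E := exist _ f (conj cf bf).
have cw : continuous (@weak_eval R E : fmeas E -> {ptws Cb E -> R}).
  exact: initial_continuous.
move=> nu; have /cvg_sup/(_ g) h := cw nu.
have ce := @initial_continuous _ _ (fun w : Cb E -> R => w g).
have fn : Filter (@weak_eval R E @ nu) 
  by apply: fmap_filter; exact: (@nbhs_filter (fmeas E) nu).
have h' := cvg_comp _ _ (h fn) (ce _).
exact: h'.
Qed.

(** For open A the mass is a limit of pairings with the continuous functions min(1, n depth). Open
    sets are stable under intersection, and the sets with measurable evaluation form a
    lambda-system, proper differences being allowed because the measures are finite. *)
Lemma measurable_fmeas_eval (A : set (borel E)) : measurable A ->
  measurable_fun [set: borel (fmeas E)] (fun nu : fmeas E => nu A).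
Proof.
pose H := [set A : set (borel E) | measurable A /\
  measurable_fun [set: borel (fmeas E)] (fun nu : fmeas E => nu A)].
suff : <<s (@open E) >> `<=` H by move=> HH mA; have [] := HH A mA.
apply: lambda_system_subset => //; first exact: openI.
  split => //.
  + split; first exact: measurableT.
    have -> : (fun nu : fmeas E => nu setT) =
        (fun nu : fmeas E => (pairing (cst 1) nu)%:E).
      apply/funext => nu; rewrite /pairing /Rintegral (integral_cst _ _ 1)// mul1e.
      by rewrite fineK//; exact: fin_num_measure.
    apply/measurable_EFinP; apply: (@continuous_borel _ (fmeas E)).
    apply: (@pairing_continuous (cst 1)); first by move=> x; exact: cvg_cst.
    by exists 1 => x; rewrite normr1.
  + move=> {}A B BA [mA hA] [mB hB]; split; first exact: measurableD.
    rewrite (_ : (fun nu => _) = fun nu : fmeas E => (nu A - nu B)%E).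
      exact: emeasurable_funB.
    apply/funext => nu; rewrite measureD//; first by rewrite (setIidr BA).
    exact: fmeas_lty.
  + move=> F ndF FH; split.
      by apply: bigcupT_measurable => n; have [] := FH n.
    apply: (emeasurable_fun_cvg (fun n (nu : borel (fmeas E)) => (nu : fmeas E) (F n))).
      by move=> n; have [] := FH n.
    move=> nu _; apply: nondecreasing_cvg_mu => //.
      by move=> n; have [] := FH n.
    by apply: bigcupT_measurable => n; have [] := FH n.
- move=> U oU; split; first exact: open_borel.
  pose f n x : R := Num.min 1 (n%:R * depth U x).
  have f01 n x : 0 <= f n x <= 1.
    by rewrite /f le_min ler01 ge_min lexx mulr_ge0// depth_ge0.
  have cf n : continuous (f n).
    move=> x; apply: cvg_minr; first exact: cvg_cst.
    by apply: cvgM; [exact: cvg_cst|exact: depth_continuous].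
  have bf n x : `|f n x| <= 1 by have /andP[? ?] := f01 n x; rewrite ger0_norm.
  rewrite (_ : (fun nu => _) = fun nu : fmeas E => (pairing \1_U nu)%:E).
    apply/measurable_EFinP.
    apply: (measurable_fun_cvg (fun n => continuous_borel
      (pairing_continuous (cf n) _))).
      by exists 1; exact: bf.
    move=> nu _; apply: (@cvg_Rintegral_bounded _ _ _ nu setT _ _ _ _ 1) => //.
    + exact: fmeas_lty.
    + by move=> n; apply: continuous_borel.
    + by move=> x _; exact: cvg_depth_indic.
  apply/funext => nu; rewrite /pairing /Rintegral integral_indic ?setIT//.
    by rewrite fineK//; apply: fin_num_measure; exact: open_borel.
  exact: open_borel.
Qed.

End finite_measure_space.

(** * Joint measurability of the spatial motion in time and outcome *)

Section compact_balls.
Context {R : realType} {E : pmetricType R}.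
Implicit Types (c x y : E) (U : set E).

Definition cball c (r : R) : set E := [set y | mdist c y <= r].

Lemma mdist_continuous c : continuous (fun y => mdist c y : R).
Proof.
apply: lipschitz1_continuous => x y; rewrite addrC [mdist x y]metric_sym.
exact: metric_triangle.
Qed.

Lemma closed_cball c r : closed (cball c r).
Proof.
by apply: (@closed_comp _ _ (mdist c) [set z : R | z <= r]) => [x _|];
  [exact: mdist_continuous|exact: closed_le].
Qed.

Lemma open_mdist_lt c r : open [set y | mdist c y < r :> R].
Proof.
by apply: (@open_comp _ _ (mdist c) [set z : R | z < r]) => [x _|];
  [exact: mdist_continuous|exact: open_lt].
Qed.

Lemma sub_cball c r s : r <= s -> cball c r `<=` cball c s.
Proof. by move=> rs y /le_trans; apply. Qed.

Lemma compact_cballW c r s : r <= s -> compact (cball c s) -> compact (cball c r).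
Proof.
by move=> rs /subclosed_compact; apply; [exact: closed_cball|exact: sub_cball].
Qed.

Hypothesis E_lc : locally_compact [set: E].
Variable s : nat -> E.
Hypothesis dense_s : forall U, open U -> U !=set0 -> exists n, U (s n).

(** The ball of radius q already contains x; the doubled radius leaves room for cone functions to
    rise between the radii 2q and q. *)
Lemma compact_ball_basis U x : open U -> U x -> exists n (q : rat),
  [/\ mdist (s n) x < ratr q :> R, compact (cball (s n) (ratr q + ratr q)) &
      cball (s n) (ratr q + ratr q) `<=` U].
Proof.
move=> oU Ux; have /(_ x I)[K Kx [cK clK]] := E_lc.
have : nbhs x (K `&` U).
  apply: filterI; first by move: Kx; rewrite /within /=; apply: filterS => y; exact.
  exact: open_nbhs_nbhs.
move=> /nbhs_ballP[e /= e0 eKU].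
have [n] : exists n, (ball x (e / 8)) (s n).
  apply: dense_s; last by exists x; apply: ballxx; rewrite divr_gt0.
  by rewrite ballEmdist; exact: open_mdist_lt.
rewrite ballEmdist /= metric_sym => nx.
(* The centre is within e/8 of x, so q > e/8 captures x, and q < e/4 keeps e/8 + 2q below e. *)
have [q] : exists q : rat, ratr q \in `]e / 8, e / 4[.
  by apply: rat_in_itvoo; rewrite ltr_pM2l// ltf_pV2 ?posrE// ltr_nat.
rewrite in_itv /= => /andP[q8 q4]; exists n, q.
have sub : cball (s n) (ratr q + ratr q) `<=` K `&` U.
  move=> y; rewrite /cball /= => ny; apply: eKU; rewrite ballEmdist /=.
  apply: le_lt_trans (metric_triangle x (s n) y) _.
  rewrite [X in X + _]metric_sym.
  have : forall a b : R, a < e / 8 -> b <= ratr q + ratr q -> a + b < e.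
    by move=> a b; lra.
  exact.
split; first exact: lt_trans q8.
- apply: subclosed_compact cK _; first exact: closed_cball.
  by move=> y /sub[].
- by move=> y /sub[].
Qed.

End compact_balls.

Section hunt_measurability.
Context {R : realType} {E : pmetricType R} {d} {Omega : measurableType d}.
Variable xi : hunt_process E Omega.
Hypothesis E_lc : locally_compact [set: E].
Variable s : nat -> E.
Hypothesis dense_s : forall U : set E, open U -> U !=set0 -> exists n, U (s n).

Lemma measurable_Some (B : set (borel E)) : measurable B ->
  measurable (Some @` B : set (borel (Ed E))).
Proof.
have mT : measurable (Some @` [set: E] : set (borel (Ed E))).
  by apply: open_borel; apply: one_point_compactification_open_some; exact: openT.
pose H := [set B : set E | measurable (Some @` B : set (borel (Ed E)))].
suff : <<s (@open E) >> `<=` H by apply.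
apply: smallest_sub.
- split.
  + by rewrite /H /= image_set0.
  + move=> A hA; rewrite /H /= (_ : _ @` _ = Some @` setT `\` Some @` A).
      exact: measurableD.
    apply/seteqP; split => [_ [x [_ Ax] <-]|_ [[x _ <-] Ax]].
      by split; [exists x|move=> [y Ay [yx]]; apply: Ax; rewrite -yx].
    by exists x => //; split => // ?; apply: Ax; exists x.
  + move=> F hF; rewrite /H /= image_bigcup.
    exact: bigcupT_measurable.
- move=> U oU; apply: open_borel.
  exact: one_point_compactification_open_some.
Qed.

Lemma measurable_pos (t : R) (B : set (borel E)) : 0 <= t -> measurable B ->
  measurable (pos xi t @^-1` (Some @` B)).
Proof.
move=> t0 mB; apply: (@filt_sub _ _ _ _ xi t t0).
by apply: filt_adapted => //; exact: measurable_Some.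
Qed.

(* the event that xi, sampled at the next multiple of 1/(n+1) after time s,
   belongs to A *)
Let sampled (A : set E) n : set (R * Omega) :=
  \bigcup_k ([set t : R | k%:R <= t * n.+1%:R < k.+1%:R] `*`
             (pos xi (k.+1%:R / n.+1%:R) @^-1` (Some @` A))).

(** The successor makes the sampling time strictly later than t, even when t is a grid point, as
    convergence along [t^'+] demands. *)
Let next n (t : R) : R := (Num.truncn (t * n.+1%:R)).+1%:R / n.+1%:R.

Let sampledE A n t w : 0 <= t ->
  sampled A n (t, w) <-> (Some @` A) (pos xi (next n t) w).
Proof.
move=> t0; have tn : 0 <= t * n.+1%:R by rewrite mulr_ge0.
split; first by move=> [k _ [/= /truncn_def kt]]; rewrite /next kt.
move=> At; exists (Num.truncn (t * n.+1%:R)) => //; split => //=.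
exact: truncn_itv.
Qed.

Let measurable_sampled (A : set (borel E)) n : measurable A ->
  measurable (sampled A n).
Proof.
move=> mA; apply: bigcupT_measurable => k; apply: measurableX.
  rewrite (_ : mkset _ = `[k%:R / n.+1%:R, k.+1%:R / n.+1%:R[%classic)//.
  by apply/seteqP; split => t /=; rewrite in_itv /= ler_pdivrMr// ltr_pdivlMr.
by apply: measurable_pos.
Qed.

Let cvg_next (t : R) : 0 <= t -> next n t @[n --> \oo] --> t^'+.
Proof.
move=> t0 U [e /= e0 eU].
have [N _ NP] := nbhs_infty_ger e^-1.
exists N => // n /= /NP Nn; apply: eU.
  rewrite /next /ball /= ltr_distlC.
  have /truncn_itv/andP[h1 h2] : 0 <= t * n.+1%:R by rewrite mulr_ge0.
  rewrite ltr_pdivrMr// ltr_pdivlMr//; apply/andP; split.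
    by apply: le_lt_trans h2; rewrite ler_pM2r// gerBl ltW.
  rewrite mulrDl -addn1 natrD.
  apply: ler_ltD => //.
  rewrite -ltr_pdivrMl// mulr1; apply: (le_lt_trans Nn).
  by rewrite ltr_nat.
by rewrite /next ltr_pdivlMr// truncnS_gt.
Qed.

(** The open ball is the union of the closed balls [F j]. By right continuity, lying in it at time t
    amounts to being eventually sampled in some [F j]; for the converse [F j] must be closed in the
    one-point compactification, which its compactness ensures. *)
Lemma measurable_pos_time_cball c r : compact (cball c r) ->
  measurable [set z : R * Omega | 0 <= z.1 /\
    (Some @` [set y : E | mdist c y < r]) (pos xi z.1 z.2)].
Proof.
move=> cr; pose F (j : nat) := cball c (r - j.+1%:R^-1).
have Fr j : r - j.+1%:R^-1 <= r by rewrite gerBl.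
have cF j : compact (F j) by exact: compact_cballW (Fr j) cr.
have FS j : @open (Ed E) (~` (Some @` F j)).
  rewrite openE => -[x|]; rewrite /interior => Fx /=.
    have xF : ~ F j x by move=> ?; apply: Fx; exists x.
    have : nbhs x (~` F j).
      by apply: open_nbhs_nbhs; split => //; apply/closed_openC/closed_cball.
    by apply: filterS => y Fy [z Fz [zy]]; apply: Fy; rewrite -zy.
  exists (F j); first by split; [exact: cF|exact: closed_cball].
  by move=> _ [[y Fy <-] [z Fz [zy]]|-> [? ?]//]; apply: Fy; rewrite -zy.
rewrite (_ : mkset _ = ([set` `[0, +oo[] `*` setT) `&`
    \bigcup_j \bigcup_N \bigcap_(n in [set n | (N <= n)%N]) sampled (F j) n).
  apply: measurableI; first exact: measurableX.
  apply: bigcupT_measurable => j; apply: bigcupT_measurable => N.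
  apply: bigcap_measurable; first by exists N => /=.
  by move=> n _; apply: measurable_sampled; apply: closed_borel; exact: closed_cball.
apply/seteqP; split => -[t w] /=.
- move=> [t0 [x xr xt]]; split; first by rewrite in_itv /= andbT.
  have [j jx] : exists j : nat, mdist c x < r - j.+1%:R^-1.
    have [N _ NP] := nbhs_infty_ger (r - mdist c x)^-1.
    have := NP N (leqnn N) => /= Nr.
    exists N; rewrite ltrBrDr addrC -ltrBrDr invf_plt ?posrE//; last first.
      by rewrite subr_gt0.
    by apply: (le_lt_trans Nr); rewrite ltr_nat.
  have : nbhs (pos xi t w) (Some @` [set y : E | mdist c y < r - j.+1%:R^-1]).
    rewrite -xt; apply: one_point_compactification_some_nbhs.
    by apply: open_nbhs_nbhs; split => //; exact: open_mdist_lt.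
  move=> /(@pos_right _ _ _ _ xi t w t0)/(cvg_next t0)[N _ NP].
  exists j => //; exists N => // n /NP [y yr yn]; apply/sampledE => //.
  by exists y => //; exact: ltW.
- rewrite in_itv /= andbT => -[[t0 _] [j _ [N _ NF]]]; split => //.
  apply: contrapT => /= Ft.
  have : (~` (Some @` F j)) (pos xi t w).
    move=> [y Fy yt]; apply: Ft; exists y => //.
    by apply: le_lt_trans Fy _; rewrite ltrBlDr ltrDl.
  move=> Fj; have : nbhs (pos xi t w) (~` (Some @` F j)).
    by apply: open_nbhs_nbhs; split => //; exact: FS.
  move=> /(@pos_right _ _ _ _ xi t w t0)/(cvg_next t0)[M _ MP].
  have := MP (maxn N M) (leq_maxr _ _); apply.
  by apply/sampledE => //; apply: NF; exact: leq_maxl.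
Qed.

(** An open set is the countable union of the rational balls that it contains and whose closed
    counterparts are compact. Complements are taken relative to the event of being alive, since the
    image under [Some] always misses the cemetery. *)
Lemma measurable_pos_time (B : set (borel E)) : measurable B ->
  measurable [set z : R * Omega | 0 <= z.1 /\ (Some @` B) (pos xi z.1 z.2)].
Proof.
pose H := [set B : set E |
  measurable [set z : R * Omega | 0 <= z.1 /\ (Some @` B) (pos xi z.1 z.2)]].
have HU (F : nat -> set E) : (forall n, H (F n)) -> H (\bigcup_n F n).
  move=> hF; rewrite /H /= (_ : mkset _ = \bigcup_n [set z : R * Omega |
      0 <= z.1 /\ (Some @` F n) (pos xi z.1 z.2)]).
    by apply: bigcupT_measurable => n; exact: hF.
  apply/seteqP; split => z /=.
    by move=> [z0 [x [n _ Fx] xz]]; exists n => //; split => //; exists x.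
  by move=> [n _ [z0 [x Fx xz]]]; split => //; exists x => //; exists n.
have HO U : open U -> H U.
  move=> oU.
  pose P (i : nat * rat) := compact (cball (s i.1) (ratr i.2)) /\
    [set y | mdist (s i.1) y < ratr i.2 :> R] `<=` U.
  pose G (n : nat) : set E := if @unpickle (nat * rat)%type n is Some i then
    if `[< P i >] then [set y | mdist (s i.1) y < ratr i.2 :> R] else set0 else set0.
  suff -> : U = \bigcup_n G n.
    apply: HU => n; rewrite /G.
    have H0 : H set0.
      rewrite /H /= (_ : mkset _ = set0)//.
      by apply/seteqP; split => // z /= [_ [? []]].
    case: unpickle => // i; case: asboolP => // -[ci _].
    exact: measurable_pos_time_cball.
  apply/seteqP; split => [x Ux|x [n _]]; last first.
    rewrite /G; case: unpickle => // i; case: asboolP => // -[_]; exact.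
  have [n [q [nx cq qU]]] := compact_ball_basis E_lc dense_s oU Ux.
  have q0 : 0 <= ratr q :> R by apply: le_trans (ltW nx); exact: mdist_ge0.
  exists (pickle (n, q)) => //; rewrite /G pickleK; case: asboolP => // -[].
  split => /=; first by apply: compact_cballW cq; rewrite lerDl.
  by move=> y /= yq; apply: qU; rewrite /cball /= (le_trans (ltW yq))// lerDl.
suff : <<s (@open E) >> `<=` H by apply.
apply: smallest_sub => //; split.
- by have := HO _ open0.
- move=> A hA; rewrite /H /= (_ : mkset _ =
    [set z : R * Omega | 0 <= z.1 /\ (Some @` [set: E]) (pos xi z.1 z.2)] `\`
    [set z : R * Omega | 0 <= z.1 /\ (Some @` A) (pos xi z.1 z.2)]).
    by apply: measurableD => //; exact: (HO _ openT).
  apply/seteqP; split => z /=.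
    move=> [z0 [x [_ Ax] xz]]; split; first by split => //; exists x.
    by move=> [_ [y Ay yz]]; apply: Ax; move: yz; rewrite -xz => -[<-].
  move=> [[z0 [x _ xz]] nA]; split => //; exists x => //; split => // Ax.
  by apply: nA; split => //; exists x.
- exact: HU.
Qed.

Definition alive : set (R * Omega) :=
  [set z | 0 <= z.1 /\ (Some @` [set: E]) (pos xi z.1 z.2)].

(** After death or at negative times the value is the base point, an arbitrary default which [extE]
    multiplies by 0. *)
Definition site (z : R * Omega) : borel E :=
  if z \in alive then odflt point (pos xi z.1 z.2) else point.

Lemma measurable_site : measurable_fun setT site.
Proof.
move=> _ B mB; rewrite setTI.
rewrite (_ : site @^-1` B =
    [set z : R * Omega | 0 <= z.1 /\ (Some @` B) (pos xi z.1 z.2)] `|`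
    (~` alive `&` (cst (point : E) @^-1` B))).
  apply: measurableU; first exact: measurable_pos_time.
  apply: measurableI; first by apply: measurableC; exact: measurable_pos_time.
  by rewrite preimage_cst; case: ifP.
apply/seteqP; split => z; rewrite /site /=.
  case: (boolP (z \in alive)); rewrite ?inE ?notin_setE => al Bz.
    case: al => z0 [x _ xz]; left; split => //; exists x => //.
    by move: Bz; rewrite -xz.
  by right.
case=> [[z0 [x Bx xz]]|[al Bz]].
  rewrite ifT; first by rewrite -xz.
  by rewrite inE; split => //; exists x.
by rewrite ifF//; apply/negbTE; rewrite notin_setE.
Qed.

Lemma extE (f : E -> R) t w : 0 <= t ->
  ext f (pos xi t w) = \1_alive (t, w) * f (site (t, w)).
Proof.
move=> t0; rewrite indicE /site; case: (boolP (_ \in alive)); rewrite ?inE => al.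
  by case: al => _ [x _] /= <- /=; rewrite mul1r.
rewrite mul0r /ext; case xt: (pos xi t w) => [x|//].
by move: al; rewrite notin_setE => -[]; split => //=; rewrite xt; exists x.
Qed.

Lemma measurable_indic_alive : measurable_fun setT (\1_alive : R * Omega -> R).
Proof. by apply/measurable_indicP; apply: measurable_pos_time; exact: measurableT. Qed.

End hunt_measurability.

(** * Fubini's theorem and time integrals along the motion *)

Section bounded_Fubini.
Context d1 d2 (T1 : measurableType d1) (T2 : measurableType d2) (R : realType).
Variables (m1 : {sigma_finite_measure set T1 -> \bar R})
  (m2 : {sigma_finite_measure set T2 -> \bar R}) (D : set T1).
Hypotheses (mD : measurable D) (fD : (m1 D < +oo)%E) (f2 : (m2 setT < +oo)%E).
Variables (f : T1 * T2 -> R) (M : R).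
Hypotheses (mf : measurable_fun setT f) (fM : forall z, D z.1 -> `|f z| <= M).

(** The function f is bounded over D only, while Fubini's theorem is applied on the whole product:
    hence the factor [\1_D]. *)
Let g z := \1_D z.1 * f z.

Let mg : measurable_fun setT g.
Proof.
apply: measurable_funM => //.
by apply: measurableT_comp; [exact: measurable_indic|exact: measurable_fst].
Qed.

Let gM z : `|g z| <= \1_D z.1 * M.
Proof.
rewrite /g indicE; case: (boolP (z.1 \in D)); rewrite ?inE => Dz.
  by rewrite !mul1r fM.
by rewrite !mul0r normr0.
Qed.

Let g_section_le x y : `|g (x, y)| <= `|M|.
Proof.
apply: le_trans (gM _) _; rewrite indicE; case: (_ \in _); first by rewrite mul1r ler_norm.
by rewrite mul0r.
Qed.

Let int_g2 x : m2.-integrable setT (fun y => (g (x, y))%:E).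
Proof.
apply: (integrable_bounded measurableT f2) => [|y _]; last exact: g_section_le.
exact: measurableT_comp mg (measurable_pair1 x).
Qed.

Let int_g1 y : m1.-integrable setT (fun x => (g (x, y))%:E).
Proof.
apply: (@le_integrable _ _ _ m1 setT measurableT _ (fun x => (\1_D x * M)%:E)).
- apply/measurable_EFinP; exact: measurableT_comp mg (measurable_pair2 y).
- by move=> x _ /=; rewrite lee_fin (le_trans (gM _))// ler_norm.
- apply: (eq_integrable measurableT (((fun=> M%:E) : T1 -> \bar R) \_ D)%E).
    move=> x _; rewrite patchE indicE; case: ifP => _; by rewrite ?mul1r ?mul0r.
  apply/integrable_restrict => //; rewrite setTI.
  by apply: (integrable_bounded mD fD (f := cst M) (M := `|M|)).
Qed.

Let int_g : (m1 \x m2)%E.-integrable setT (EFin \o g).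
Proof.
apply/integrable12ltyP; first exact/measurable_EFinP.
apply: (@le_lt_trans _ _ (\int[m1]_x (\1_D x * (`|M| * fine (m2 setT)))%:E)%E).
  apply: ge0_le_integral => //.
  - by move=> x _; exact: integral_ge0.
  - have mag : measurable_fun setT (abse \o (EFin \o g)).
      by apply: measurableT_comp => //; exact/measurable_EFinP.
    rewrite (_ : (fun x => _) = fubini_F m2 (abse \o (EFin \o g)))//.
    by apply: measurable_fun_fubini_tonelli_F => // z; exact: abse_ge0.
  - by apply/measurable_EFinP; apply: measurable_funM => //; exact: measurable_indic.
  - move=> x _.
    apply: (@le_trans _ _ (\int[m2]_y cst (\1_D x * `|M|)%:E y)%E).
      apply: ge0_le_integral => //.
      + by apply: measurableT_comp => //; apply/measurable_EFinP;
          exact: measurableT_comp mg (measurable_pair1 x).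
      + move=> y _ /=; rewrite lee_fin; apply: le_trans (gM _) _ => /=.
        by rewrite ler_wpM2l// ler_norm.
    rewrite integral_cst// -[X in (_ * X <= _)%E]fineK ?ge0_fin_numE//.
    by rewrite -EFinM mulrA.
under eq_integral do rewrite EFinM.
rewrite ge0_integralZr//; last 2 first.
- by apply/measurable_EFinP; exact: measurable_indic.
- by rewrite lee_fin mulr_ge0// fine_ge0.
by rewrite integral_indic// setIT lte_mul_pinfty// ?ge0_fin_numE// ltry.
Qed.

Lemma measurable_Rintegral_snd : measurable_fun setT (fun x => \int[m2]_y f (x, y)).
Proof. exact: (measurable_param_Rintegral (l := fun=> m2)). Qed.

Lemma Rintegral_prod_fst :
  \int[(m1 \x m2)%E]_(z in D `*` setT) f z = \int[m1]_(x in D) \int[m2]_y f (x, y).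
Proof.
rewrite [LHS]Rintegral_mkcond [RHS]Rintegral_mkcond.
transitivity (\int[(m1 \x m2)%E]_z g z).
  apply: eq_Rintegral => -[x y] _; rewrite patchE /g indicE in_setX in_setT andbT.
  by case: ifP => _; rewrite ?mul1r ?mul0r.
rewrite /Rintegral -(integral12_prod_meas1 int_g); congr fine.
apply: eq_integral => x _; rewrite /fubini_F patchE.
have intE : (\int[m2]_y (g (x, y))%:E = \int[m2]_y (\1_D x * f (x, y))%:E)%E by [].
case: ifP => xD.
  have <- : (\int[m2]_y (g (x, y))%:E = \int[m2]_y (f (x, y))%:E)%E.
    by rewrite intE indicE xD; under eq_integral do rewrite mul1r.
  by rewrite fineK//; exact: integrable_fin_num (int_g2 x).
rewrite [LHS]intE indicE xD; under eq_integral do rewrite mul0r.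
by rewrite integral0.
Qed.

Lemma Rintegral_prod_snd :
  \int[(m1 \x m2)%E]_(z in D `*` setT) f z = \int[m2]_y \int[m1]_(x in D) f (x, y).
Proof.
rewrite [LHS]Rintegral_mkcond.
transitivity (\int[(m1 \x m2)%E]_z g z).
  apply: eq_Rintegral => -[x y] _; rewrite patchE /g indicE in_setX in_setT andbT.
  by case: ifP => _; rewrite ?mul1r ?mul0r.
rewrite /Rintegral -(integral21_prod_meas1 int_g); congr fine.
apply: eq_integral => y _; rewrite /fubini_G.
have <- : (\int[m1]_x (g (x, y))%:E = \int[m1]_(x in D) (f (x, y))%:E)%E.
  rewrite [RHS]integral_mkcond; apply: eq_integral => x _; rewrite patchE /g indicE /=.
  by case: ifP => _; rewrite ?mul1r ?mul0r.
by rewrite fineK//; exact: integrable_fin_num (int_g1 y).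
Qed.

End bounded_Fubini.

Section finite_measure_of.
Context d (T : measurableType d) (R : realType) (mu : {measure set T -> \bar R}).

(** An alias that carries the proof of finiteness, so that the law of the motion at a fixed starting
    point can be a factor of a product measure. *)
Definition finite_measure_of of fin_num_fun mu : set T -> \bar R := mu.
Hypothesis fmu : fin_num_fun mu.

HB.instance Definition _ := Measure.copy (finite_measure_of fmu) mu.
HB.instance Definition _ :=
  @Measure_isFinite.Build _ _ _ (finite_measure_of fmu) fmu.

End finite_measure_of.

Section time_integrals.
Context {R : realType} {E : pmetricType R} {d} {Omega : measurableType d}.
Variable xi : hunt_process E Omega.
Hypothesis E_lc : locally_compact [set: E].
Variable s : nat -> E.
Hypothesis dense_s : forall U : set E, open U -> U !=set0 -> exists n, U (s n).
Implicit Types (f : E -> R) (g : R -> E -> R) (t r M : R) (x y : E).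

Local Notation leb := (@lebesgue_measure R).
Local Notation jmeasurable g :=
  (measurable_fun setT (fun z : R * borel E => g z.1 z.2)).

Lemma law_setT z : law xi z setT = 1%E.
Proof. exact: prob_kernel. Qed.

Let lebt t : (leb `[0%R, t]%classic < +oo)%E.
Proof. by rewrite lebesgue_measure_itv /=; case: ifP => _; rewrite ?ltry// -EFinB ltry. Qed.

(** The value of [g] along the path, as a jointly measurable function of time and outcome; it is 0
    after death and at negative times, which [alive] excludes. *)
Definition occ g (z : R * Omega) : R := \1_(alive xi) z * g z.1 (site xi z).

Lemma measurable_occ g : jmeasurable g -> measurable_fun setT (occ g).
Proof.
move=> mg; apply: measurable_funM; first exact: (measurable_indic_alive xi E_lc dense_s).
have mh : measurable_fun setT (fun z : R * Omega => (z.1, site xi z) : R * borel E).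
  by apply: measurable_fun_pair => //; exact: (measurable_site xi E_lc dense_s).
exact: measurableT_comp mg mh.
Qed.

Let occM g t M : (forall r y, 0 <= r -> r <= t -> `|g r y| <= M) ->
  forall z : R * Omega, `[0, t]%classic z.1 -> `|occ g z| <= M.
Proof.
move=> gM z; rewrite /= in_itv /= => /andP[z0 zt].
rewrite /occ indicE; case: (_ \in _); first by rewrite mul1r gM.
by rewrite mul0r normr0; apply: le_trans (gM z.1 point z0 zt).
Qed.

Lemma PtE t f x : 0 <= t -> Pt xi t f x = \int[law xi (Some x)]_w occ (fun=> f) (t, w).
Proof.
by move=> t0; apply: eq_Rintegral => w _; rewrite extE.
Qed.

Lemma time_integral_ext t g g' x : (forall r y, 0 <= r -> r <= t -> g r y = g' r y) ->
  time_integral xi t g x = time_integral xi t g' x.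
Proof.
move=> gg; apply: eq_Rintegral => w _; apply: eq_Rintegral => r.
rewrite inE /= in_itv /= => /andP[r0 rt].
by rewrite /ext; case: (pos xi r w) => // y; exact: gg.
Qed.

Let time_integral_occ t g x : time_integral xi t g x =
  \int[law xi (Some x)]_w \int[leb]_(r in `[0, t]) occ g (r, w).
Proof.
apply: eq_Rintegral => w _; apply: eq_Rintegral => r.
by rewrite inE /= in_itv /= => /andP[r0 rt]; rewrite extE.
Qed.

Section fixed_law.
Variable x : E.

Let law_fin : fin_num_fun (law xi (Some x)).
Proof.
move=> U mU; rewrite ge0_fin_numE//; apply: (@le_lt_trans _ _ 1%E); last exact: ltry.
by rewrite -(law_setT (Some x)); apply: le_measure; rewrite ?inE.
Qed.

Let P : {finite_measure set Omega -> \bar R} := finite_measure_of law_fin.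

Let lawP : law xi (Some x) = P :> {measure set Omega -> \bar R}.
Proof. exact: eq_measure. Qed.

Let P1 : P setT = 1%E.
Proof. by have := law_setT (Some x); rewrite lawP. Qed.

Let Poo : (P setT < +oo)%E.
Proof. by rewrite P1 ltry. Qed.

Let mt t : measurable (`[0, t]%classic : set R). Proof. by []. Qed.

Let time_integral_prod t g M : jmeasurable g ->
  (forall r y, 0 <= r -> r <= t -> `|g r y| <= M) ->
  time_integral xi t g x = \int[(leb \x P)%E]_(z in `[0, t]%classic `*` setT) occ g z.
Proof.
move=> mg gM; rewrite time_integral_occ lawP.
by rewrite (Rintegral_prod_snd (m1 := leb) (mt t) (lebt t) Poo (measurable_occ mg) (occM gM)).
Qed.

Lemma time_integral_Pt t g M : jmeasurable g ->
  (forall r y, 0 <= r -> r <= t -> `|g r y| <= M) ->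
  time_integral xi t g x = \int[leb]_(r in `[0, t]) Pt xi r (g r) x.
Proof.
move=> mg gM; rewrite (time_integral_prod mg gM).
rewrite (Rintegral_prod_fst (m1 := leb) (mt t) (lebt t) Poo (measurable_occ mg) (occM gM)).
apply: eq_Rintegral => r; rewrite inE /= in_itv /= => /andP[r0 rt].
by rewrite PtE// lawP.
Qed.

Let dom t : set (measurableTypeR R * Omega) := `[0, t]%classic `*` [set: Omega].

Let mdom t : measurable (dom t). Proof. exact: measurableX. Qed.

Let fdom t : ((leb \x P) (dom t) < +oo)%E.
Proof.
rewrite /dom product_measure1E//.
apply: lte_mul_pinfty => //.
by rewrite ge0_fin_numE//; exact: lebt.
Qed.

Let domM t g M : (forall r y, 0 <= r -> r <= t -> `|g r y| <= M) ->
  forall z, dom t z -> `|occ g z| <= M.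
Proof. by move=> gM z [z1 _]; exact: occM gM z z1. Qed.

Let int_occ t g M : jmeasurable g ->
  (forall r y, 0 <= r -> r <= t -> `|g r y| <= M) ->
  (leb \x P)%E.-integrable (dom t) (EFin \o occ g).
Proof.
move=> mg gM; apply: (integrable_bounded (mu := (leb \x P)%E) (mdom t) (fdom t) (M := M)); last exact: domM gM.
by apply: measurable_funTS; exact: measurable_occ.
Qed.

Lemma time_integralD t g1 g2 M1 M2 : jmeasurable g1 -> jmeasurable g2 ->
  (forall r y, 0 <= r -> r <= t -> `|g1 r y| <= M1) ->
  (forall r y, 0 <= r -> r <= t -> `|g2 r y| <= M2) ->
  time_integral xi t (fun r y => g1 r y + g2 r y) x =
  time_integral xi t g1 x + time_integral xi t g2 x.
Proof.
move=> m1 m2 b1 b2.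
have m12 : jmeasurable (fun r y => g1 r y + g2 r y) by exact: measurable_funD.
have b12 r y : 0 <= r -> r <= t -> `|g1 r y + g2 r y| <= M1 + M2.
  by move=> r0 rt; rewrite (le_trans (ler_normD _ _))// lerD ?b1 ?b2.
rewrite (time_integral_prod m12 b12) (time_integral_prod m1 b1)
  (time_integral_prod m2 b2).
rewrite -(RintegralD (mdom t) (int_occ m1 b1) (int_occ m2 b2)).
by apply: eq_Rintegral => z _; rewrite /occ mulrDr.
Qed.

Lemma time_integralB t g1 g2 M1 M2 : jmeasurable g1 -> jmeasurable g2 ->
  (forall r y, 0 <= r -> r <= t -> `|g1 r y| <= M1) ->
  (forall r y, 0 <= r -> r <= t -> `|g2 r y| <= M2) ->
  time_integral xi t (fun r y => g1 r y - g2 r y) x =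
  time_integral xi t g1 x - time_integral xi t g2 x.
Proof.
move=> m1 m2 b1 b2.
have m12 : jmeasurable (fun r y => g1 r y - g2 r y) by exact: measurable_funB.
have b12 r y : 0 <= r -> r <= t -> `|g1 r y - g2 r y| <= M1 + M2.
  by move=> r0 rt; rewrite (le_trans (ler_normB _ _))// lerD ?b1 ?b2.
rewrite (time_integral_prod m12 b12) (time_integral_prod m1 b1)
  (time_integral_prod m2 b2).
rewrite -(RintegralB (mdom t) (int_occ m1 b1) (int_occ m2 b2)).
by apply: eq_Rintegral => z _; rewrite /occ mulrBr.
Qed.

Lemma time_integralZ t g (c M : R) : jmeasurable g ->
  (forall r y, 0 <= r -> r <= t -> `|g r y| <= M) ->
  time_integral xi t (fun r y => c * g r y) x = c * time_integral xi t g x.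
Proof.
move=> mg gM.
have mc : jmeasurable (fun r y => c * g r y) by exact: measurable_funM.
have bc r y : 0 <= r -> r <= t -> `|c * g r y| <= `|c| * M.
  by move=> r0 rt; rewrite normrM ler_wpM2l// gM.
rewrite (time_integral_prod mc bc) (time_integral_prod mg gM).
rewrite -(RintegralZl c (mdom t) (int_occ mg gM)).
by apply: eq_Rintegral => z _; rewrite /occ mulrCA.
Qed.

Lemma le_time_integral t g1 g2 M1 M2 : jmeasurable g1 -> jmeasurable g2 ->
  (forall r y, 0 <= r -> r <= t -> `|g1 r y| <= M1) ->
  (forall r y, 0 <= r -> r <= t -> `|g2 r y| <= M2) ->
  (forall r y, 0 <= r -> r <= t -> g1 r y <= g2 r y) ->
  time_integral xi t g1 x <= time_integral xi t g2 x.
Proof.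
move=> m1 m2 b1 b2 g12.
rewrite (time_integral_prod m1 b1) (time_integral_prod m2 b2).
apply: (le_Rintegral (mdom t) (int_occ m1 b1) (int_occ m2 b2)).
move=> z [/=]; rewrite in_itv /= => /andP[z0 zt] _.
by rewrite /occ ler_wpM2l// g12.
Qed.

Lemma cvg_time_integral t (g_ : nat -> R -> E -> R) g M :
  (forall n, jmeasurable (g_ n)) ->
  (forall n r y, 0 <= r -> r <= t -> `|g_ n r y| <= M) ->
  (forall r y, 0 <= r -> r <= t -> g_ n r y @[n --> \oo] --> g r y) ->
  jmeasurable g ->
  time_integral xi t (g_ n) x @[n --> \oo] --> time_integral xi t g x.
Proof.
move=> mg gM gg mg'.
have gM' r y : 0 <= r -> r <= t -> `|g r y| <= M.
  move=> r0 rt; have nf : `|g_ n r y| @[n --> \oo] --> `|g r y|.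
    by apply: cvg_norm; exact: gg.
  by apply: (cvgr_to_le nf); apply: nearW => n; exact: gM.
under eq_fun do rewrite (time_integral_prod (mg _) (gM _)).
rewrite (time_integral_prod mg' gM').
apply: (cvg_Rintegral_bounded (mu := (leb \x P)%E) (mdom t) (fdom t) (M := M)).
- by move=> n; apply: measurable_funTS; exact: measurable_occ.
- by move=> n; exact: domM (gM n).
- move=> z [/=]; rewrite in_itv /= => /andP[z0 zt] _.
  by apply: cvgMr; exact: gg.
Qed.

(** A dead path contributes 0 to the mean, so the upper bound c has to be nonnegative. *)
Lemma Pt_le r f M c : 0 <= r -> measurable_fun [set: borel E] f ->
  (forall y, `|f y| <= M) -> 0 <= c -> (forall y, f y <= c) -> Pt xi r f x <= c.
Proof.
move=> r0 mf fM c0 fc; rewrite PtE// lawP.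
have -> : c = \int[P]_w cst c w by rewrite Rintegral_cst// (_ : fine _ = 1) ?mulr1//; exact: (congr1 fine P1).
apply: le_Rintegral => //.
- apply: (integrable_bounded measurableT Poo (M := M)).
    have mo : measurable_fun setT (occ (fun=> f)).
      by apply: measurable_occ; exact: measurableT_comp mf measurable_snd.
    exact: measurableT_comp mo (measurable_pair1 r).
  by move=> w _; apply: (@occM (fun=> f) r) => //; rewrite /= in_itv /= r0 lexx.
- by apply: (integrable_bounded measurableT Poo (M := `|c|)).
- by move=> w _; rewrite /occ indicE; case: (_ \in _); rewrite ?mul1r ?mul0r.
Qed.

Lemma time_integral_le_int t g M (B : R -> R) (MB : R) : jmeasurable g ->
  (forall r y, 0 <= r -> r <= t -> `|g r y| <= M) ->
  measurable_fun setT B -> (forall r, 0 <= r -> r <= t -> `|B r| <= MB) ->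
  (forall r, 0 <= r -> r <= t -> Pt xi r (g r) x <= B r) ->
  time_integral xi t g x <= \int[leb]_(r in `[0, t]) B r.
Proof.
move=> mg gM mB BM PB; rewrite (time_integral_Pt mg gM).
have bP r : `[0, t]%classic r -> `|Pt xi r (g r) x| <= M.
  rewrite /= in_itv /= => /andP[r0 rt]; rewrite PtE// lawP.
  rewrite (le_trans (normr_Rintegral_le measurableT Poo (M := M) _ _))//.
  - have := measurable_occ mg => /measurableT_comp/(_ (measurable_pair1 r)).
    exact.
  - by move=> w _; apply: (occM gM); rewrite /= in_itv /= r0.
  - by rewrite (_ : fine _ = 1) ?mulr1//; exact: (congr1 fine P1).
apply: le_Rintegral => //.
- apply: (integrable_bounded (mu := leb) (mt t) (lebt t) (M := M)) => //.
  have mI := measurable_Rintegral_snd Poo (measurable_occ mg).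
  apply: (eq_measurable_fun (fun r => \int[P]_w occ g (r, w))).
    move=> r; rewrite inE /= in_itv /= => /andP[r0 rt].
    by rewrite PtE// lawP.
  exact: measurable_funTS.
- apply: (integrable_bounded (mu := leb) (mt t) (lebt t) (M := MB)).
    exact: measurable_funTS.
  by move=> r /=; rewrite in_itv /= => /andP[]; exact: BM.
- by move=> r /=; rewrite in_itv /= => /andP[]; exact: PB.
Qed.

End fixed_law.
End time_integrals.

(** * Mixtures of measures and the decomposition of the branching mechanism *)

Section mixture_measures.
Context d1 d2 (T1 : measurableType d1) (T2 : measurableType d2) (R : realType).
Variables (mu : {measure set T1 -> \bar R}) (D : set T1)
  (k : T1 -> {measure set T2 -> \bar R}).

Definition mixture_measure of measurable D &
    (forall U, measurable U -> measurable_fun D (k ^~ U)) : set T2 -> \bar R :=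
  fun U => (\int[mu]_(x in D) k x U)%E.

Hypotheses (mD : measurable D)
  (mk : forall U, measurable U -> measurable_fun D (k ^~ U)).

Let mixture0 : mixture_measure mD mk set0 = 0%E.
Proof. by apply: integral0_eq => x _; rewrite measure0. Qed.

Let mixture_ge0 U : (0 <= mixture_measure mD mk U)%E.
Proof. exact: integral_ge0. Qed.

Let mixture_sigma_additive : semi_sigma_additive (mixture_measure mD mk).
Proof.
move=> F mF tF mUF; rewrite /mixture_measure.
rewrite [X in _ --> X](_ : _ = \sum_(0 <= n <oo) \int[mu]_(x in D) k x (F n))%E.
  by apply: is_cvg_ereal_nneg_natsum_cond => n _ _; exact: integral_ge0.
rewrite -integral_nneseries//; last by move=> n; exact: mk.
by apply: eq_integral => x _; rewrite measure_semi_bigcup.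
Qed.

HB.instance Definition _ := isMeasure.Build _ _ _ (mixture_measure mD mk)
  mixture0 mixture_ge0 mixture_sigma_additive.

End mixture_measures.

(** The restriction of [mu] to D is the mixture of the Dirac masses at the points of D. *)
Lemma integral_mrestr d (T : measurableType d) (R : realType)
    (mu : {measure set T -> \bar R}) (D : set T) (mD : measurable D)
    (f : T -> \bar R) : (forall x, 0 <= f x)%E -> measurable_fun setT f ->
  (\int[mrestr mu mD]_x f x = \int[mu]_(x in D) f x)%E.
Proof.
move=> f0 mf.
have mk U : measurable U -> measurable_fun D (fun x : T => \d_x U : \bar R).
  by move=> mU; apply/measurable_EFinP; apply: measurable_indic.
rewrite (integral_mixture (mu := mu) (nu := mrestr mu mD) mD mk)//.
  by apply: eq_integral => x _; rewrite integral_dirac// diracT mul1e.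
by move=> U mU; rewrite /mrestr integral_indic// setIC.
Qed.

Section second_order_remainder.
Context {R : realType}.
Implicit Types y z : R.

Definition rem2 y := expR (- y) - 1 + y.

Lemma rem2_ge0 y : 0 <= rem2 y.
Proof. by rewrite /rem2; have := expR_ge1Dx (- y); lra. Qed.

Lemma rem2_le y : 0 <= y -> rem2 y <= y.
Proof.
move=> y0; rewrite /rem2; have : expR (- y) <= 1 by rewrite expR_le1 oppr_le0.
lra.
Qed.

Lemma rem2_le_sqr y : 0 <= y -> rem2 y <= y ^+ 2.
Proof.
move=> y0; rewrite /rem2.
have y1 : 0 < 1 + y by lra.
have : expR (- y) <= (1 + y)^-1.
  by rewrite expRN lef_pV2 ?posrE ?expR_gt0//; exact: expR_ge1Dx.
have : (1 + y)^-1 <= 1 - y + y ^+ 2.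
  rewrite -[leLHS]mulr1 ler_pdivrMl// (_ : _ * _ = 1 + y ^+ 3); last by ring.
  by rewrite lerDl exprn_ge0.
lra.
Qed.

(** The power interpolates: y^2 <= y^q up to 1 and y <= y^q beyond. *)
Lemma rem2_le_powR y (q : R) : 1 < q -> q <= 2 -> 0 <= y -> rem2 y <= y `^ q.
Proof.
move=> q1 q2; rewrite le_eqVlt => /predU1P[<-|y0].
  by rewrite /rem2 oppr0 expR0 subrr add0r powR_ge0.
have [y1|y1] := leP y 1.
  apply: le_trans (rem2_le_sqr (ltW y0)) _.
  by rewrite -(powR_mulrn 2 (ltW y0)) ger_powR ?y0.
apply: le_trans (rem2_le (ltW y0)) _.
by rewrite le1r_powR ?ltW.
Qed.

(** For y <= 2, (1 - y/2)^2 <= e^{-y} gives rem2 y >= y^2 / 4; beyond 2 already rem2 y >= y - 1. *)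
Lemma rem2_ge y : 1 <= `|y| -> 4^-1 <= rem2 y.
Proof.
have [y2|y2] := leP y 2; last first.
  move=> _; rewrite /rem2; have := expR_ge0 (- y); lra.
move=> y1.
have e1 : 1 - y / 2 <= expR (- (y / 2)) by apply: le_trans (expR_ge1Dx _); lra.
have e2 : (1 - y / 2) ^+ 2 <= expR (- y).
  rewrite (_ : expR (- y) = expR (- (y / 2)) ^+ 2).
    by rewrite lerXn2r// ?nnegrE ?expR_ge0//; lra.
  by rewrite -expRM_natl; congr expR; field.
have : 1 <= y ^+ 2 by rewrite -real_normK ?num_real// exprn_ege1.
rewrite /rem2; move: e2; rewrite sqrrB expr1n; lra.
Qed.

Lemma measurable_rem2 : measurable_fun setT rem2.
Proof.
apply: measurable_funD => //; apply: measurable_funB => //.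
by apply: measurableT_comp => //; exact: measurable_expR.
Qed.

End second_order_remainder.

Section pairings.
Context {R : realType} {E : pmetricType R}.
Implicit Types (f : E -> R) (nu : fmeas E).

Lemma fmeas_setT nu : nu setT = (fine (nu setT))%:E.
Proof. by rewrite fineK//; exact: fin_num_measure. Qed.

Lemma integrable_pairing f nu : Bb f -> nu.-integrable setT (EFin \o f).
Proof.
by move=> [mf [M fM]]; apply: (integrable_bounded measurableT (fmeas_lty _ _) (M := M)).
Qed.

Lemma EFin_pairing f nu : Bb f -> ((pairing f nu)%:E = \int[nu]_x (f x)%:E)%E.
Proof.
by move=> bf; rewrite /pairing /Rintegral fineK//; exact/integrable_fin_num/integrable_pairing.
Qed.

Lemma pairing_ge0 f nu : (forall x, 0 <= f x) -> 0 <= pairing f nu.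
Proof. by move=> f0; apply: Rintegral_ge0 => x _. Qed.

Lemma le_pairing f1 f2 nu : Bb f1 -> Bb f2 -> (forall x, f1 x <= f2 x) ->
  pairing f1 nu <= pairing f2 nu.
Proof.
by move=> b1 b2 f12; apply: le_Rintegral => //; exact: integrable_pairing.
Qed.

Lemma pairing_cst (c : R) nu : pairing (cst c) nu = c * fine (nu setT).
Proof. by rewrite /pairing Rintegral_cst. Qed.

Lemma pairingZ (c : R) f nu : Bb f -> pairing (fun x => c * f x) nu = c * pairing f nu.
Proof. by move=> bf; rewrite /pairing RintegralZl//; exact: integrable_pairing. Qed.

Lemma pairingB f1 f2 nu : Bb f1 -> Bb f2 ->
  pairing (fun x => f1 x - f2 x) nu = pairing f1 nu - pairing f2 nu.
Proof. by move=> b1 b2; rewrite /pairing RintegralB//; exact: integrable_pairing. Qed.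

Lemma pairingD f1 f2 nu : Bb f1 -> Bb f2 ->
  pairing (fun x => f1 x + f2 x) nu = pairing f1 nu + pairing f2 nu.
Proof. by move=> b1 b2; rewrite /pairing RintegralD//; exact: integrable_pairing. Qed.

Lemma Bb_cst (c : R) : @Bb R E (cst c).
Proof. by split; [exact: measurable_cst|exists `|c|]. Qed.

Lemma BbZ (c : R) f : Bb f -> Bb (fun x => c * f x).
Proof.
move=> [mf [M fM]]; split; first exact: measurable_funM.
by exists (`|c| * M) => x; rewrite normrM ler_wpM2l.
Qed.

Lemma BbB f1 f2 : Bb f1 -> Bb f2 -> Bb (fun x => f1 x - f2 x).
Proof.
move=> [mf [M fM]] [mf2 [M2 fM2]]; split; first exact: measurable_funB.
by exists (M + M2) => x; rewrite (le_trans (ler_normB _ _))// lerD.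
Qed.

Lemma BbD f1 f2 : Bb f1 -> Bb f2 -> Bb (fun x => f1 x + f2 x).
Proof.
move=> [mf [M fM]] [mf2 [M2 fM2]]; split; first exact: measurable_funD.
by exists (M + M2) => x; rewrite (le_trans (ler_normD _ _))// lerD.
Qed.

Lemma BbM f1 f2 : Bb f1 -> Bb f2 -> Bb (fun x => f1 x * f2 x).
Proof.
move=> [mf [M fM]] [mf2 [M2 fM2]]; split; first exact: measurable_funM.
by exists (M * M2) => x; rewrite normrM ler_pM.
Qed.

Lemma measurable_fmeas_param d (T : measurableType d) (F : T * borel E -> R) :
  measurable_fun setT F ->
  measurable_fun setT (fun z : T * borel (fmeas E) => pairing (fun y => F (z.1, y)) z.2).
Proof.
move=> mF.
apply: (@measurable_param_Rintegral _ _ (T * borel (fmeas E))%type (borel E) R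
  (fun z => (z.2 : fmeas E)) _ _ (fun z => F (z.1.1, z.2))).
- move=> U mU; apply: (measurableT_comp (measurable_fmeas_eval mU)).
  exact: measurable_snd.
- by move=> z; exact: fmeas_lty.
- apply: measurableT_comp mF _; apply: measurable_fun_pair => //.
  exact: measurableT_comp measurable_fst measurable_fst.
Qed.

Lemma measurable_pairing f : measurable_fun [set: borel E] f ->
  measurable_fun [set: borel (fmeas E)] (fun nu : fmeas E => pairing f nu).
Proof.
move=> mf; apply: (@measurable_param_Rintegral _ _ (borel (fmeas E)) (borel E) R
  (fun nu => (nu : fmeas E)) _ _ (fun z => f z.2)).
- by move=> U mU; exact: measurable_fmeas_eval.
- by move=> nu; exact: fmeas_lty.
- exact: measurableT_comp mf measurable_snd.
Qed.

Lemma measurable_nonzero : measurable (@nonzero R E : set (borel (fmeas E))).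
Proof.
rewrite /nonzero -[X in measurable X]setTI; apply: emeasurable_neq => //.
exact: measurable_fmeas_eval.
Qed.

End pairings.

Section branching_decomposition.
Context {R : realType} {E : pmetricType R}.
Variable br : branching_mechanism E.
Implicit Types (f : E -> R) (x y : E) (nu : fmeas E) (K : R).

Local Notation nz := (@nonzero R E : set (borel (fmeas E))).
Let mnz : measurable nz := measurable_nonzero.

Definition mass nu : R := fine (nu setT).

(** K times this is the minimum of K nu(1) and (K nu(1))^2, which bounds [rem2] of nu(f) for 0 <= f
    <= K. Keeping K inside the minimum is what makes the integral against H vanish as K tends to
    0. *)
Definition mass2 K nu : R := Num.min (mass nu) (K * mass nu ^+ 2).

Lemma mass_ge0 nu : 0 <= mass nu.
Proof. exact: fine_ge0. Qed.

Lemma mass2_ge0 K nu : 0 <= K -> 0 <= mass2 K nu.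
Proof. by move=> K0; rewrite le_min mass_ge0 mulr_ge0// exprn_ge0// mass_ge0. Qed.

Lemma measurable_mass : measurable_fun [set: borel (fmeas E)] mass.
Proof. by apply: measurableT_comp; [exact: fine_measurable|exact: measurable_fmeas_eval]. Qed.

Lemma measurable_mass2 K : measurable_fun [set: borel (fmeas E)] (mass2 K).
Proof.
apply: measurable_minr; first exact: measurable_mass.
by apply: measurable_funM => //; apply: measurable_funX; exact: measurable_mass.
Qed.

Lemma measurable_set1 x : measurable ([set x] : set (borel E)).
Proof.
apply: closed_borel; apply: accessible_closed_set1; apply: hausdorff_accessible.
exact: metric_hausdorff.
Qed.

Lemma measurable_off x : measurable_fun [set: borel (fmeas E)]
  (fun nu : fmeas E => nu (~` [set x])).
Proof. by apply: measurable_fmeas_eval; apply: measurableC; exact: measurable_set1. Qed.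

Lemma brH_bound : exists2 C : R, 0 <= C & forall x,
  (\int[brH br x]_(nu in nz) (mass2 1 nu)%:E <= C%:E)%E /\
  (\int[brH br x]_(nu in nz) nu (~` [set x]) <= C%:E)%E.
Proof.
have := brH_moment br; set S := ereal_sup _ => Soo.
have S0 : (0 <= S)%E.
  apply: (@le_trans _ _ (\int[brH br point]_(nu in nz)
    (Order.min (nu setT) (nu setT ^+ 2) + nu (~` [set (point : E)])))%E); last first.
    by apply: ereal_sup_ubound; exists point.
  apply: integral_ge0 => nu _; apply: adde_ge0 => //.
  by rewrite le_min measure_ge0 expe_ge0.
have SE : (S = (fine (S))%:E)%E.
  by rewrite fineK// ge0_fin_numE.
exists (fine (S)) => [|x]; first exact: fine_ge0.
have mE nu : (Order.min (nu setT) (nu setT ^+ 2) = (mass2 1 nu)%:E)%E.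
  by rewrite [in LHS]fmeas_setT /mass2 mul1r EFin_min EFin_expe.
have xS : (\int[brH br x]_(nu in nz)
    ((mass2 1 nu)%:E + nu (~` [set x])) <= (fine (S))%:E)%E.
  rewrite -SE /S; apply: ereal_sup_ubound; exists x => //.
  by apply: eq_integral => nu _; rewrite mE.
have m1 : measurable_fun nz (fun nu : fmeas E => (mass2 1 nu)%:E).
  by apply/measurable_EFinP; apply: measurable_funTS; exact: measurable_mass2.
have m2 : measurable_fun nz (fun nu : fmeas E => nu (~` [set x])).
  by apply: measurable_funTS; exact: measurable_off.
have g0 nu : (0 <= (mass2 1 nu)%:E)%E by rewrite lee_fin mass2_ge0.
split; apply: le_trans xS; apply: ge0_le_integral => //.
- exact: emeasurable_funD.
- by move=> nu _; rewrite leeDl.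
- exact: emeasurable_funD.
- by move=> nu _; rewrite leeDr.
Qed.

Lemma pairing_le_mass f K nu : Bb f -> (forall x, f x <= K) -> pairing f nu <= K * mass nu.
Proof. by move=> bf fK; rewrite -pairing_cst; apply: le_pairing => //; exact: Bb_cst. Qed.

Lemma rem2_pairing_le f K nu : Bb f -> (forall x, 0 <= f x) -> (forall x, f x <= K) ->
  rem2 (pairing f nu) <= K * mass2 K nu.
Proof.
move=> bf f0 fK; have fnu := pairing_le_mass nu bf fK.
have K0 : 0 <= K by apply: le_trans (f0 point) (fK point).
have p0 := pairing_ge0 nu f0.
rewrite /mass2 minr_pMr// le_min; apply/andP; split.
  by apply: le_trans (rem2_le p0) _.
rewrite mulrA -expr2 -exprMn; apply: le_trans (rem2_le_sqr p0) _.
by rewrite lerXn2r// nnegrE (le_trans p0).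
Qed.

Lemma measurable_rem2_pairing f : measurable_fun [set: borel E] f ->
  measurable_fun nz (fun nu : fmeas E => rem2 (pairing f nu)).
Proof.
move=> mf; apply: measurable_funTS.
exact: measurableT_comp measurable_rem2 (measurable_pairing mf).
Qed.

Lemma mass2_le K nu : 0 <= K -> mass2 K nu <= (1 + K) * mass2 1 nu.
Proof.
move=> K0; rewrite /mass2 mul1r minr_pMr; last by rewrite addr_ge0.
rewrite le_min !ge_min; apply/andP; split; apply/orP.
  by left; rewrite ler_peMl ?mass_ge0// lerDl.
by right; rewrite ler_wpM2r ?exprn_ge0 ?mass_ge0// lerDr.
Qed.

Lemma integrable_mass2 K x : 0 <= K ->
  (brH br x).-integrable nz (fun nu => (mass2 K nu)%:E).
Proof.
move=> K0; have [C C0 /(_ x)[HC _]] := brH_bound.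
apply: (@le_integrable _ _ _ _ nz mnz _ (fun nu => ((1 + K) * mass2 1 nu)%:E)).
- by apply/measurable_EFinP; apply: measurable_funTS; exact: measurable_mass2.
- move=> nu _; rewrite lee_fin ger0_norm ?mass2_ge0// (le_trans (mass2_le nu K0))//.
  exact: ler_norm.
- under eq_fun do rewrite EFinM; apply: integrableZl => //.
  apply/integrableP; split.
    by apply/measurable_EFinP; apply: measurable_funTS; exact: measurable_mass2.
  apply: le_lt_trans (ltry C); apply: le_trans HC.
  apply: ge0_le_integral => //.
  + apply: measurableT_comp => //; apply/measurable_EFinP; apply: measurable_funTS.
    exact: measurable_mass2.
  + by apply/measurable_EFinP; apply: measurable_funTS; exact: measurable_mass2.
  + by move=> nu _; rewrite lee_fin ger0_norm// mass2_ge0.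
Qed.

Lemma integrable_cmass2 (c : R) K x : 0 <= K ->
  (brH br x).-integrable nz (fun nu => (c * mass2 K nu)%:E).
Proof.
move=> K0; under eq_fun do rewrite EFinM.
by apply: integrableZl => //; exact: integrable_mass2.
Qed.

Lemma integrable_rem2 f x : Bb f -> (forall y, 0 <= f y) ->
  (brH br x).-integrable nz (fun nu => (rem2 (pairing f nu))%:E).
Proof.
move=> bf f0; have [mf [K fK]] := bf.
have fK' y : f y <= K by apply: le_trans (fK y); exact: ler_norm.
have K0 : 0 <= K by apply: le_trans (f0 point) (fK' point).
apply: (@le_integrable _ _ _ _ nz mnz _ (fun nu => (K * mass2 K nu)%:E)).
- by apply/measurable_EFinP; exact: measurable_rem2_pairing.
- move=> nu _; rewrite lee_fin ger0_norm ?rem2_ge0//.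
  by apply: le_trans (ler_norm _); exact: rem2_pairing_le.
- exact: integrable_cmass2.
Qed.

(** This is nu_x(f), the part of nu(f) off the site x, as a difference that matches the compensator
    nu({x}) f(x) in [psi] and is visibly measurable in nu. *)
Definition off f x nu : R := pairing f nu - fine (nu [set x]) * f x.

Lemma offE f x nu : Bb f ->
  ((off f x nu)%:E = \int[nu]_(y in ~` [set x]) (f y)%:E)%E.
Proof.
move=> bf; have i := integrable_pairing nu bf.
have mx := measurable_set1 x.
have ix : nu.-integrable (~` [set x]) (EFin \o f).
  by apply: integrableS i => //; exact: measurableC.
rewrite /off EFinB EFin_pairing// -(setvU [set x]) integral_setU_EFin//; last 3 first.
- exact: measurableC.
- by apply: measurable_funTS; exact: bf.1.
- by apply/disj_setPS => y [].
rewrite [X in (_ + X - _)%E](_ : _ = (fine (nu [set x]) * f x)%:E)%E.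
  by rewrite addeK.
rewrite (eq_integral (cst (f x)%:E)); last by move=> y; rewrite inE => ->.
rewrite integral_cst// EFinM muleC fineK//.
exact: fin_num_measure.
Qed.

Lemma off_ge0 f x nu : Bb f -> (forall y, 0 <= f y) -> 0 <= off f x nu.
Proof.
by move=> bf f0; rewrite -lee_fin offE//; apply: integral_ge0 => y _; rewrite lee_fin.
Qed.

Lemma off_le f K x nu : Bb f -> (forall y, 0 <= f y) -> (forall y, f y <= K) ->
  ((off f x nu)%:E <= K%:E * nu (~` [set x]))%E.
Proof.
move=> bf f0 fK; have mx := measurableC (measurable_set1 x).
rewrite offE// -integral_cst//; apply: ge0_le_integral => //.
- by move=> y _; rewrite lee_fin.
- by apply/measurable_EFinP; apply: measurable_funTS; exact: bf.1.
- by move=> y _; rewrite lee_fin.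
Qed.

Lemma measurable_off_pairing f x : Bb f ->
  measurable_fun [set: borel (fmeas E)] (off f x).
Proof.
move=> bf; apply: measurable_funB; first exact: measurable_pairing bf.1.
apply: measurable_funM => //; apply: measurableT_comp; first exact: fine_measurable.
by apply: measurable_fmeas_eval; exact: measurable_set1.
Qed.

Lemma integrable_off f x : Bb f -> (forall y, 0 <= f y) ->
  (brH br x).-integrable nz (fun nu => (off f x nu)%:E).
Proof.
move=> bf f0; have [mf [K fK]] := bf.
have fK' y : f y <= K by apply: le_trans (fK y); exact: ler_norm.
have K0 : 0 <= K by apply: le_trans (f0 point) (fK' point).
have [C C0 /(_ x)[_ HC]] := brH_bound.
apply/integrableP; split.
  by apply/measurable_EFinP; apply: measurable_funTS; exact: measurable_off_pairing.
apply: (@le_lt_trans _ _ (K%:E * C%:E)%E); last by rewrite -EFinM ltry.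
apply: le_trans (lee_wpmul2l _ HC) => //.
have mo : measurable_fun nz (fun nu : fmeas E => nu (~` [set x])).
  by apply: measurable_funTS; exact: measurable_off.
rewrite -ge0_integralZl//; apply: ge0_le_integral => //.
- apply: measurableT_comp => //; apply/measurable_EFinP.
  by apply: measurable_funTS; exact: measurable_off_pairing.
- exact: measurable_funeM.
- by move=> nu _; rewrite gee0_abs ?lee_fin ?off_ge0//; exact: off_le.
Qed.

Variables (gamma : R.-fker (borel E) ~> (borel E)) (gammaE : nonlocal_kernel br gamma).

Let fker_lty (k : R.-fker (borel E) ~> (borel E)) x : (k x setT < +oo)%E.
Proof.
by have [r kr] := measure_uub k; apply: lt_trans (kr x) (ltry r).
Qed.

(** The non-local kernel is eta plus the mixture, under H(x, .), of the restrictions of nu off x, so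
    [integral_mixture] applies to the second part. *)
Lemma Rintegral_gamma f x : Bb f -> (forall y, 0 <= f y) ->
  \int[gamma x]_y f y = \int[breta br x]_y f y
    + \int[brH br x]_(nu in nz) off f x nu.
Proof.
move=> bf f0; have [mf [K fK]] := bf.
have mx := measurableC (measurable_set1 x).
pose k nu := mrestr nu mx.
have mk U : measurable U -> measurable_fun nz (fun nu : borel (fmeas E) => k nu U).
  move=> mU; apply: measurable_funTS; apply: measurable_fmeas_eval.
  exact: measurableI.
pose mm : {measure set (borel E) -> \bar R} := mixture_measure (brH br x) mnz mk.
have f0' y : (0 <= (f y)%:E)%E by rewrite lee_fin.
have mf' : measurable_fun [set: borel E] (EFin \o f) by exact/measurable_EFinP.
have E1 : (\int[gamma x]_y (f y)%:E = \int[breta br x]_y (f y)%:E +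
    \int[brH br x]_(nu in nz) (off f x nu)%:E)%E.
  rewrite (eq_measure_integral (measure_add (breta br x) mm)); last first.
    by move=> A mA _; rewrite (gammaE x mA) [RHS]measure_addE.
  rewrite ge0_integral_measure_add//; congr (_ + _)%E.
  rewrite (integral_mixture (mu := brH br x) (nu := mm) mnz mk)//.
  by apply: eq_integral => nu _; rewrite integral_mrestr// offE.
rewrite /Rintegral E1 fineD//; last exact: integrable_fin_num (integrable_off _ bf f0).
apply: integrable_fin_num => //.
exact: (integrable_bounded measurableT (fker_lty _ x) (M := K)).
Qed.

Definition Rem x f : R := brb br x * f x ^+ 2
  + \int[brH br x]_(nu in nz) rem2 (pairing f nu).

(** The compensator subtracts only the mass at x; completing it to all of nu(f) produces [rem2], and
    the excess nu_x(f) joins eta to form gamma. *)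
Lemma psiE f x : Bbplus f ->
  psi br x f = bra br x * f x - \int[gamma x]_y f y + Rem x f.
Proof.
move=> [bf [_ f0]]; rewrite Rintegral_gamma// /psi /Rem.
have -> : \int[brH br x]_(nu in @nonzero R E)
    (expR (- pairing f nu) - 1 + fine (nu [set x]) * f x) =
    \int[brH br x]_(nu in nz) (rem2 (pairing f nu) - off f x nu).
  by apply: eq_Rintegral => nu _; rewrite /rem2 /off; ring.
rewrite (RintegralB mnz (integrable_rem2 x bf f0) (integrable_off x bf f0)).
ring.
Qed.

Lemma brb_bound : exists2 B : R, 0 <= B & forall x, 0 <= brb br x <= B.
Proof.
have [[_ [B HB]] [_ b0]] := brb_Bb br.
exists B => [|x]; first by apply: le_trans (HB point).
by rewrite b0/=; apply: le_trans (HB x); exact: ler_norm.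
Qed.

Lemma Rem_ge0 x f : 0 <= Rem x f.
Proof.
have [B _ /(_ x)/andP[b0 _]] := brb_bound.
apply: addr_ge0; first by rewrite mulr_ge0// sqr_ge0.
by apply: Rintegral_ge0 => nu _; exact: rem2_ge0.
Qed.

(** K is multiplied by a factor that tends to 0 with K, by [cvg_mass2_int]. So the remainder is o(K)
    under the moment of min(nu(1), nu(1)^2) alone. *)
Lemma Rem_le x f K B : Bb f -> (forall y, 0 <= f y) -> (forall y, f y <= K) ->
  (forall x, 0 <= brb br x <= B) ->
  Rem x f <= K * (B * K + \int[brH br x]_(nu in nz) mass2 K nu).
Proof.
move=> bf f0 fK bB; have K0 : 0 <= K by apply: le_trans (f0 point) (fK point).
have /andP[b0 bB'] := bB x.
rewrite mulrDr; apply: lerD.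
  rewrite [leRHS]mulrCA -expr2 ler_pM ?sqr_ge0//.
  by rewrite lerXn2r// nnegrE.
rewrite -RintegralZl//; last exact: integrable_mass2.
apply: le_Rintegral => //.
- exact: integrable_rem2.
- exact: integrable_cmass2.
- by move=> nu _; exact: rem2_pairing_le.
Qed.

(** The local part is quadratic, with K^2 <= K^q and h^2 <= B h; the jump part uses rem2 y <= y^q
    and the q-th moment of nu(h). Both keep one factor h(x). *)
Lemma Rem_le_powR x f (h : E -> R) (K B C q : R) : Bb f -> Bb h ->
  (forall y, 0 <= f y) -> (forall y, 0 <= h y) -> (forall y, f y <= K * h y) ->
  0 <= K <= 1 -> 1 < q -> q <= 2 -> (forall x, 0 <= brb br x <= B) ->
  (forall y, h y <= B) ->
  (\int[brH br x]_(nu in nz) (pairing h nu `^ q)%:E <= (C * h x)%:E)%E ->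
  Rem x f <= K `^ q * ((B * B + C) * h x).
Proof.
move=> bf bh f0 h0 fh /andP[K0 K1] q1 q2 bB hB HC.
have B0 : 0 <= B by have /andP[] := bB point; exact: le_trans.
(* The comparison of K^2 with K^q below is made for positive K. *)
have [K00|Kn0] := eqVneq K 0.
  have fz y : f y = 0.
    by apply/le_anti; rewrite f0 andbT; apply: le_trans (fh y) _; rewrite K00 mul0r.
  rewrite K00 powR0; last by rewrite gt_eqF// (lt_trans _ q1).
  rewrite mul0r /Rem fz expr0n mulr0 add0r.
  have -> : f = cst 0 by apply/funext => y; exact: fz.
  rewrite (@eq_Rintegral _ _ _ (brH br x) nz (cst 0)); first by rewrite Rintegral_cst// mul0r.
  by move=> nu _; rewrite pairing_cst mul0r /rem2 oppr0 expR0 subrr addr0.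
have K0' : 0 < K by rewrite lt_neqAle eq_sym Kn0.
have /andP[b0 bB'] := bB x.
rewrite mulrDl mulrDr; apply: lerD.
  apply: (@le_trans _ _ (B * (K * h x) ^+ 2)).
    by rewrite ler_pM ?sqr_ge0// lerXn2r ?nnegrE// mulr_ge0.
  rewrite exprMn mulrCA ler_pM ?sqr_ge0 ?mulr_ge0 ?sqr_ge0//.
    by rewrite -(powR_mulrn 2 K0) ger_powR ?K0'.
  by rewrite -mulrA ler_wpM2l// expr2 ler_wpM2r.
have mh : measurable_fun nz (fun nu : fmeas E => pairing h nu `^ q).
  apply: measurable_funTS.
  exact: (measurableT_comp (measurable_powR q) (measurable_pairing bh.1)).
have le_q nu : rem2 (pairing f nu) <= K `^ q * pairing h nu `^ q.
  rewrite -powRM ?pairing_ge0//.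
  apply: le_trans (rem2_le_powR q1 q2 (pairing_ge0 nu f0)) _.
  apply: ge0_ler_powR; rewrite ?nnegrE ?pairing_ge0//.
  - by rewrite (le_trans _ (ltW q1)).
  - by rewrite mulr_ge0// pairing_ge0.
  - by rewrite -pairingZ//; apply: le_pairing => //; exact: BbZ.
rewrite -lee_fin /Rintegral fineK; last exact: integrable_fin_num (integrable_rem2 x bf f0).
rewrite EFinM; apply: le_trans (lee_wpmul2l _ HC); last by rewrite lee_fin powR_ge0.
rewrite -ge0_integralZl//; last 3 first.
- exact/measurable_EFinP.
- by move=> nu _; rewrite lee_fin powR_ge0.
- by rewrite lee_fin powR_ge0.
apply: ge0_le_integral => //.
- by move=> nu _; rewrite lee_fin rem2_ge0.
- by apply/measurable_EFinP; exact: measurable_rem2_pairing bf.1.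
- by apply: measurable_funeM; exact/measurable_EFinP.
- by move=> nu _; rewrite -EFinM lee_fin.
Qed.

Lemma measurable_brH_param d (T : measurableType d) (pr : T -> borel E)
    (G : T * borel (fmeas E) -> \bar R) : measurable_fun setT pr ->
  measurable_fun setT G -> (forall z, 0 <= G z)%E ->
  measurable_fun setT (fun z => \int[brH br (pr z)]_(nu in nz) G (z, nu))%E.
Proof.
move=> mpr mG G0.
(* brH is only sigma-finite: exhaust by the sets where mass2 is bounded below *)
pose A n : set (borel (fmeas E)) := [set nu | n.+1%:R^-1 <= mass2 1 nu].
have mA n : measurable (A n).
  rewrite /A -[X in measurable X]setTI.
  have /(_ measurableT `[n.+1%:R^-1, +oo[%classic) := measurable_mass2 1.
  move=> /(_ (measurable_itv _)); congr (measurable (_ `&` _)).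
  by apply/seteqP; split => nu /=; rewrite in_itv /= andbT.
have An n : A n `<=` nz.
  move=> nu; rewrite /A /nonzero /= => h; apply/eqP => nu0.
  have : mass2 1 nu <= 0 by rewrite ge_min /mass nu0 /= lexx.
  by move=> /(le_trans h); rewrite leNgt invr_gt0 ltr0Sn.
have bigA : \bigcup_n A n = nz.
  apply/seteqP; split => [nu [n _]|nu nu0]; first exact: An.
  have m0 : 0 < mass nu.
    by rewrite /mass fine_gt0// lt0e nu0 measure_ge0 /= -ge0_fin_numE// fin_num_measure.
  have m20 : 0 < mass2 1 nu by rewrite lt_min m0 mul1r exprn_gt0.
  have [N _ NP] := nbhs_infty_ger (mass2 1 nu)^-1.
  exists N => //; rewrite /A /= invf_ple ?posrE//.
  by apply: le_trans (NP N (leqnn N)) _; rewrite ler_nat.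
have ndA m n : (m <= n)%N -> A m `<=` A n.
  move=> mn nu; apply: le_trans; rewrite lef_pV2 ?posrE// ler_nat ltnS.
  exact: mn.
have [C C0 HC] := brH_bound.
have fA n x : (brH br x (A n) < +oo)%E.
  apply: (@le_lt_trans _ _ (n.+1%:R * C)%:E); last exact: ltry.
  have -> : (brH br x (A n) = \int[brH br x]_(nu in A n) cst 1 nu)%E.
    by rewrite integral_cst// mul1e.
  apply: (@le_trans _ _ (\int[brH br x]_(nu in A n) (n.+1%:R%:E * (mass2 1 nu)%:E))%E).
    apply: ge0_le_integral => //.
    - apply: measurable_funeM; apply/measurable_EFinP; apply: measurable_funTS.
      exact: measurable_mass2.
    - move=> nu Anu; rewrite -EFinM lee_fin -ler_pdivrMl// mulr1.
      exact: Anu.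
  have mm D : measurable_fun D (fun nu : borel (fmeas E) => (mass2 1 (nu : fmeas E))%:E).
    by apply/measurable_EFinP; apply: measurable_funTS; exact: measurable_mass2.
  rewrite ge0_integralZl//; last by move=> nu _; rewrite lee_fin mass2_ge0.
  rewrite EFinM lee_wpmul2l//; apply: le_trans (HC x).1.
  apply: ge0_subset_integral => //.
  by move=> nu _; rewrite lee_fin mass2_ge0.
pose l n z : {measure set (borel (fmeas E)) -> \bar R} := mrestr (brH br (pr z)) (mA n).
apply: (emeasurable_fun_cvg (fun n z => \int[l n z]_nu G (z, nu))%E).
  move=> n; apply: measurable_param_integral => // [U mU|z].
    apply: (measurableT_comp (measurable_kernel (brH br) _ _)) => //.
    exact: measurableI.
  by rewrite -[X in (X < _)%E]/(brH br (pr z) (setT `&` A n)) setTI; exact: fA.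
move=> z _.
have mGz : measurable_fun [set: borel (fmeas E)] (fun nu => G (z, nu)).
  exact: measurable_fun_pair2.
rewrite -bigA; under eq_fun do rewrite integral_mrestr//.
apply: ge0_nondecreasing_set_cvg_integral => //.
- by move=> m n mn; rewrite subsetEset; exact: ndA.
- by move=> n; exact: measurable_funTS.
Qed.

End branching_decomposition.

Section remainder_limits.
Context {R : realType} {E : pmetricType R}.
Variable br : branching_mechanism E.

Local Notation nz := (@nonzero R E : set (borel (fmeas E))).

Lemma measurable_Rem (F : R * borel E -> R) : measurable_fun setT F ->
  measurable_fun setT (fun z : R * borel E => Rem br z.2 (fun y => F (z.1, y))).
Proof.
move=> mF; apply: measurable_funD.
  apply: measurable_funM; first exact: measurableT_comp (brb_Bb br).1.1 measurable_snd.
  by apply: measurable_funX; under eq_fun do rewrite -surjective_pairing.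
apply: measurableT_comp; first exact: fine_measurable.
pose G (w : (R * borel E) * borel (fmeas E)) :=
  (rem2 (pairing (fun y => F (w.1.1, y)) w.2))%:E.
apply: (@measurable_brH_param _ _ br _ _ snd G) => //.
- apply/measurable_EFinP; apply: measurableT_comp measurable_rem2 _.
  apply: (@measurable_fmeas_param _ _ _ (R * borel E)%type (fun w => F (w.1.1, w.2))).
  apply: measurableT_comp mF _; apply: measurable_fun_pair; last exact: measurable_snd.
  exact: measurableT_comp measurable_fst measurable_fst.
- by move=> w; rewrite lee_fin rem2_ge0.
Qed.

Definition mass2_int (K : R) x : R := \int[brH br x]_(nu in nz) mass2 K nu.

Lemma measurable_mass2_int K : 0 <= K ->
  measurable_fun [set: borel E] (mass2_int K).
Proof.
move=> K0; apply: measurableT_comp; first exact: fine_measurable.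
apply: (@measurable_brH_param _ _ br _ (borel E) id
  (fun w => (mass2 K (w.2 : fmeas E))%:E)) => //.
- apply/measurable_EFinP; apply: measurableT_comp (measurable_mass2 K) _.
  exact: measurable_snd.
- by move=> w; rewrite lee_fin mass2_ge0.
Qed.

Lemma mass2_int_ge0 K x : 0 <= K -> 0 <= mass2_int K x.
Proof. by move=> K0; apply: Rintegral_ge0 => nu _; exact: mass2_ge0. Qed.

Lemma le_mass2_int K L x : 0 <= K -> K <= L -> mass2_int K x <= mass2_int L x.
Proof.
move=> K0 KL; have L0 := le_trans K0 KL.
apply: le_Rintegral; [exact: measurable_nonzero|exact: integrable_mass2..|].
move=> nu _; rewrite /mass2 le_min !ge_min lexx /=.
by apply/orP; right; rewrite ler_wpM2r// exprn_ge0// mass_ge0.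
Qed.

Lemma mass2_int_bound : exists2 C : R, 0 <= C &
  forall K x, 0 <= K -> mass2_int K x <= (1 + K) * C.
Proof.
have [C C0 HC] := brH_bound br; exists C => // K x K0.
have mnz := @measurable_nonzero R E.
rewrite -lee_fin /mass2_int /Rintegral fineK; last first.
  exact: integrable_fin_num (integrable_mass2 br x K0).
rewrite EFinM; apply: le_trans (lee_wpmul2l _ (HC x).1); last first.
  by rewrite lee_fin addr_ge0.
have mm L : measurable_fun nz (fun nu : borel (fmeas E) => (mass2 L (nu : fmeas E))%:E).
  by apply/measurable_EFinP; apply: measurable_funTS; exact: measurable_mass2.
rewrite -ge0_integralZl//; last 2 first.
- by move=> nu _; rewrite lee_fin mass2_ge0.
- by rewrite lee_fin addr_ge0.
apply: ge0_le_integral => //.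
- by move=> nu _; rewrite lee_fin mass2_ge0.
- exact: measurable_funeM.
- by move=> nu _; rewrite -EFinM lee_fin mass2_le.
Qed.

Lemma cvg_mass2_int (K : nat -> R) (L : R) x : (forall n, 0 <= K n <= L) ->
  K n @[n --> \oo] --> (0 : R) -> mass2_int (K n) x @[n --> \oo] --> (0 : R).
Proof.
move=> K01 K0; have mnz := @measurable_nonzero R E.
have Kge n : 0 <= K n by have /andP[] := K01 n.
have mF n : measurable_fun nz (fun nu : borel (fmeas E) => (mass2 (K n) (nu : fmeas E))%:E).
  by apply/measurable_EFinP; apply: measurable_funTS; exact: measurable_mass2.
have Ff : {ae brH br x, forall nu, nz nu ->
    (mass2 (K n) nu)%:E @[n --> \oo] --> (cst 0 nu : \bar R)}.
  apply/aeW => nu _; apply: cvg_EFin; first exact: nearW.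
  have m0 : Num.min (mass nu) (0 * mass nu ^+ 2) = 0.
    by rewrite mul0r; apply/min_idPr; exact: mass_ge0.
  rewrite -[X in _ --> X]m0.
  by apply: cvg_minr; [exact: cvg_cst|exact: cvgMl].
have Fm : {ae brH br x, forall nu n, nz nu ->
    `|(mass2 (K n) nu)%:E| <= (mass2 L nu)%:E}%E.
  apply/aeW => nu n _; rewrite lee_fin ger0_norm ?mass2_ge0//.
  rewrite /mass2 le_min !ge_min lexx /=; apply/orP; right.
  by rewrite ler_wpM2r ?exprn_ge0 ?mass_ge0//; have /andP[] := K01 n.
have L0 : 0 <= L by have /andP[+] := K01 0; exact: le_trans.
have int1 : (brH br x).-integrable nz (fun nu => (mass2 L nu)%:E) by exact: integrable_mass2.
have [_ _] := dominated_convergence mnz mF (measurable_cst _) Ff int1 Fm.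
rewrite integral0 => /fine_cvg; exact.
Qed.

End remainder_limits.

(** * Gronwall's inequality and the evolution equations of PP and V *)

Section exponential_integral.
Context {R : realType}.

Lemma Rintegral_expR_rev (c b t : R) : 0 < b -> 0 <= t ->
  \int[@lebesgue_measure R]_(s in `[0, t]) (c * expR (b * (t - s)))
  = c / b * (expR (b * t) - 1).
Proof.
move=> b0; rewrite le_eqVlt => /predU1P[<-|t0].
  by rewrite set_itv1 Rintegral_set1 mulr0 expR0 subrr mulr0.
pose F (s : R) := - (c / b) * expR (b * (t - s)).
have dF (x : R) : is_derive x 1 F (c * expR (b * (t - x))).
  rewrite /F; apply: is_derive_eq.
  rewrite /GRing.scale /= add0r mul1r mulrN1; field.
  by rewrite gt_eqF.
have cF : continuous F by move=> x; apply: differentiable_continuous; apply/derivable1_diffP; exact: ex_derive.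
have cf : continuous (fun s : R => c * expR (b * (t - s))).
  move=> x; apply: cvgMr; apply: continuous_comp; last exact: continuous_expR.
  by apply: cvgMr; apply: cvgB; [exact: cvg_cst|exact: cvg_id].
rewrite /Rintegral (@continuous_FTC2 _ _ F)//.
- rewrite /F subrr mulr0 expR0 subr0 -EFinB /=; ring.
- by apply: continuous_subspaceT.
- split => [x _||]; first exact: ex_derive.
  + by apply: cvg_at_right_filter; exact: cF.
  + by apply: cvg_at_left_filter; exact: cF.
- by move=> x _; rewrite derive1E; exact: derive_val.
Qed.

(** In the norm weighted by e^{-bs} with b = 2C + 1 the integral operator contracts by C/b <= 1/2,
    whence K <= a + K/2. The integral inequality is replaced by its effect [step] on exponential
    bounds, so the form of the time integral does not matter. *)
Lemma gronwall (E : pointedType) (T C a : R) (u : R -> E -> R) : 0 <= T -> 0 <= C ->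
  0 <= a -> (exists M : R, forall s y, 0 <= s -> s <= T -> u s y <= M) ->
  (forall K b : R, 0 <= K -> 0 < b ->
    (forall s y, 0 <= s -> s <= T -> u s y <= K * expR (b * s)) ->
    forall t x, 0 <= t -> t <= T -> u t x <= a + C * K / b * expR (b * t)) ->
  forall t x, 0 <= t -> t <= T -> u t x <= 2 * a * expR ((2 * C + 1) * t).
Proof.
move=> T0 C0 a0 [M uM] step; pose b := 2 * C + 1.
have b0 : 0 < b by rewrite /b; lra.
(* The element 0 makes the supremum nonnegative, as [step] requires of K. *)
pose S := [set r | r = 0 \/ exists s y, [/\ 0 <= s, s <= T & r = u s y / expR (b * s)]].
have S0 : S !=set0 by exists 0; left.
have Sub : has_ubound S.
  exists (Num.max M 0) => _ [->|[s [y [s0 sT ->]]]]; first by rewrite le_max lexx orbT.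
  rewrite ler_pdivrMr ?expR_gt0//; apply: le_trans (uM _ _ s0 sT) _.
  have e1 : 1 <= expR (b * s) by rewrite -expR0 ler_expR mulr_ge0// ltW.
  apply: (@le_trans _ _ (Num.max M 0)); first by rewrite le_max lexx.
  by rewrite ler_peMr// le_max lexx orbT.
have Ssup : has_sup S by split.
pose K := sup S.
have K0 : 0 <= K by apply: sup_upper_bound => //; left.
have uK s y : 0 <= s -> s <= T -> u s y <= K * expR (b * s).
  move=> s0 sT; rewrite -ler_pdivrMr ?expR_gt0//; apply: sup_upper_bound => //.
  by right; exists s, y.
have uK' := step K b K0 b0 uK.
have K2 : K <= 2 * a.
  suff : K <= a + K / 2 by lra.
  apply: ge_sup => // _ [->|[s [y [s0 sT ->]]]]; first by lra.
  rewrite ler_pdivrMr ?expR_gt0//; apply: le_trans (uK' s y s0 sT) _.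
  have e1 : 1 <= expR (b * s) by rewrite -expR0 ler_expR mulr_ge0// ltW.
  rewrite [leRHS]mulrDl; apply: lerD; first by rewrite ler_peMr.
  rewrite ler_wpM2r ?expR_ge0// ler_pdivrMr// mulrAC ler_pdivlMr//.
  by rewrite /b; nra.
move=> t x t0 tT; apply: le_trans (uK t x t0 tT) _.
by rewrite ler_wpM2r ?expR_ge0.
Qed.

End exponential_integral.

Section evolution_equations.
Context {R : realType} {E : pmetricType R} {d} {Omega : measurableType d}.
Variable xi : hunt_process E Omega.
Hypothesis E_lc : locally_compact [set: E].
Variable s : nat -> E.
Hypothesis dense_s : forall U : set E, open U -> U !=set0 -> exists n, U (s n).
Variables (br : branching_mechanism E) (gamma : R.-fker (borel E) ~> (borel E)).
Implicit Types (f : E -> R) (g : R -> E -> R) (t r T M K c : R) (x y : E).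

Local Notation leb := (@lebesgue_measure R).
Local Notation jmeasurable g :=
  (measurable_fun setT (fun z : R * borel E => g z.1 z.2)).
Local Notation TI := (time_integral xi).

Lemma jmeasurable_rev t g : jmeasurable g -> jmeasurable (fun r => g (t - r)).
Proof.
move=> mg; pose k (z : R * borel E) : R * borel E := (t - z.1, z.2).
have mk : measurable_fun setT k.
  apply: measurable_fun_pair => //.
  by apply: measurable_funB => //; exact: measurable_cst.
exact: measurableT_comp mg mk.
Qed.

Lemma jmeasurable_section g r : jmeasurable g -> measurable_fun [set: borel E] (g r).
Proof. by move=> mg; exact: measurableT_comp mg (measurable_pair1 r). Qed.

(* local boundedness says nothing about negative times; freezing the time
   outside [0, T] yields a function measurable and bounded on all of R * E *)
Definition clip T g r y := g (Num.min (Num.max r 0) T) y.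

Lemma clipE T g r y : 0 <= r -> r <= T -> clip T g r y = g r y.
Proof. by move=> r0 rT; rewrite /clip max_l// min_l. Qed.

Lemma clip_fctE T g r : 0 <= r -> r <= T -> clip T g r = g r.
Proof. by move=> r0 rT; apply/funext => y; rewrite clipE. Qed.

Lemma clip_rev T g t r : t <= T -> 0 <= r -> r <= t -> clip T g (t - r) = g (t - r).
Proof. by move=> tT r0 rt; rewrite clip_fctE//; lra. Qed.

Lemma jmeasurable_clip T g : 0 <= T ->
  measurable_fun [set z : R * borel E | 0 <= z.1] (fun z => g z.1 z.2) ->
  jmeasurable (clip T g).
Proof.
move=> T0 mg.
have mD : measurable [set z : R * borel E | 0 <= z.1].
  have -> : [set z : R * borel E | 0 <= z.1] = `[0, +oo[%classic `*` setT.
    by apply/seteqP; split => [[a b]|[a b]] /=; rewrite in_itv /= andbT => //; case.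
  exact: measurableX.
pose k (z : R * borel E) : R * borel E := (Num.min (Num.max z.1 0) T, z.2).
have mk : measurable_fun setT k.
  apply: measurable_fun_pair => //; apply: measurable_minr; last exact: measurable_cst.
  by apply: measurable_maxr => //; exact: measurable_cst.
apply: (measurable_comp mD _ mg mk).
by move=> _ [z _ <-]; rewrite /= le_min T0 le_max lexx orbT.
Qed.

Lemma clip_bound T g M : 0 <= T ->
  (forall r y, 0 <= r -> r <= T -> `|g r y| <= M) ->
  forall r y, `|clip T g r y| <= M.
Proof.
move=> T0 gM r y; apply: gM; first by rewrite le_min T0 le_max lexx orbT.
by rewrite ge_min lexx orbT.
Qed.

Let law_lty x : (law xi (Some x) setT < +oo)%E.
Proof. by rewrite law_setT ltry. Qed.

Let measurable_occ_at t f : measurable_fun [set: borel E] f ->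
  measurable_fun setT (fun w => occ xi (fun=> f) (t, w)).
Proof.
move=> mf; have mo : measurable_fun setT (occ xi (fun=> f)).
  by apply: (measurable_occ xi E_lc dense_s); exact: measurableT_comp mf measurable_snd.
exact: measurableT_comp mo (measurable_pair1 t).
Qed.

Lemma Pt_norm_le t f M x : 0 <= t -> measurable_fun [set: borel E] f ->
  (forall y, `|f y| <= M) -> `|Pt xi t f x| <= M.
Proof.
move=> t0 mf fM; have M0 : 0 <= M by exact: le_trans (fM point).
rewrite ler_norml; apply/andP; split; last first.
  by apply: (Pt_le xi E_lc dense_s x t0 mf fM M0) => y; exact: ler_normlW.
rewrite lerNl; have -> : - Pt xi t f x = Pt xi t (fun y => - f y) x.
  rewrite !PtE// -[LHS]mulN1r -RintegralZl//.
    by apply: eq_Rintegral => w _; rewrite /occ mulrN mulN1r.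
  apply: (integrable_bounded measurableT (law_lty x) (M := M)) => //.
  - exact: measurable_occ_at.
  - move=> w _; rewrite /occ indicE; case: (_ \in _); first by rewrite mul1r.
    by rewrite mul0r normr0.
apply: (Pt_le xi E_lc dense_s x (M := M) t0 _ _ M0).
- exact: measurableT_comp.
- by move=> y; rewrite normrN.
- by move=> y; apply: le_trans (ler_norm _) _; rewrite normrN.
Qed.

Lemma Pt0 f x : measurable_fun [set: borel E] f -> Pt xi 0 f x = f x.
Proof.
move=> mf; have mo := measurable_occ_at 0 mf.
rewrite /Pt /eP (ae_eq_integral (cst (f x)%:E))//.
- by rewrite integral_cst//= law_setT mule1.
- apply/measurable_EFinP; apply: (eq_measurable_fun (fun w => occ xi (fun=> f) (0, w))) => //.
  by move=> w _; rewrite extE.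
- by apply: filterS (pos_normal xi (Some x)) => w -> _.
Qed.

Lemma time_integral_exp_le t g M c (b : R) x : 0 <= t -> 0 <= c -> 0 < b ->
  jmeasurable g -> (forall r y, 0 <= r -> r <= t -> `|g r y| <= M) ->
  (forall r y, 0 <= r -> r <= t -> g r y <= c * expR (b * (t - r))) ->
  TI t g x <= c / b * expR (b * t).
Proof.
move=> t0 c0 b0 mg gM gc; pose B r := c * expR (b * (t - r)).
have mB : measurable_fun setT B.
  apply: measurable_funM; first exact: measurable_cst.
  apply: measurableT_comp; first exact: measurable_expR.
  by apply: measurable_funM; [exact: measurable_cst|exact: measurable_funB].
have B0 r : 0 <= B r by rewrite mulr_ge0 ?expR_ge0.
have BM r : 0 <= r -> r <= t -> `|B r| <= c * expR (b * t).
  move=> r0 rt; rewrite ger0_norm// ler_wpM2l// ler_expR (ler_wpM2l (ltW b0))//; lra.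
have PB r : 0 <= r -> r <= t -> Pt xi r (g r) x <= B r.
  move=> r0 rt; apply: (Pt_le xi E_lc dense_s x (M := M)) => //.
  - exact: jmeasurable_section.
  - by move=> y; exact: gM.
  - by move=> y; exact: gc.
apply: le_trans (time_integral_le_int E_lc dense_s mg gM mB BM PB) _.
rewrite Rintegral_expR_rev// ler_wpM2l ?divr_ge0// ?(ltW b0)//.
by rewrite lerBlDr lerDl.
Qed.

Lemma time_integral_exp_norm t g c (b : R) x : 0 <= t -> 0 <= c -> 0 < b ->
  jmeasurable g ->
  (forall r y, 0 <= r -> r <= t -> `|g r y| <= c * expR (b * (t - r))) ->
  `|TI t g x| <= c / b * expR (b * t).
Proof.
move=> t0 c0 b0 mg gc; pose M := c * expR (b * t).
have gM r y : 0 <= r -> r <= t -> `|g r y| <= M.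
  move=> r0 rt; apply: le_trans (gc _ _ r0 rt) _.
  by rewrite ler_wpM2l// ler_expR (ler_wpM2l (ltW b0))//; lra.
rewrite ler_norml; apply/andP; split; last first.
  apply: (time_integral_exp_le x t0 c0 b0 mg gM) => r y r0 rt.
  exact: le_trans (ler_norm _) (gc _ _ r0 rt).
rewrite lerNl -[leLHS]mulN1r -(time_integralZ xi E_lc dense_s _ _ mg gM).
apply: (time_integral_exp_le (M := M) x t0 c0 b0) => [|r y r0 rt|r y r0 rt].
- exact: measurable_funM.
- by rewrite mulN1r normrN gM.
- by rewrite mulN1r (le_trans (ler_norm _))// normrN gc.
Qed.

Lemma normr_time_integral_le t g1 g2 M1 M2 x : jmeasurable g1 -> jmeasurable g2 ->
  (forall r y, 0 <= r -> r <= t -> `|g1 r y| <= M1) ->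
  (forall r y, 0 <= r -> r <= t -> `|g2 r y| <= M2) ->
  (forall r y, 0 <= r -> r <= t -> `|g1 r y| <= g2 r y) ->
  `|TI t g1 x| <= TI t g2 x.
Proof.
move=> m1 m2 b1 b2 g12; rewrite ler_norml; apply/andP; split.
  rewrite lerNl -[leLHS]mulN1r -(time_integralZ xi E_lc dense_s x (-1) m1 b1).
  apply: (le_time_integral xi E_lc dense_s x (M1 := M1) _ m2 _ b2) => [|r y r0 rt|r y r0 rt].
  - exact: measurable_funM.
  - by rewrite mulN1r normrN b1.
  - by rewrite mulN1r (le_trans (ler_norm _))// normrN g12.
apply: (le_time_integral xi E_lc dense_s x m1 m2 b1 b2) => r y r0 rt.
exact: le_trans (ler_norm _) (g12 _ _ r0 rt).
Qed.

Lemma time_integral_le_cst t g M c x : 0 <= t -> 0 <= c -> jmeasurable g ->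
  (forall r y, 0 <= r -> r <= t -> `|g r y| <= M) ->
  (forall r y, 0 <= r -> r <= t -> g r y <= c) -> TI t g x <= c * t.
Proof.
move=> t0 c0 mg gM gc; have mc := @measurable_cst _ _ R R setT c.
apply: le_trans (time_integral_le_int E_lc dense_s mg gM mc (MB := `|c|) _ _) _ => //.
- move=> r r0 rt; apply: (Pt_le xi E_lc dense_s x (M := M)) => //.
  + exact: jmeasurable_section.
  + by move=> y; exact: gM.
  + by move=> y; exact: gc.
- rewrite (_ : \int[leb]_(r in `[0, t]) cst c r = c * fine (leb `[0, t]%classic)); last exact: Rintegral_cst.
  rewrite lebesgue_measure_itv /= lte_fin.
  by case: ltP => /=; rewrite ?mulr0 ?mulr_ge0//= subr0.
Qed.

Lemma time_integral0 g x : TI 0 g x = 0.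
Proof.
rewrite /time_integral /Rintegral integral0_eq// => w _.
by rewrite set_itv1 integral_set1 ?fine0.
Qed.

End evolution_equations.

Section drift_operators.
Context {R : realType} {E : pmetricType R}.
Variables (br : branching_mechanism E) (gamma : R.-fker (borel E) ~> (borel E)).
Implicit Types (f : E -> R) (g : R -> E -> R) (t r T M K c : R) (x y : E).

Local Notation jmeasurable g :=
  (measurable_fun setT (fun z : R * borel E => g z.1 z.2)).

Definition drift f x : R := \int[gamma x]_y f y - bra br x * f x.

(** The coefficient a may have either sign, so [drift] need not be monotone; this majorant is, as
    comparison arguments require. *)
Definition abs_drift f x : R := \int[gamma x]_y f y + `|bra br x| * f x.

Let gamma_lty x : (gamma x setT < +oo)%E.
Proof. by have [r gr] := measure_uub gamma; apply: lt_trans (gr x) (ltry _). Qed.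

Lemma drift_bound : exists2 C : R, 0 <= C &
  forall x, `|bra br x| + fine (gamma x setT) <= C.
Proof.
have [r gr] := measure_uub gamma; have [A HA] := (bra_Bb br).2.
have gr' x : 0 <= fine (gamma x setT) <= r.
  rewrite fine_ge0//= -lee_fin fineK ?ge0_fin_numE//; exact/ltW/gr.
exists (A + r) => [|x]; last by rewrite lerD//; have /andP[] := gr' x.
have /andP[g0 g1] := gr' point.
by rewrite addr_ge0//; [exact: le_trans (HA point)|exact: le_trans g1].
Qed.

Lemma normr_gamma_le f M x : measurable_fun [set: borel E] f ->
  (forall y, `|f y| <= M) -> `|\int[gamma x]_y f y| <= M * fine (gamma x setT).
Proof. by move=> mf fM; apply: normr_Rintegral_le. Qed.

Lemma le_gamma f1 f2 M1 M2 x : measurable_fun [set: borel E] f1 ->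
  measurable_fun [set: borel E] f2 -> (forall y, `|f1 y| <= M1) ->
  (forall y, `|f2 y| <= M2) -> (forall y, f1 y <= f2 y) ->
  \int[gamma x]_y f1 y <= \int[gamma x]_y f2 y.
Proof.
move=> m1 m2 b1 b2 f12; apply: le_Rintegral => //.
- by apply: (integrable_bounded _ (gamma_lty x) (M := M1)).
- by apply: (integrable_bounded _ (gamma_lty x) (M := M2)).
Qed.

Lemma normr_drift_le f M C x : (forall x, `|bra br x| + fine (gamma x setT) <= C) ->
  measurable_fun [set: borel E] f -> (forall y, `|f y| <= M) -> `|drift f x| <= C * M.
Proof.
move=> HC mf fM; have M0 : 0 <= M by exact: le_trans (fM point).
apply: le_trans (ler_normB _ _) _; rewrite normrM.
apply: le_trans (ler_wpM2r M0 (HC x)); rewrite mulrDl addrC lerD//.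
  by rewrite ler_wpM2l.
by rewrite mulrC; exact: normr_gamma_le.
Qed.

Lemma abs_drift_ge0 f x : (forall y, 0 <= f y) -> 0 <= abs_drift f x.
Proof. by move=> f0; rewrite addr_ge0 ?mulr_ge0// Rintegral_ge0. Qed.

Lemma abs_drift_le f M C x : (forall x, `|bra br x| + fine (gamma x setT) <= C) ->
  measurable_fun [set: borel E] f -> (forall y, 0 <= f y <= M) -> abs_drift f x <= C * M.
Proof.
move=> HC mf fM.
have M0 : 0 <= M by have /andP[] := fM point; exact: le_trans.
apply: le_trans (ler_wpM2r M0 (HC x)); rewrite /abs_drift mulrDl addrC lerD//.
  by rewrite ler_wpM2l//; have /andP[] := fM x.
rewrite mulrC; apply: le_trans (ler_norm _) _; apply: normr_gamma_le => // y.
by have /andP[f0 f1] := fM y; rewrite ger0_norm.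
Qed.

Lemma drift_le_abs f (g : E -> R) x M : measurable_fun [set: borel E] f ->
  measurable_fun [set: borel E] g -> (forall y, `|f y| <= g y) -> (forall y, g y <= M) ->
  `|drift f x| <= abs_drift g x.
Proof.
move=> mf mg fg gM; have g0 y : 0 <= g y by exact: le_trans (fg y).
apply: le_trans (ler_normB _ _) _; rewrite normrM lerD//; last by rewrite ler_wpM2l.
have fM y : `|f y| <= M by exact: le_trans (fg y) (gM y).
rewrite ler_norml; apply/andP; split; last first.
  apply: (le_gamma _ mf mg fM (M2 := M)) => y; first by rewrite ger0_norm.
  exact: le_trans (ler_norm _) (fg y).
have gi : (gamma x).-integrable setT (EFin \o g).
  by apply: (integrable_bounded _ (gamma_lty x) (M := M)) => // y _; rewrite ger0_norm.
rewrite -[leLHS]mulN1r -RintegralZl//.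
apply: (le_gamma _ _ mf (M1 := M) _ fM) => [|y|y].
- exact: measurable_funM.
- by rewrite mulN1r normrN ger0_norm.
- by rewrite mulN1r lerNl; apply: le_trans (ler_norm _) _; rewrite normrN.
Qed.

Lemma driftB f1 f2 M1 M2 x : measurable_fun [set: borel E] f1 ->
  measurable_fun [set: borel E] f2 -> (forall y, `|f1 y| <= M1) ->
  (forall y, `|f2 y| <= M2) ->
  drift (fun y => f1 y - f2 y) x = drift f1 x - drift f2 x.
Proof.
move=> m1 m2 b1 b2; rewrite /drift (@RintegralB _ _ _ _ setT)//.
- by ring.
- by apply: (integrable_bounded _ (gamma_lty x) (M := M1)).
- by apply: (integrable_bounded _ (gamma_lty x) (M := M2)).
Qed.

Lemma driftZ f M c x : measurable_fun [set: borel E] f -> (forall y, `|f y| <= M) ->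
  drift (fun y => c * f y) x = c * drift f x.
Proof.
move=> mf fM; rewrite /drift RintegralZl//; first by ring.
by apply: (integrable_bounded _ (gamma_lty x) (M := M)).
Qed.

Lemma jmeasurable_gamma g : jmeasurable g ->
  jmeasurable (fun r y => \int[gamma y]_z g r z).
Proof.
move=> mg; pose G (w : (R * borel E) * borel E) := g w.1.1 w.2.
apply: (@measurable_param_Rintegral _ _ _ _ _ (fun z : R * borel E => gamma z.2) _ _ G).
- by move=> U mU; exact: measurableT_comp (measurable_kernel gamma U mU) measurable_snd.
- by move=> z; exact: gamma_lty.
- pose k (w : (R * borel E) * borel E) : R * borel E := (w.1.1, w.2).
  have mk : measurable_fun setT k.
    apply: measurable_fun_pair; last exact: measurable_snd.
    exact: measurableT_comp measurable_fst measurable_fst.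
  exact: measurableT_comp mg mk.
Qed.

Lemma jmeasurable_drift g : jmeasurable g -> jmeasurable (fun r => drift (g r)).
Proof.
move=> mg; apply: measurable_funB; first exact: jmeasurable_gamma.
apply: measurable_funM => //.
exact: measurableT_comp (bra_Bb br).1 measurable_snd.
Qed.

Lemma jmeasurable_abs_drift g : jmeasurable g -> jmeasurable (fun r => abs_drift (g r)).
Proof.
move=> mg; apply: measurable_funD; first exact: jmeasurable_gamma.
apply: measurable_funM => //; apply: measurableT_comp; first exact: normr_measurable.
exact: measurableT_comp (bra_Bb br).1 measurable_snd.
Qed.

Lemma cvg_abs_drift (f_ : nat -> E -> R) f M x :
  (forall n, measurable_fun [set: borel E] (f_ n)) -> (forall n y, `|f_ n y| <= M) ->
  (forall y, f_ n y @[n --> \oo] --> f y) ->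
  abs_drift (f_ n) x @[n --> \oo] --> abs_drift f x.
Proof.
move=> mf fM ff; apply: cvgD; last exact: cvgMr.
by apply: (cvg_Rintegral_bounded _ (gamma_lty x) (M := M)).
Qed.

Lemma Rem_bound : exists2 C : R, 0 <= C & forall f K x, Bb f ->
  (forall y, 0 <= f y) -> (forall y, f y <= K) -> Rem br x f <= C * (K * (1 + K)).
Proof.
have [B B0 HB] := brb_bound br; have [C C0 HC] := mass2_int_bound br.
exists (B + C) => [|f K x bf f0 fK]; first by rewrite addr_ge0.
have K0 : 0 <= K by exact: le_trans (f0 point) (fK point).
apply: le_trans (Rem_le x bf f0 fK HB) _.
rewrite mulrCA ler_wpM2l// mulrDl lerD//; last by rewrite mulrC; exact: HC.
by rewrite ler_wpM2l// lerDr.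
Qed.

End drift_operators.

Section mean_and_cumulant.
Context {R : realType} {E : pmetricType R} {d} {Omega : measurableType d}.
Variable xi : hunt_process E Omega.
Hypothesis E_lc : locally_compact [set: E].
Variable s : nat -> E.
Hypothesis dense_s : forall U : set E, open U -> U !=set0 -> exists n, U (s n).
Variables (br : branching_mechanism E) (gamma : R.-fker (borel E) ~> (borel E)).
Implicit Types (f : E -> R) (g : R -> E -> R) (t r T M K c : R) (x y : E).

Local Notation jmeasurable g :=
  (measurable_fun setT (fun z : R * borel E => g z.1 z.2)).
Local Notation TI := (time_integral xi).
Local Notation drift := (drift br gamma).
Local Notation abs_drift := (abs_drift br gamma).

Lemma locally_bounded_clip g T : locally_bounded g -> 0 <= T ->
  jmeasurable (clip T g) /\ exists2 M, 0 <= M & forall r y, `|clip T g r y| <= M.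
Proof.
move=> [mg bg] T0; split; first exact: jmeasurable_clip.
have [M HM] := bg (T + 1) (ltr_wpDl T0 ltr01).
have gM r y : 0 <= r -> r <= T -> `|g r y| <= M.
  by move=> r0 rT; apply: HM => //; rewrite (le_trans rT)// lerDl.
exists M; first by apply: le_trans (gM 0 point _ _).
exact: clip_bound.
Qed.

Lemma clip_ge0 g T r y : 0 <= T -> (forall r y, 0 <= r -> 0 <= g r y) ->
  0 <= clip T g r y.
Proof. by move=> T0 g0; apply: g0; rewrite le_min T0 le_max lexx orbT. Qed.

(* monotone limits and dominated convergence turn the asymptotic bound into
   the homogeneous inequality, whose only solution is 0 by Gronwall *)
Lemma gronwall_vanishing T (u : nat -> R -> E -> R) (rho : nat -> E -> R) M L :
  0 <= T -> (forall n, jmeasurable (u n)) -> (forall n r y, `|u n r y| <= M) ->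
  (forall n, measurable_fun [set: borel E] (rho n)) ->
  (forall n y, 0 <= rho n y <= L) ->
  (forall n k y, (n <= k)%N -> rho k y <= rho n y) ->
  (forall y, rho n y @[n --> \oo] --> (0 : R)) ->
  (forall n t x, 0 <= t -> t <= T -> `|u n t x| <=
     TI t (fun r y => abs_drift (fun z => `|u n (t - r) z|) y + rho n y) x) ->
  forall t x, 0 <= t -> t <= T -> u n t x @[n --> \oo] --> (0 : R).
Proof.
move=> T0 mu uM mrho rhoL rho_dec rho0 step.
have M0 : 0 <= M by exact: le_trans (uM 0 0 point).
(* The [u n] need not converge, but their tail suprema decrease to a limit [w]. They inherit the
   inequality because [abs_drift] is monotone and [rho] decreases in n. *)
pose e n r y := sups (fun k => `|u k r y|) n.
have ub r y : has_ubound (range (fun k => `|u k r y|)).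
  by exists M => _ [k _ <-]; exact: uM.
have ue n k r y : (n <= k)%N -> `|u k r y| <= e n r y.
  move=> nk; apply: sup_upper_bound; last by exists k.
  split; first by exists (`|u k r y|); exists k.
  by exists M => _ [j _ <-]; exact: uM.
have eub n r y c : (forall k, (n <= k)%N -> `|u k r y| <= c) -> e n r y <= c.
  move=> uc; apply: ge_sup; first by exists (`|u n r y|); exists n => //=.
  by move=> _ [k nk <-]; exact: uc.
have e0 n r y : 0 <= e n r y by apply: le_trans (ue n n r y (leqnn n)).
have eM n r y : e n r y <= M by apply: eub => k _; exact: uM.
have me n : jmeasurable (e n).
  apply: (@measurable_fun_sups _ _ _ setT (fun k (z : R * borel E) => `|u k z.1 z.2|)).
  - by move=> z _; exact: ub.
  - by move=> k; apply: measurableT_comp; [exact: normr_measurable|exact: mu].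
pose w r y := inf (range (e^~ r ^~ y)).
have ew r y : e n r y @[n --> \oo] --> w r y.
  apply: (@cvg_sups_inf _ (fun k => `|u k r y|)); first exact: ub.
  by exists 0 => _ [k _ <-].
have mw : jmeasurable w.
  apply: (@measurable_fun_cvg _ _ _ setT (fun n (z : R * borel E) => e n z.1 z.2)) => //.
have w0 r y : 0 <= w r y by apply: (cvgr_to_ge (@ew r y)); exact: nearW.
have wM r y : w r y <= M by apply: (cvgr_to_le (@ew r y)); exact: nearW.
have [C C0 HC] := drift_bound br gamma.
have m_at g r : jmeasurable g -> measurable_fun [set: borel E] (g r).
  exact: jmeasurable_section.
have mrhoz n : jmeasurable (fun=> rho n : E -> R) by exact: measurableT_comp (mrho n) measurable_snd.
have ad_bound g r y : jmeasurable g -> (forall r y, 0 <= g r y <= M) ->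
    `|abs_drift (g r) y| <= C * M.
  move=> mg gM; rewrite ger0_norm.
    by apply: abs_drift_le => //; exact: m_at.
  by apply: abs_drift_ge0 => z; have /andP[] := gM r z.
have ein n r y : 0 <= e n r y <= M by rewrite e0 eM.
have e_step n t x : 0 <= t -> t <= T ->
    e n t x <= TI t (fun r y => abs_drift (e n (t - r)) y + rho n y) x.
  move=> t0 tT; apply: eub => k nk; apply: le_trans (step k t x t0 tT) _.
  have mau : jmeasurable (fun r y => `|u k r y|).
    by apply: measurableT_comp; [exact: normr_measurable|exact: mu].
  have auM r y : 0 <= `|u k r y| <= M by rewrite normr_ge0 uM.
  have rL n' y : `|rho n' y| <= L.
    by have /andP[r0 rl] := rhoL n' y; rewrite ger0_norm.
  apply: (le_time_integral xi E_lc dense_s x (M1 := C * M + L) (M2 := C * M + L)).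
  - apply: measurable_funD; last exact: mrhoz.
    exact: (@jmeasurable_abs_drift _ _ br gamma _ (@jmeasurable_rev _ _ t (fun r y => `|u k r y|) mau)).
  - apply: measurable_funD; last exact: mrhoz.
    exact: (@jmeasurable_abs_drift _ _ br gamma _ (@jmeasurable_rev _ _ t (e n) (me n))).
  - move=> r y _ _; apply: le_trans (ler_normD _ _) (lerD _ (rL _ _)).
    exact: (ad_bound (fun r y => `|u k r y|)).
  - move=> r y _ _; apply: le_trans (ler_normD _ _) (lerD _ (rL _ _)).
    exact: (ad_bound (e n)).
  - move=> r y r0 rt; apply: lerD; last exact: rho_dec.
    apply: lerD; last by rewrite ler_wpM2l// ue.
    apply: (le_gamma gamma y (M1 := M) (M2 := M)).
    + exact: (m_at (fun r y => `|u k r y|) (t - r) mau).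
    + exact: m_at.
    + by move=> z; rewrite normr_id.
    + by move=> z; rewrite ger0_norm.
    + by move=> z; exact: ue.
have w_step t x : 0 <= t -> t <= T -> w t x <= TI t (fun r => abs_drift (w (t - r))) x.
  move=> t0 tT; have L0 : 0 <= L by have /andP[+] := rhoL 0 point; exact: le_trans.
  have c1 : TI t (fun r y => abs_drift (e n (t - r)) y + rho n y) x @[n --> \oo] -->
      TI t (fun r => abs_drift (w (t - r))) x.
    refine (@cvg_time_integral _ _ _ _ xi E_lc s dense_s x t
      (fun n r y => abs_drift (e n (t - r)) y + rho n y)
      (fun r => abs_drift (w (t - r))) (C * M + L) _ _ _ _).
    - move=> n; apply: measurable_funD; last exact: mrhoz.
      exact: (@jmeasurable_abs_drift _ _ br gamma _ (@jmeasurable_rev _ _ t (e n) (me n))).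
    - move=> n r y _ _; apply: le_trans (ler_normD _ _) (lerD _ _).
        exact: (ad_bound (e n)).
      by have /andP[r0 rl] := rhoL n y; rewrite ger0_norm.
    - move=> r y _ _; rewrite -[X in _ --> X]addr0; apply: cvgD; last exact: rho0.
      refine (@cvg_abs_drift _ _ br gamma (fun n => e n (t - r)) _ M y _ _ _)
        => [n|n z|z]; last exact: ew.
      + exact: m_at.
      + by rewrite ger0_norm.
    - exact: (@jmeasurable_abs_drift _ _ br gamma _ (@jmeasurable_rev _ _ t w mw)).
  apply: (ler_cvg_to (ew t x) c1); apply: nearW => n; exact: e_step.
have w_eq0 t x : 0 <= t -> t <= T -> w t x = 0.
  move=> t0 tT; apply/eqP; rewrite eq_le w0 andbT.
  have := @gronwall R E T C 0 w T0 C0 (lexx 0).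
  rewrite mulr0 => /(_ _ _ t x t0 tT); rewrite mul0r; apply.
  - by exists M.
  - move=> K b K0 b0 wK t' x' t'0 t'T; rewrite add0r.
    apply: le_trans (w_step _ _ t'0 t'T) _.
    apply: (time_integral_exp_le xi E_lc dense_s (M := C * M) x' t'0 _ b0).
    + exact: mulr_ge0.
    + exact: (@jmeasurable_abs_drift _ _ br gamma _ (@jmeasurable_rev _ _ t' w mw)).
    + move=> r y r0 rt; apply: (ad_bound w) => // r' y'.
      by rewrite w0 wM.
    + move=> r y r0 rt; rewrite -mulrA; apply: abs_drift_le => //; first exact: m_at.
      move=> z; rewrite w0 wK//; first by rewrite subr_ge0.
      by rewrite lerBlDr (le_trans t'T)// lerDl.
move=> t x t0 tT; apply/norm_cvg0P.
have := ew t x; rewrite w_eq0// => ew0.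
apply: (squeeze_cvgr _ (cvg_cst 0) ew0); apply: nearW => n.
by rewrite normr_ge0 ue.
Qed.

Hypothesis gammaE : nonlocal_kernel br gamma.
Variables (V PP : R -> (E -> R) -> E -> R).
Hypotheses (V_cum : cumulant_semigroup br xi V) (PP_mean : mean_semigroup br xi gamma PP).

Lemma mean_clip f T : Bb f -> 0 <= T -> jmeasurable (clip T (PP ^~ f)) /\
  exists2 M, 0 <= M & forall r y, `|clip T (PP ^~ f) r y| <= M.
Proof. by move=> /PP_mean[? _]; exact: locally_bounded_clip. Qed.

Lemma cum_clip f T : Bbplus f -> 0 <= T -> jmeasurable (clip T (V ^~ f)) /\
  exists2 M, 0 <= M & forall r y, `|clip T (V ^~ f) r y| <= M.
Proof. by move=> /V_cum[? _ _]; exact: locally_bounded_clip. Qed.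

Lemma cum_ge0 f t x : Bbplus f -> 0 <= t -> 0 <= V t f x.
Proof. by move=> /V_cum[_ + _]; exact. Qed.

Lemma mean_Bb f t : Bb f -> 0 <= t -> Bb (PP t f).
Proof.
move=> bf t0; have [mj [M _ HM]] := mean_clip bf t0.
have <- : clip t (PP ^~ f) t = PP t f by apply/clip_fctE.
by split; [exact: jmeasurable_section|exists M].
Qed.

Lemma cum_Bbplus f t : Bbplus f -> 0 <= t -> Bbplus (V t f).
Proof.
move=> bf t0; have [mj [M _ HM]] := cum_clip bf t0.
have Vm : measurable_fun [set: borel E] (V t f).
  have <- : clip t (V ^~ f) t = V t f by apply/clip_fctE.
  exact: jmeasurable_section.
split; split => //; last by move=> y; exact: cum_ge0.
exists M => y; rewrite -(clipE (T := t) (V ^~ f) y t0 (lexx t)).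
exact: HM.
Qed.

(** The equation is rewritten with the clipped semigroup, to which the rules for time integrals
    apply; clipping changes nothing on [0, t] as t <= T. *)
Lemma mean_evol f T t x : Bb f -> 0 <= t -> t <= T ->
  PP t f x = Pt xi t f x + TI t (fun r => drift (clip T (PP ^~ f) (t - r))) x.
Proof.
move=> bf t0 tT; have T0 := le_trans t0 tT.
have [_ eqn] := PP_mean bf; rewrite (eqn t x t0); have [mj [M M0 HM]] := mean_clip bf T0.
have [C C0 HC] := drift_bound br gamma.
have mr := jmeasurable_rev t mj.
have m_at r : measurable_fun [set: borel E] (clip T (PP^~ f) (t - r)) by exact: jmeasurable_section.
have a_le y : `|bra br y| <= C.
  by apply: le_trans (HC y); rewrite lerDl fine_ge0.
have g_le y : fine (gamma y setT) <= C.
  by apply: le_trans (HC y); rewrite lerDr.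
rewrite -addrA; congr (_ + _); rewrite addrC.
rewrite (time_integral_ext xi (t := t) x
  (g' := fun r y => \int[gamma y]_z clip T (PP^~ f) (t - r) z)); last first.
  by move=> r y r0 rt; rewrite clip_rev.
rewrite (time_integral_ext xi (t := t) x
  (g := fun r y => bra br y * PP (t - r) f y)
  (g' := fun r y => bra br y * clip T (PP^~ f) (t - r) y)); last first.
  by move=> r y r0 rt; rewrite clip_rev.
rewrite -(time_integralB xi E_lc dense_s x (M1 := M * C) (M2 := C * M)) => [//||| |].
- exact: (@jmeasurable_gamma _ _ gamma (fun q => clip T (PP ^~ f) (t - q)) mr).
- apply: measurable_funM => //.
  exact: measurableT_comp (bra_Bb br).1 measurable_snd.
- move=> r y _ _; apply: le_trans (normr_gamma_le _ _ (m_at r) (HM _)) _.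
  by rewrite ler_wpM2l.
- by move=> r y _ _; rewrite normrM ler_pM.
Qed.

Lemma cum_evol f T t x : Bbplus f -> 0 <= t -> t <= T ->
  V t f x = Pt xi t f x + TI t (fun r y =>
    drift (clip T (V ^~ f) (t - r)) y - Rem br y (clip T (V ^~ f) (t - r))) x.
Proof.
move=> bf t0 tT; have T0 := le_trans t0 tT.
have [_ V0 eqn] := V_cum bf; rewrite (eqn t x t0); have [mj [M M0 HM]] := cum_clip bf T0.
have [C C0 HC] := drift_bound br gamma; have [D D0 HD] := Rem_bound br.
have mr := jmeasurable_rev t mj.
have m_at r : measurable_fun [set: borel E] (clip T (V^~ f) (t - r)) by exact: jmeasurable_section.
have c0 r y : 0 <= clip T (V^~ f) r y by exact: clip_ge0.
congr (_ + _).
rewrite (time_integral_ext xi (t := t) x (g' := fun r y => -1 *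
   (drift (clip T (V ^~ f) (t - r)) y - Rem br y (clip T (V ^~ f) (t - r))))); last first.
  move=> r y r0 rt; rewrite clip_rev// (psiE gammaE); first by rewrite /drift; ring.
  by apply: cum_Bbplus => //; rewrite subr_ge0.
rewrite (time_integralZ xi E_lc dense_s x (-1) (M := C * M + D * (M * (1 + M)))) ?mulN1r ?opprK//.
- apply: measurable_funB; first exact: (@jmeasurable_drift _ _ br gamma (fun q => clip T (V ^~ f) (t - q)) mr).
  exact: measurable_Rem mr.
- move=> r y _ _; apply: le_trans (ler_normB _ _) (lerD _ _).
    exact: normr_drift_le.
  rewrite ger0_norm ?Rem_ge0//; apply: HD => [||z]; last exact: ler_normlW (HM _ z).
  + by split; [exact: m_at|exists M].
  + by move=> z.
Qed.

Lemma mean_apriori f K C t x : (forall x, `|bra br x| + fine (gamma x setT) <= C) ->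
  0 <= C -> Bb f -> (forall y, `|f y| <= K) -> 0 <= t ->
  `|PP t f x| <= 2 * K * expR ((2 * C + 1) * t).
Proof.
move=> HC C0 bf fK t0; have K0 : 0 <= K by exact: le_trans (fK point).
have [mj [M M0 HM]] := mean_clip bf t0.
apply: (@gronwall R E t C K (fun r y => `|PP r f y|)) => //.
  by exists M => r y r0 rt; rewrite -(clipE (T := t) (PP ^~ f) y r0 rt).
move=> L b L0 b0 HL r y r0 rt; rewrite (mean_evol y bf r0 rt).
apply: le_trans (ler_normD _ _) (lerD _ _).
  by apply: (Pt_norm_le xi E_lc dense_s y r0) => //; case: bf.
apply: (time_integral_exp_norm xi E_lc dense_s y r0 _ b0); first exact: mulr_ge0.
  exact: (@jmeasurable_drift _ _ br gamma _ (jmeasurable_rev r mj)).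
move=> r' y' r'0 r'r; rewrite -mulrA; apply: normr_drift_le => //.
  exact: jmeasurable_section.
by move=> z; rewrite clip_rev// HL//; lra.
Qed.

(** The remainder enters the evolution with a negative sign and is dropped, so V grows at most at
    the rate of the linear part. Linearity of the bound in K is what permits division by theta in
    [cvg_mean_cum]. *)
Lemma cum_apriori f K C t x : (forall x, `|bra br x| + fine (gamma x setT) <= C) ->
  0 <= C -> Bbplus f -> (forall y, f y <= K) -> 0 <= t ->
  V t f x <= 2 * K * expR ((2 * C + 1) * t).
Proof.
move=> HC C0 bf fK t0; have f0 := bf.2.2.
have K0 : 0 <= K by exact: le_trans (f0 point) (fK point).
have [mj [M M0 HM]] := cum_clip bf t0; have [D D0 HD] := Rem_bound br.
apply: (@gronwall R E t C K (fun r y => V r f y)) => //.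
  exists M => r y r0 rt; rewrite -(clipE (T := t) (V ^~ f) y r0 rt).
  exact: ler_normlW (HM _ _).
move=> L b L0 b0 HL r y r0 rt; rewrite (cum_evol y bf r0 rt); apply: lerD.
  apply: (Pt_le xi E_lc dense_s y r0 bf.2.1 (M := K)) => // z.
  by rewrite ger0_norm.
have mr := jmeasurable_rev r mj.
have m_at q : measurable_fun [set: borel E] (clip t (V^~ f) (r - q)) by exact: jmeasurable_section.
have c0 q z : 0 <= clip t (V^~ f) q z by apply: clip_ge0 => // *; exact: cum_ge0.
apply: (time_integral_exp_le xi E_lc dense_s (M := C * M + D * (M * (1 + M))) y r0 _ b0).
- exact: mulr_ge0.
- apply: measurable_funB; first exact: (@jmeasurable_drift _ _ br gamma (fun q => clip t (V^~ f) (r - q)) mr).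
  exact: measurable_Rem mr.
- move=> q z _ _; apply: le_trans (ler_normB _ _) (lerD _ _).
    exact: normr_drift_le.
  rewrite ger0_norm ?Rem_ge0//; apply: HD => [||z']; last exact: ler_normlW (HM _ z').
  + by split; [exact: m_at|exists M].
  + by move=> z'.
- move=> q z q0 qr; rewrite -mulrA lerBlDr.
  apply: (@le_trans _ _ (C * (L * expR (b * (r - q))))); last by rewrite lerDl Rem_ge0.
  apply: le_trans (ler_norm _) _; apply: normr_drift_le => // z'.
  by rewrite ger0_norm// clip_rev// HL//; lra.
Qed.

(** The free terms P_t f cancel: the difference solves the linear equation with source [Rem]. *)
Lemma mean_cum_evol f T t x : Bbplus f -> 0 <= t -> t <= T ->
  PP t f x - V t f x = TI t (fun r y =>
    drift (fun z => clip T (PP ^~ f) (t - r) z - clip T (V ^~ f) (t - r) z) y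
    + Rem br y (clip T (V ^~ f) (t - r))) x.
Proof.
move=> bf t0 tT; have T0 := le_trans t0 tT.
rewrite (mean_evol x bf.1 t0 tT) (cum_evol x bf t0 tT) opprD addrACA subrr add0r.
have [mP [MP MP0 HMP]] := mean_clip bf.1 T0; have [mV [M M0 HM]] := cum_clip bf T0.
have [C C0 HC] := drift_bound br gamma; have [D D0 HD] := Rem_bound br.
have mPr := jmeasurable_rev t mP; have mVr := jmeasurable_rev t mV.
have P_at r : measurable_fun [set: borel E] (clip T (PP^~ f) (t - r)) by exact: jmeasurable_section.
have V_at r : measurable_fun [set: borel E] (clip T (V^~ f) (t - r)) by exact: jmeasurable_section.
have c0 r y : 0 <= clip T (V^~ f) r y by apply: clip_ge0 => // *; exact: cum_ge0.
rewrite -(time_integralB xi E_lc dense_s x (M1 := C * MP) (M2 := C * M + D * (M * (1 + M)))).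
- apply: time_integral_ext => r y r0 rt.
  rewrite (driftB br gamma y (P_at r) (V_at r) (HMP _) (HM _)).
  by ring.
- exact: (@jmeasurable_drift _ _ br gamma (fun q => clip T (PP ^~ f) (t - q)) mPr).
- apply: measurable_funB; first exact: (@jmeasurable_drift _ _ br gamma (fun q => clip T (V ^~ f) (t - q)) mVr).
  exact: measurable_Rem mVr.
- by move=> r y _ _; exact: normr_drift_le.
- move=> q z _ _; apply: le_trans (ler_normB _ _) (lerD _ _).
    exact: normr_drift_le.
  rewrite ger0_norm ?Rem_ge0//; apply: HD => [||z']; last exact: ler_normlW (HM _ z').
  + by split; [exact: V_at|exists M].
  + by move=> z'.
Qed.

Lemma Bbplus_scale f c : Bbplus f -> 0 <= c -> Bbplus (fun x => c * f x).
Proof.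
move=> [bf [mf f0]] c0; split; first exact: BbZ.
by split => [|x]; [case: (BbZ c bf)|rewrite mulr_ge0].
Qed.

Let th n : R := n.+1%:R^-1.

Let th_ge0 n : 0 <= th n. Proof. by rewrite /th invr_ge0. Qed.

Let th_le1 n : th n <= 1.
Proof. by rewrite /th invf_le1 ?ltr0Sn// ler1n. Qed.

Let thK n c : n.+1%:R * (c * th n) = c.
Proof. by rewrite /th mulrCA mulfV ?mulr1// pnatr_eq0. Qed.

Let cvg_th c : c * th n @[n --> \oo] --> (0 : R).
Proof. by rewrite -(mulr0 c); apply: cvgMr; exact: cvg_harmonic. Qed.

(** With theta = 1/(n+1), the difference divided by theta solves the linear equation with source
    Rem(V(theta f)) / theta. As V(theta f) <= L theta, this source is at most [rho n], which
    decreases to 0, though at no explicit rate, since only the moment of min(nu(1), nu(1)^2) is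
    available here; hence [gronwall_vanishing]. *)
Lemma cvg_mean_cum f t x : Bbplus f -> 0 <= t ->
  n.+1%:R * (PP t (fun y => n.+1%:R^-1 * f y) x - V t (fun y => n.+1%:R^-1 * f y) x)
    @[n --> \oo] --> (0 : R).
Proof.
move=> bf t0; pose T := t; have [C C0 HC] := drift_bound br gamma.
have [K fK'] := bf.1.2; have fK y : f y <= K by exact: le_trans (ler_norm _) (fK' y).
have K0 : 0 <= K by exact: le_trans (bf.2.2 point) (fK point).
pose L := 2 * K * expR ((2 * C + 1) * T).
have L0 : 0 <= L by rewrite !mulr_ge0 ?expR_ge0.
pose fn n y := th n * f y.
have bfn n : Bbplus (fn n) by exact: Bbplus_scale.
have fnK n y : `|fn n y| <= K * th n.
  by rewrite normrM ger0_norm// mulrC ler_wpM2r.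
have exp_le n r : r <= T -> 2 * (K * th n) * expR ((2 * C + 1) * r) <= L * th n.
  move=> rT; rewrite /L [leRHS]mulrAC -mulrA -[leRHS]mulrA; rewrite !mulrA.
  rewrite ler_wpM2l ?mulr_ge0// ler_expR ler_wpM2l// addr_ge0// mulr_ge0//.
pose P n := clip T (PP ^~ (fn n)); pose W n := clip T (V ^~ (fn n)).
have mP n : jmeasurable (P n) by have [] := mean_clip (bfn n).1 t0.
have mW n : jmeasurable (W n) by have [] := cum_clip (bfn n) t0.
have PL n r y : `|P n r y| <= L * th n.
  apply: clip_bound => // {}r {}y r0 rT; apply: le_trans (exp_le n r rT).
  exact: mean_apriori (bfn n).1 (fnK n) r0.
have WL n r y : W n r y <= L * th n.
  apply: (@le_trans _ _ `|W n r y|); first exact: ler_norm.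
  apply: clip_bound => // {}r {}y r0 rT; apply: le_trans (exp_le n r rT).
  rewrite ger0_norm; last exact: cum_ge0.
  by apply: cum_apriori => // z; exact: le_trans (ler_norm _) (fnK n z).
have W0 n r y : 0 <= W n r y by apply: clip_ge0 => // *; exact: cum_ge0.
have Lth n : L * th n <= L by rewrite ler_piMr.
pose u n r y := n.+1%:R * (P n r y - W n r y).
have [B B0 HB] := brb_bound br; have [D D0 HD] := mass2_int_bound br.
pose rho n y := L * (B * (L * th n) + mass2_int br (L * th n) y).
have RemW n r y : n.+1%:R * Rem br y (W n r) <= rho n y.
  rewrite -(thK n (rho n y)) ler_wpM2l// /rho [leRHS]mulrAC.
  apply: Rem_le => //; split; first exact: jmeasurable_section.
  by exists (L * th n) => z; rewrite ger0_norm.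
have rhoL n y : 0 <= rho n y <= L * (B * L + (1 + L) * D).
  apply/andP; split.
    by rewrite mulr_ge0// addr_ge0 ?mulr_ge0// mass2_int_ge0// mulr_ge0.
  rewrite ler_wpM2l// lerD ?ler_wpM2l//.
  apply: le_trans (HD _ _ _) _; first by rewrite mulr_ge0.
  by rewrite ler_wpM2r// lerD2l.
have mu n : jmeasurable (u n).
  apply: measurable_funM; first exact: measurable_cst.
  exact: measurable_funB.
have uM n r y : `|u n r y| <= 2 * L.
  rewrite normrM ger0_norm//.
  have -> : 2 * L = n.+1%:R * (2 * L * th n) by rewrite thK.
  rewrite ler_wpM2l// -mulrA mulr_natl mulr2n (le_trans (ler_normB _ _))// lerD//.
  by rewrite ger0_norm.
have mrho n : measurable_fun [set: borel E] (rho n).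
  apply: measurable_funM; first exact: measurable_cst.
  apply: measurable_funD; first exact: measurable_cst.
  by apply: measurable_mass2_int; rewrite mulr_ge0.
suff : u n t x @[n --> \oo] --> (0 : R).
  by apply: cvg_trans; apply: near_eq_cvg; apply: nearW => n; rewrite /u /P /W !clipE.
apply: (@gronwall_vanishing T u rho (2 * L) (L * (B * L + (1 + L) * D)) t0) => //.
- move=> n k y nk; rewrite ler_wpM2l// lerD ?ler_wpM2l ?lef_pV2 ?posrE ?ltr0Sn ?ler_nat//.
  by apply: le_mass2_int; rewrite ?mulr_ge0// ler_wpM2l ?lef_pV2 ?posrE ?ltr0Sn ?ler_nat.
- move=> y; rewrite /rho -(mulr0 L); apply: cvgMr; rewrite -(addr0 0); apply: cvgD.
    by rewrite -(mulr0 B); apply: cvgMr; exact: cvg_th.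
  apply: (@cvg_mass2_int _ _ br _ L); last exact: cvg_th.
  by move=> n; rewrite mulr_ge0//= Lth.
- move=> n r y r0 rT; have mPr := jmeasurable_rev r (mP n); have mWr := jmeasurable_rev r (mW n).
  have P_at q : measurable_fun [set: borel E] (P n (r - q)) by exact: jmeasurable_section.
  have W_at q : measurable_fun [set: borel E] (W n (r - q)) by exact: jmeasurable_section.
  have WL' q z : `|W n q z| <= L * th n by rewrite ger0_norm.
  have mPW : jmeasurable (fun q z => P n (r - q) z - W n (r - q) z).
    exact: measurable_funB.
  have PWb q z : `|P n (r - q) z - W n (r - q) z| <= L * th n + L * th n.
    by rewrite (le_trans (ler_normB _ _))// lerD.
  have Rm : jmeasurable (fun q z => Rem br z (W n (r - q))) by exact: measurable_Rem mWr.
  have Rb q z : `|Rem br z (W n (r - q))| <= rho n z.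
    rewrite ger0_norm ?Rem_ge0//; apply: le_trans (RemW n (r - q) z).
    by rewrite ler_peMl ?Rem_ge0// ler1n.
  have Rb' q z : `|Rem br z (W n (r - q))| <= L * (B * L + (1 + L) * D).
    by apply: le_trans (Rb _ _) _; have /andP[] := rhoL n z.
  have Dm : jmeasurable (fun q => drift (fun z => P n (r - q) z - W n (r - q) z)).
    exact: (@jmeasurable_drift _ _ br gamma (fun q z => P n (r - q) z - W n (r - q) z)).
  have Db q z : `|drift (fun z => P n (r - q) z - W n (r - q) z) z| <= C * (L * th n + L * th n).
    by apply: normr_drift_le => //; exact: (@jmeasurable_section _ _ (fun q z => P n (r - q) z - W n (r - q) z)).
  have -> : u n r y = TI r (fun q z => n.+1%:R * (
      drift (fun z => P n (r - q) z - W n (r - q) z) z + Rem br z (W n (r - q)))) y.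
    rewrite (time_integralZ xi E_lc dense_s y n.+1%:R
      (M := C * (L * th n + L * th n) + L * (B * L + (1 + L) * D))).
    + by rewrite -(mean_cum_evol y (bfn n) r0 rT) /u /P /W !clipE.
    + exact: measurable_funD.
    + by move=> q z _ _; rewrite (le_trans (ler_normD _ _))// lerD.
  have au q z : 0 <= `|u n (r - q) z| <= 2 * L by rewrite normr_ge0 uM.
  have mau : jmeasurable (fun q z => `|u n (r - q) z|).
    apply: measurableT_comp; first exact: normr_measurable.
    exact: (@jmeasurable_rev _ _ r (u n)).
  have mau_at q : measurable_fun [set: borel E] (fun z => `|u n (r - q) z|).
    exact: (@jmeasurable_section _ _ (fun q z => `|u n (r - q) z|)).
  have n0 : 0 <= n.+1%:R :> R by [].
  apply: (normr_time_integral_le xi E_lc dense_s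
    (M1 := n.+1%:R * (C * (L * th n + L * th n) + L * (B * L + (1 + L) * D)))
    (M2 := C * (2 * L) + L * (B * L + (1 + L) * D)) y).
  + by apply: measurable_funM; [exact: measurable_cst|exact: measurable_funD].
  + apply: measurable_funD; first exact: (@jmeasurable_abs_drift _ _ br gamma (fun q z => `|u n (r - q) z|)).
    exact: measurableT_comp (mrho n) measurable_snd.
  + move=> q z _ _; rewrite normrM ger0_norm// ler_wpM2l//.
    by rewrite (le_trans (ler_normD _ _))// lerD.
  + move=> q z _ _; have /andP[r0' rl] := rhoL n z.
    rewrite ger0_norm; first by rewrite lerD//; exact: abs_drift_le.
    by rewrite addr_ge0// abs_drift_ge0.
  + move=> q z _ _; rewrite mulrDr (le_trans (ler_normD _ _))// lerD//.
      have mPWq : measurable_fun [set: borel E] (fun z => P n (r - q) z - W n (r - q) z).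
        exact: (@jmeasurable_section _ _ (fun q z => P n (r - q) z - W n (r - q) z)).
      rewrite -(driftZ br gamma n.+1%:R z mPWq (PWb q)).
      refine (@drift_le_abs _ _ br gamma _ (fun z => `|u n (r - q) z|) z (2 * L) _ _ _ _) => //.
      exact: (@jmeasurable_section _ _ (fun q => u n (r - q)) q (jmeasurable_rev r (mu n))).
    by rewrite normrM [`|n.+1%:R|]ger0_norm// ger0_norm ?Rem_ge0// RemW.
Qed.

End mean_and_cumulant.

(** * Laws on path space and the Markov property *)

Section image_laws.
Context d1 d2 (T1 : measurableType d1) (T2 : measurableType d2) (R : realType).
Variables (mu : {measure set T1 -> \bar R}) (phi : T1 -> T2)
  (mphi : measurable_fun setT phi).

Let measurable_dirac_image U : measurable U ->
  measurable_fun setT (fun w => (\d_(phi w) U : \bar R)).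
Proof.
move=> mU; rewrite /dirac; apply/measurable_EFinP.
by apply: measurableT_comp mphi; exact: measurable_indic.
Qed.

(** The push-forward, built as a mixture of Dirac masses so that [integral_mixture] yields the
    change of variables. *)
Definition image_law : {measure set T2 -> \bar R} :=
  mixture_measure mu measurableT measurable_dirac_image.

Lemma image_lawE U : measurable U -> image_law U = mu (phi @^-1` U).
Proof.
move=> mU; rewrite -(setIT (_ @^-1` _)) -integral_indic//.
by rewrite -[X in measurable X]setTI; exact: mphi.
Qed.

Lemma integral_image (F : T2 -> \bar R) : (forall z, 0 <= F z)%E ->
  measurable_fun setT F -> (\int[image_law]_z F z = \int[mu]_w F (phi w))%E.
Proof.
move=> F0 mF; rewrite (integral_mixture (mu := mu) (nu := image_law) measurableT measurable_dirac_image)//.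
by apply: eq_integral => w _; rewrite integral_dirac// diracT mul1e.
Qed.

End image_laws.

Section path_space_measurability.
Context {R : realType} {E : pmetricType R}.

Lemma measurable_traj (t : R) : 0 <= t ->
  measurable_fun [set: path_space E] (fun w : path_space E => traj w t : borel (fmeas E)).
Proof.
move=> t0 _ B mB; rewrite setTI; apply: sub_sigma_algebra.
by exists t; [rewrite /= in_itv /= t0|exists B => //; rewrite setTI].
Qed.

Lemma measurable_traj_past (r t : R) : 0 <= r -> r <= t ->
  measurable_fun [set: g_sigma_algebraType (coordinates E `[0, t]%classic)]
    (fun w => traj w r : borel (fmeas E)).
Proof.
move=> r0 rt _ B mB; rewrite setTI; apply: sub_sigma_algebra.
by exists r; [rewrite /= in_itv /= r0|exists B => //; rewrite setTI].
Qed.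

(** The inclusion of sigma-algebras, put as measurability of the identity so that functions of the
    past can be composed into functions on path space. *)
Lemma measurable_past (t : R) :
  measurable_fun [set: path_space E]
    (id : path_space E -> g_sigma_algebraType (coordinates E `[0, t]%classic)).
Proof.
move=> _ A mA; rewrite setTI preimage_id.
apply: (smallest_sub _ _ mA); first exact: smallest_sigma_algebra.
move=> _ [r + [B mB <-]]; rewrite /= in_itv /= => /andP[r0 _].
apply: sub_sigma_algebra.
by exists r; [rewrite /= in_itv /= r0|exists B].
Qed.

Lemma measurable_pairing_traj (f : E -> R) t : measurable_fun [set: borel E] f ->
  0 <= t -> measurable_fun [set: path_space E] (fun w : path_space E => pairing f (traj w t)).
Proof.
by move=> mf t0; exact: measurableT_comp (measurable_pairing mf) (measurable_traj t0).
Qed.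

Lemma measurable_pairing_past (f : E -> R) (r t : R) : measurable_fun [set: borel E] f ->
  0 <= r -> r <= t ->
  measurable_fun [set: g_sigma_algebraType (coordinates E `[0, t]%classic)]
    (fun w => pairing f (traj w r)).
Proof.
by move=> mf r0 rt; exact: measurableT_comp (measurable_pairing mf) (measurable_traj_past r0 rt).
Qed.

End path_space_measurability.

Section superprocess_markov.
Context {R : realType} {E : pmetricType R}.
Variables (V : R -> (E -> R) -> E -> R) (P : R.-pker (borel (fmeas E)) ~> (path_space E)).
Hypothesis P_sup : is_superprocess V P.
Implicit Types (mu : fmeas E) (s t : R).

Lemma P_setT mu : P mu setT = 1%E.
Proof. exact: prob_kernel. Qed.

Let past s := g_sigma_algebraType (coordinates E `[0, s]%classic).

(* both sides integrate F against measures on the product that agree on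
   rectangles *)
Lemma markov_past mu s t (F : past s * borel (fmeas E) -> \bar R) : 0 <= s -> 0 <= t ->
  measurable_fun setT F -> (forall z, 0 <= F z)%E ->
  (\int[P mu]_w F (w, traj w (s + t)) =
   \int[P mu]_w \int[P (traj w s)]_w' F (w, traj w' t))%E.
Proof.
move=> s0 t0 mF F0; have st0 : 0 <= s + t by rewrite addr_ge0.
have mphi : measurable_fun [set: path_space E]
    (fun w : path_space E => (w, traj w (s + t)) : past s * borel (fmeas E)).
  by apply: measurable_fun_pair; [exact: measurable_past|exact: measurable_traj].
have mphi2 (w : path_space E) : measurable_fun [set: path_space E]
    (fun w' : path_space E => (w, traj w' t) : past s * borel (fmeas E)).
  by apply: measurable_fun_pair; [exact: measurable_cst|exact: measurable_traj].
pose k (w : path_space E) := image_law (P (traj w s)) (mphi2 w).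
have mP U : measurable U -> measurable_fun setT (fun w : path_space E => P (traj w s) U).
  by move=> mU; exact: measurableT_comp (measurable_kernel P U mU) (measurable_traj s0).
have mk U : measurable U -> measurable_fun [set: path_space E] (k ^~ U).
  move=> mU; apply: (eq_measurable_fun (fun w : path_space E =>
    \int[P (traj w s)]_w' (\1_U ((w, traj w' t) : past s * borel (fmeas E)))%:E)%E).
    move=> w _; rewrite image_lawE// -(setIT (_ @^-1` _)) -integral_indic//.
    by rewrite -[X in measurable X]setTI; exact: (mphi2 w).
  apply: (@measurable_param_integral _ _ _ _ R (fun w : path_space E => P (traj w s)) mP _
    (fun z : path_space E * path_space E =>
      (\1_U ((z.1, traj z.2 t) : past s * borel (fmeas E)))%:E)).
  - by move=> w; rewrite P_setT ltry.
  - apply/measurable_EFinP.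
    have mj : measurable_fun setT (fun z : path_space E * path_space E =>
        (z.1, traj z.2 t) : past s * borel (fmeas E)).
      apply: measurable_fun_pair.
        exact: measurableT_comp (@measurable_past R E s) measurable_fst.
      exact: measurableT_comp (measurable_traj t0) measurable_snd.
    exact: measurableT_comp (measurable_indic mU) mj.
  - by move=> z; rewrite lee_fin indicE.
pose nu1 := image_law (P mu) mphi.
pose nu2 : {measure set (past s * borel (fmeas E)) -> \bar R} :=
  mixture_measure (P mu) measurableT mk.
have nuE U : measurable U -> nu1 U = nu2 U.
  apply: (measure_unique [set A `*` B | A in measurable & B in measurable] (fun=> setT)).
  - exact: measurable_prod_measurableType.
  - move=> _ _ [A mA [B mB <-]] [A' mA' [B' mB' <-]]; rewrite -setXI.
    by exists (A `&` A'); [exact: measurableI|exists (B `&` B') => //; exact: measurableI].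
  - by move=> _; exists setT => //; exists setT => //; rewrite setXTT.
  - exact: bigcup_const.
  - move=> _ [A mA [B mB <-]].
    rewrite image_lawE; last exact: measurableX.
    transitivity (P mu (A `&` [set w : mpath E | B (traj w (s + t))])).
      by congr (P mu _); apply/seteqP; split.
    rewrite (super_markov P_sup)// integral_mkcond; apply: eq_integral => w _.
    rewrite image_lawE; last exact: measurableX.
    rewrite patchE; case: ifPn => [/set_mem Aw|/negP Aw].
      by congr (P _ _); apply/seteqP; split => w' /=; [split|case].
    rewrite -[LHS](measure0 (P (traj w s))); congr (P _ _).
    by apply/seteqP; split => w' //= [Aw' _]; apply: Aw; rewrite inE.
  - by move=> _; rewrite image_lawE// P_setT ltry.
rewrite -(integral_image (P mu) mphi F0 mF).
rewrite (integral_mixture (mu := P mu) (nu := nu1) measurableT mk nuE F0 mF).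
by apply: eq_integral => w _; rewrite integral_image.
Qed.

End superprocess_markov.

(** * The mean martingale of a superprocess and its maximal inequality *)

Section maximal_inequality.
Context {R : realType} {E : pmetricType R}.
Variables (V PP : R -> (E -> R) -> E -> R)
  (P : R.-pker (borel (fmeas E)) ~> (path_space E)).
Hypotheses (P_sup : is_superprocess V P)
  (PPb : forall f t, Bbplus f -> 0 <= t -> Bbplus (PP t f))
  (Vb : forall f t, Bbplus f -> 0 <= t -> Bbplus (V t f))
  (PP0 : forall f x, Bb f -> PP 0 f x = f x)
  (V_PP : forall f t x, Bbplus f -> 0 <= t -> V t f x <= PP t f x)
  (moment : forall mu f t, Bbplus f -> 0 <= t ->
     (\int[P mu]_w (pairing f (traj w t))%:E = (pairing (PP t f) mu)%:E)%E).
Variables (mu : fmeas E) (g : E -> R) (r T : R).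
Hypotheses (bg : Bbplus g) (r0 : 0 <= r) (T0 : 0 <= T).

Lemma laplace_ereal nu f t : Bbplus f -> 0 <= t ->
  (\int[P nu]_w (expR (- pairing f (traj w t)))%:E = (expR (- pairing (V t f) nu))%:E)%E.
Proof.
move=> bf t0; rewrite -(super_laplace P_sup nu t0 bf) /Rintegral fineK//.
apply: (integrable_fin_num measurableT).
have Plty : (P nu setT < +oo)%E by rewrite P_setT ltry.
apply: (integrable_bounded measurableT Plty (M := 1)).
  apply: measurableT_comp => //; apply: measurableT_comp => //.
  exact: measurable_pairing_traj bf.2.1 t0.
move=> w _; rewrite ger0_norm ?expR_ge0// expR_le1 oppr_le0.
by apply: pairing_ge0; exact: bf.2.2.
Qed.

(* the mean of <g, X_{r+T}> given X up to time r + t *)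
Definition mart t (w : mpath E) : R := pairing (PP (T - t) g) (traj w (r + t)).

Let bP t : t <= T -> Bbplus (PP (T - t) g).
Proof. by move=> tT; apply: PPb bg _; rewrite subr_ge0. Qed.

Let mart_ge0 t w : t <= T -> 0 <= mart t w.
Proof. by move=> tT; apply: pairing_ge0; exact: (bP tT).2.2. Qed.

Let mart_T w : mart T w = pairing g (traj w (r + T)).
Proof.
rewrite /mart subrr; congr (pairing _ _); apply/funext => y.
exact: PP0 bg.1.
Qed.

Lemma measurable_mart t : 0 <= t -> t <= T ->
  measurable_fun [set: path_space E] (mart t : path_space E -> R).
Proof.
move=> t0 tT; apply: measurable_pairing_traj; first exact: (bP tT).2.1.
by rewrite addr_ge0.
Qed.

Lemma measurable_mart_past t u : 0 <= t -> t <= T -> t <= u ->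
  measurable_fun [set: g_sigma_algebraType (coordinates E `[0, r + u]%classic)]
    (mart t : g_sigma_algebraType (coordinates E `[0, r + u]%classic) -> R).
Proof.
move=> t0 tT tu; apply: measurable_pairing_past; first exact: (bP tT).2.1.
  by rewrite addr_ge0.
by rewrite lerD2l.
Qed.

Let past u := g_sigma_algebraType (coordinates E `[0, r + u]%classic).

Section fixed_event.
Variables (t : R) (A : set (mpath E)).
Hypotheses (t0 : 0 <= t) (tT : t <= T) (mA : measurable (A : set (past t))).

Let rt0 : 0 <= r + t. Proof. exact: addr_ge0. Qed.

Let Tt0 : 0 <= T - t. Proof. by rewrite subr_ge0. Qed.

Let rTE : r + T = r + t + (T - t). Proof. by ring. Qed.

Let mindic : measurable_fun [set: past t] (\1_A : past t -> R).
Proof. exact: measurable_indic. Qed.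

(** Conditioning at time r + t: the Markov property and the first-moment formula replace <g,
    X_{r+T}> by <PP_{T-t} g, X_{r+t}> on events of that past. *)
Lemma integral_mart :
  (\int[P mu]_w (\1_A w * mart T w)%:E = \int[P mu]_w (\1_A w * mart t w)%:E)%E.
Proof.
pose F (z : past t * borel (fmeas E)) := (\1_A z.1 * pairing g z.2)%:E.
have mF : measurable_fun setT F.
  apply/measurable_EFinP; apply: measurable_funM.
    exact: measurableT_comp mindic measurable_fst.
  exact: measurableT_comp (measurable_pairing bg.2.1) measurable_snd.
have F0 z : (0 <= F z)%E by rewrite lee_fin mulr_ge0// pairing_ge0//; exact: bg.2.2.
transitivity (\int[P mu]_w F (w, traj w (r + t + (T - t))))%E.
  by apply: eq_integral => w _; rewrite mart_T rTE.
rewrite (markov_past P_sup mu rt0 Tt0 mF F0); apply: eq_integral => w _.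
rewrite /F /= /mart EFinM -(moment _ bg Tt0) -ge0_integralZl ?lee_fin//.
  by apply/measurable_EFinP; exact: measurable_pairing_traj bg.2.1 Tt0.
by move=> w' _; rewrite lee_fin; apply: pairing_ge0; exact: bg.2.2.
Qed.

(** The factor e^{M_0} belongs to the past, so the Laplace functional can be applied to the future
    alone. All integrands are nonnegative, so the integrals may be infinite. *)
Lemma integral_exp_mart :
  (\int[P mu]_w (\1_A w * expR (mart 0 w - mart T w))%:E =
   \int[P mu]_w (\1_A w * expR (mart 0 w - pairing (V (T - t) g) (traj w (r + t))))%:E)%E.
Proof.
pose F (z : past t * borel (fmeas E)) := (\1_A z.1 * expR (mart 0 z.1 - pairing g z.2))%:E.
have mF : measurable_fun setT F.
  apply/measurable_EFinP; apply: measurable_funM.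
    exact: measurableT_comp mindic measurable_fst.
  apply: measurableT_comp; first exact: measurable_expR.
  apply: measurable_funB.
    exact: measurableT_comp (measurable_mart_past (lexx 0) T0 t0) measurable_fst.
  exact: measurableT_comp (measurable_pairing bg.2.1) measurable_snd.
have F0 z : (0 <= F z)%E by rewrite lee_fin mulr_ge0// expR_ge0.
transitivity (\int[P mu]_w F (w, traj w (r + t + (T - t))))%E.
  by apply: eq_integral => w _; rewrite mart_T rTE.
rewrite (markov_past P_sup mu rt0 Tt0 mF F0); apply: eq_integral => w _.
rewrite /F /= expRD mulrA EFinM -(laplace_ereal _ bg Tt0) -ge0_integralZl.
- by apply: eq_integral => w' _; rewrite expRD mulrA.
- exact: measurableT.
- apply/measurable_EFinP; apply: measurableT_comp; first exact: measurable_expR.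
  apply: measurableT_comp => //; exact: measurable_pairing_traj bg.2.1 Tt0.
- by move=> w' _; rewrite lee_fin expR_ge0.
- by rewrite lee_fin mulr_ge0// expR_ge0.
Qed.

Let mindicT : measurable_fun [set: path_space E] (\1_A : path_space E -> R).
Proof. exact: measurableT_comp mindic (@measurable_past R E (r + t)). Qed.

(** Finiteness allows this term to be added to both sides of an inequality and cancelled. *)
Lemma integral_start_fin : ((\int[P mu]_w (\1_A w * (1 + mart 0 w))%:E)%E \is a fin_num).
Proof.
have m0 := measurable_mart (lexx 0) T0.
have p4 (w : path_space E) : setT w -> (0 <= (\1_A w * (1 + mart 0 w))%:E)%E.
  by move=> _; rewrite lee_fin; apply: mulr_ge0 (addr_ge0 ler01 (mart_ge0 w T0)).
rewrite (ge0_fin_numE (integral_ge0 (P mu) p4)).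
have i0 : (\int[P mu]_w (mart 0 w)%:E < +oo)%E.
  rewrite /mart (moment mu (bP T0) (addr_ge0 r0 (lexx 0))); exact: ltry.
apply: (@le_lt_trans _ _ (\int[P mu]_w (1%:E + (mart 0 w)%:E))%E).
  apply: (ge0_le_integral _ measurableT) => [w|||w _]; first exact: p4.
  - apply/measurable_EFinP; apply: measurable_funM mindicT _.
    exact: measurable_funD (measurable_cst _) m0.
  - by apply/measurable_EFinP; exact: measurable_funD (measurable_cst _) m0.
  - rewrite lee_fin; apply: ler_piMl; first exact: addr_ge0 ler01 (mart_ge0 w T0).
    by rewrite indicE; case: (_ \in _).
rewrite (ge0_integralD _ measurableT) => [||//|w _|].
- rewrite integral_cst; last exact: measurableT.
  by rewrite mul1e P_setT; apply: lte_add_pinfty i0; exact: ltry.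
- by move=> w _; rewrite lee_fin ler01.
- by rewrite lee_fin; exact: mart_ge0.
- exact/measurable_EFinP.
Qed.

(** For y = M_u - M_0, rem2 y + (1 + M_0) = e^{-y} + M_u. Moving the negative terms of [rem2] across
    leaves nonnegative integrands only, so that no integrability of e^{M_0 - M_u} is called for. *)
Lemma integral_rem2_split u : 0 <= u -> u <= T ->
  (\int[P mu]_w (\1_A w * rem2 (mart u w - mart 0 w))%:E
    + \int[P mu]_w (\1_A w * (1 + mart 0 w))%:E =
   \int[P mu]_w (\1_A w * expR (mart 0 w - mart u w))%:E
    + \int[P mu]_w (\1_A w * mart u w)%:E)%E.
Proof.
move=> u0 uT; have mu' := measurable_mart u0 uT; have m0 := measurable_mart (lexx 0) T0.
have mB := measurable_funB mu' m0.
have i0 w : 0 <= (\1_A w : R) by [].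
have e1 : measurable_fun [set: path_space E] (fun w => (\1_A w * expR (mart 0 w - mart u w))%:E).
  apply/measurable_EFinP; apply: measurable_funM mindicT _.
  by apply: measurableT_comp; [exact: measurable_expR|exact: measurable_funB].
have e2 : measurable_fun [set: path_space E] (fun w => (\1_A w * mart u w)%:E).
  by apply/measurable_EFinP; exact: measurable_funM.
have e3 : measurable_fun [set: path_space E] (fun w => (\1_A w * rem2 (mart u w - mart 0 w))%:E).
  apply/measurable_EFinP; apply: measurable_funM mindicT _.
  exact: measurableT_comp measurable_rem2 mB.
have e4 : measurable_fun [set: path_space E] (fun w => (\1_A w * (1 + mart 0 w))%:E).
  apply/measurable_EFinP; apply: measurable_funM mindicT _.
  exact: measurable_funD.
have p1 (w : path_space E) : setT w -> (0 <= (\1_A w * expR (mart 0 w - mart u w))%:E)%E.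
  by move=> _; rewrite lee_fin; apply: mulr_ge0 (expR_ge0 _).
have p2 (w : path_space E) : setT w -> (0 <= (\1_A w * mart u w)%:E)%E.
  by move=> _; rewrite lee_fin; apply: mulr_ge0 (mart_ge0 w uT).
have p3 (w : path_space E) : setT w -> (0 <= (\1_A w * rem2 (mart u w - mart 0 w))%:E)%E.
  by move=> _; rewrite lee_fin; apply: mulr_ge0 (rem2_ge0 _).
have p4 (w : path_space E) : setT w -> (0 <= (\1_A w * (1 + mart 0 w))%:E)%E.
  by move=> _; rewrite lee_fin; apply: mulr_ge0 (addr_ge0 ler01 (mart_ge0 w T0)).
rewrite -(ge0_integralD (P mu) measurableT p3 e3 p4 e4).
rewrite -(ge0_integralD (P mu) measurableT p1 e1 p2 e2).
apply: eq_integral => w _; rewrite -!EFinD -!mulrDr; congr (_ * _)%:E.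
by rewrite /rem2 opprB; ring.
Qed.

(* the convexity of rem2 enters through V <= PP: the conditional mean of
   e^{-M_T} is e^{-<V_{T-t} g, X_{r+t}>}, which is at least e^{-M_t} *)
Lemma rem2_submartingale :
  (\int[P mu]_w (\1_A w * rem2 (mart t w - mart 0 w))%:E <=
   \int[P mu]_w (\1_A w * rem2 (mart T w - mart 0 w))%:E)%E.
Proof.
rewrite -(leeD2rE _ _ integral_start_fin) (integral_rem2_split t0 tT) (integral_rem2_split T0 (lexx T)).
rewrite integral_mart; apply: leeD2r; rewrite integral_exp_mart; have m0 := measurable_mart (lexx 0) T0.
have bVt := Vb bg Tt0.
apply: (ge0_le_integral _ measurableT).
- by move=> w _; rewrite lee_fin; apply: mulr_ge0 (expR_ge0 _).
- apply/measurable_EFinP; apply: measurable_funM mindicT _.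
  apply: measurableT_comp; first exact: measurable_expR.
  by apply: measurable_funB m0 _; exact: measurable_mart.
- apply/measurable_EFinP; apply: measurable_funM mindicT _.
  apply: measurableT_comp; first exact: measurable_expR.
  by apply: measurable_funB m0 _; exact: measurable_pairing_traj bVt.2.1 rt0.
- move=> w _; rewrite lee_fin; apply: ler_wpM2l; first by rewrite indicE ler0n.
  rewrite ler_expR lerD2l lerN2; apply: le_pairing; [exact: bVt.1|exact: (bP tT).1|].
  by move=> y; exact: V_PP.
Qed.

End fixed_event.

(** Given X up to time r, e^{M_0 - M_T} has mean e^{<gap, X_r>}: this function alone governs the
    second-order fluctuation. *)
Definition gap y : R := PP T g y - V T g y.

Let bgap : Bbplus gap.
Proof.
have bp := PPb bg T0; have bv := Vb bg T0.
have b : Bb gap by exact: BbB bp.1 bv.1.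
by split => //; split => [|y]; [exact: b.1|rewrite subr_ge0; exact: V_PP].
Qed.

(** Up to 1/2 the exponential of <gap, X_r> is bounded by an affine function; the complement is left
    to Markov's inequality. The time r + 0 matches [mart] at 0 syntactically. *)
Let smallgap : set (mpath E) := [set w | pairing gap (traj w (r + 0)) <= 2^-1].

Let r00 : 0 <= r + 0. Proof. by rewrite addr0. Qed.

Let msmall u : 0 <= u -> measurable (smallgap : set (past u)).
Proof.
move=> u0; have mk : measurable_fun [set: past u] (fun w => pairing gap (traj w (r + 0))).
  by apply: measurable_pairing_past => //; [exact: bgap.2.1|rewrite lerD2l].
rewrite (_ : smallgap = setT `&` (fun w : past u => pairing gap (traj w (r + 0))) @^-1` [set x | x <= 2^-1]).
  by apply: (mk measurableT); rewrite -set_itvNyc.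
by rewrite setTI.
Qed.

Let integral_gap : (\int[P mu]_w (pairing gap (traj w (r + 0)))%:E = (pairing (PP r gap) mu)%:E)%E.
Proof. by rewrite (moment mu bgap r00) addr0. Qed.

Let mgap : measurable_fun [set: path_space E] (fun w : path_space E => pairing gap (traj w (r + 0))).
Proof. exact: measurable_pairing_traj bgap.2.1 r00. Qed.

Let gap_ge0 w : 0 <= pairing gap (traj w (r + 0)).
Proof. by apply: pairing_ge0; exact: bgap.2.2. Qed.

Let indic_ge0 (A : set (mpath E)) w : 0 <= (\1_A w : R).
Proof. by rewrite indicE ler0n. Qed.

(** Here (1 - x) e^x <= 1, while (1 + 2x)(1 - x) >= 1 on [0, 1/2]. *)
Let expR_le_half (x : R) : 0 <= x -> x <= 2^-1 -> expR x <= 1 + 2 * x.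
Proof.
move=> x0 x1; have h : (1 - x) * expR x <= 1.
  rewrite -ler_pdivlMr ?expR_gt0// div1r -expRN.
  by have := expR_ge1Dx (- x); rewrite addrC.
have := ler_wpM2l (_ : 0 <= 1 + 2 * x) h; rewrite mulr1 => /(_ _) H.
apply: le_trans (H _); last by lra.
by rewrite mulrA ler_peMl ?expR_ge0//; nra.
Qed.

(** The mean of rem2(M_T - M_0) given the past is e^{<gap, X_r>} - 1, at most 2 <gap, X_r> on
    [smallgap]. *)
Let integral_rem2_end :
  (\int[P mu]_w (\1_smallgap w * rem2 (mart T w - mart 0 w))%:E <=
   2%:E * (pairing (PP r gap) mu)%:E)%E.
Proof.
have mB := msmall (lexx 0); have mB' : measurable_fun [set: path_space E] (\1_smallgap : path_space E -> R).
  exact: measurableT_comp (measurable_indic mB) (@measurable_past R E (r + 0)).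
have m0 := measurable_mart (lexx 0) T0.
have fin := integral_start_fin mB.
rewrite -(leeD2rE _ _ fin) (integral_rem2_split mB T0 (lexx T)).
rewrite (integral_mart (lexx 0) T0 mB) (integral_exp_mart (lexx 0) T0 mB) subr0.
rewrite -integral_gap -ge0_integralZl//; last 2 first.
- exact/measurable_EFinP.
- by move=> w _; rewrite lee_fin.
have bv := Vb bg T0.
have q1 (w : path_space E) : setT w -> (0 <= (\1_smallgap w *
    expR (mart 0 w - pairing (V T g) (traj w (r + 0))))%:E)%E.
  by move=> _; rewrite lee_fin; apply: mulr_ge0 (expR_ge0 _).
have q2 (w : path_space E) : setT w -> (0 <= (\1_smallgap w * mart 0 w)%:E)%E.
  by move=> _; rewrite lee_fin; apply: mulr_ge0 (mart_ge0 w T0).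
have q3 (w : path_space E) : setT w -> (0 <= 2%:E * (pairing gap (traj w (r + 0)))%:E)%E.
  by move=> _; rewrite -EFinM lee_fin; apply: mulr_ge0 (gap_ge0 w).
have q4 (w : path_space E) : setT w -> (0 <= (\1_smallgap w * (1 + mart 0 w))%:E)%E.
  by move=> _; rewrite lee_fin; apply: mulr_ge0 (addr_ge0 ler01 (mart_ge0 w T0)).
have n1 : measurable_fun [set: path_space E] (fun w : path_space E => (\1_smallgap w *
    expR (mart 0 w - pairing (V T g) (traj w (r + 0))))%:E).
  apply/measurable_EFinP; apply: measurable_funM mB' _.
  apply: measurableT_comp; first exact: measurable_expR.
  by apply: measurable_funB m0 _; exact: measurable_pairing_traj bv.2.1 r00.
have n2 : measurable_fun [set: path_space E] (fun w : path_space E => (\1_smallgap w * mart 0 w)%:E).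
  by apply/measurable_EFinP; exact: measurable_funM mB' m0.
have n3 : measurable_fun [set: path_space E] (fun w : path_space E => 2%:E * (pairing gap (traj w (r + 0)))%:E)%E.
  by apply/measurable_EFinP; exact: measurable_funM (measurable_cst _) mgap.
have n4 : measurable_fun [set: path_space E] (fun w : path_space E => (\1_smallgap w * (1 + mart 0 w))%:E).
  apply/measurable_EFinP; apply: measurable_funM mB' _.
  exact: measurable_funD (measurable_cst _) m0.
rewrite -(ge0_integralD (P mu) measurableT q1 n1 q2 n2).
rewrite -(ge0_integralD (P mu) measurableT q3 n3 q4 n4).
apply: (ge0_le_integral _ measurableT).
- by move=> w _; exact: adde_ge0 (q1 w I) (q2 w I).
- exact: emeasurable_funD n1 n2.
- exact: emeasurable_funD n3 n4.
move=> w _; rewrite -EFinM -!EFinD lee_fin.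
have -> : mart 0 w - pairing (V T g) (traj w (r + 0)) = pairing gap (traj w (r + 0)).
  rewrite /mart subr0 /gap (pairingB (f1 := PP T g) (f2 := V T g))//.
    exact: (PPb bg T0).1.
  exact: bv.1.
have k0 := gap_ge0 w; have M0 := mart_ge0 w T0.
rewrite indicE; have [/set_mem|_] := boolP (w \in smallgap); rewrite /smallgap /=.
  move=> k1; have := expR_le_half k0 k1; rewrite /=.
  by move: (mart 0 w) (pairing _ _) k0 k1 M0 => M k k0 k1 M0; lra.
by move: (mart 0 w) (pairing _ _) k0 M0 => M k k0 M0; lra.
Qed.

Let integral_indic (A : set (path_space E)) (f : path_space E -> R) :
  (\int[P mu]_(w in A) (f w)%:E = \int[P mu]_w (\1_A w * f w)%:E)%E.
Proof.
rewrite integral_mkcond; apply: eq_integral => w _.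
by rewrite patchE indicE; case: (_ \in _); rewrite ?mul1r ?mul0r.
Qed.

(** Truncation lets i range over all naturals and makes T itself a grid point at every level. *)
Let grid n i : R := Num.min (i%:R / 2 ^+ n) T.

Let grid_ge0 n i : 0 <= grid n i.
Proof. by rewrite le_min T0 andbT divr_ge0// exprn_ge0. Qed.

Let grid_leT n i : grid n i <= T. Proof. by rewrite ge_min lexx orbT. Qed.

Let le_grid n i j : (i <= j)%N -> grid n i <= grid n j.
Proof.
move=> ij; rewrite le_min [X in _ && X]ge_min lexx orbT andbT ge_min.
by rewrite ler_pM2r ?ler_nat ?ij// invr_gt0 exprn_gt0.
Qed.

Let jump t : set (path_space E) := [set w | 1 <= `|mart t w - mart 0 w|].

Let mjump t u : 0 <= t -> t <= T -> t <= u -> measurable (jump t : set (past u)).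
Proof.
move=> t0 tT tu; have mM := measurable_mart_past t0 tT tu.
have mM0 := measurable_mart_past (lexx 0) T0 (le_trans t0 tu).
have mn := measurableT_comp (@normr_measurable R setT) (measurable_funB mM mM0).
rewrite (_ : jump t = setT `&` (fun w : past u => `|mart t w - mart 0 w|) @^-1` [set x | 1 <= x]).
  by apply: (mn measurableT); rewrite -set_itvcy.
by rewrite setTI.
Qed.

Let mjumpT t : 0 <= t -> t <= T -> measurable (jump t).
Proof.
move=> t0 tT; have := @measurable_past R E (r + t) measurableT _ (mjump t0 tT (lexx t)).
by rewrite setTI preimage_id.
Qed.

Let msmallT : measurable (smallgap : set (path_space E)).
Proof.
have := @measurable_past R E (r + 0) measurableT _ (msmall (lexx 0)).
by rewrite setTI preimage_id.
Qed.

Let G (w : path_space E) := (rem2 (mart T w - mart 0 w))%:E.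

Let mG : measurable_fun setT G.
Proof.
apply/measurable_EFinP; apply: measurableT_comp; first exact: measurable_rem2.
by apply: measurable_funB; exact: measurable_mart.
Qed.

Let G0 w : (0 <= G w)%E. Proof. by rewrite lee_fin rem2_ge0. Qed.

(* Doob's maximal inequality along the grid, the first jump time being the
   index of the disjointed union *)
Let grid_maximal n :
  (P mu (\bigcup_i (smallgap `&` jump (grid n i))) <= 8%:E * (pairing (PP r gap) mu)%:E)%E.
Proof.
pose F i : set (path_space E) := smallgap `&` jump (grid n i).
have mF i : measurable (F i) by apply: measurableI msmallT (mjumpT _ _).
have mFp i j : (j <= i)%N -> measurable (F j : set (past (grid n i))).
  move=> ji; apply: measurableI (msmall _) (mjump _ _ _) => //.
  exact: le_grid.
(* That the first jump along the grid occurs at index i is known at time [grid n i], as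
   [rem2_submartingale] requires. *)
have mD i : measurable (seqDU F i : set (past (grid n i))).
  apply: measurableD; first exact: mFp.
  by apply: bigsetU_measurable => j _; apply: mFp; exact: ltnW.
have mDT i : measurable (seqDU F i).
  by apply: measurableD => //; exact: bigsetU_measurable.
have le1 i : (P mu (seqDU F i) <= 4%:E * \int[P mu]_(w in seqDU F i) G w)%E.
  have G4 : (\int[P mu]_(w in seqDU F i) (rem2 (mart (grid n i) w - mart 0 w))%:E <=
      \int[P mu]_(w in seqDU F i) G w)%E.
    rewrite /G (integral_indic _ (fun w => rem2 (mart (grid n i) w - mart 0 w))).
    rewrite (integral_indic _ (fun w => rem2 (mart T w - mart 0 w))).
    exact: (rem2_submartingale (grid_ge0 n i) (grid_leT n i) (mD i)).
  apply: le_trans (lee_wpmul2l _ G4); last by rewrite lee_fin.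
  have mr : measurable_fun (seqDU F i) (fun w : path_space E => (rem2 (mart (grid n i) w - mart 0 w))%:E).
    apply/measurable_EFinP; apply: measurable_funTS.
    apply: measurableT_comp; first exact: measurable_rem2.
    by apply: measurable_funB; exact: measurable_mart.
  have r0' w : seqDU F i w -> (0 <= (rem2 (mart (grid n i) w - mart 0 w))%:E)%E.
    by move=> _; rewrite lee_fin rem2_ge0.
  rewrite -(ge0_integralZl_EFin _ (mDT i) r0' mr)//.
  rewrite -[leLHS]mul1e -(integral_cst (P mu) (mDT i)).
  apply: (ge0_le_integral _ (mDT i)) => //; first exact: measurable_funeM.
  move=> w [[_ wj] _]; rewrite -EFinM lee_fin /=.
  by rewrite -ler_pdivrMl// mulr1; exact: rem2_ge.
rewrite (_ : \bigcup_i _ = \bigcup_i F i)// seqDU_bigcup_eq.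
have mU := bigcup_measurable (fun i _ => mDT i).
rewrite measure_semi_bigcup//.
apply: (@le_trans _ _ (4%:E * \int[P mu]_(w in \bigcup_i seqDU F i) G w)%E).
  rewrite ge0_integral_bigcup//; last exact: measurable_funTS.
  rewrite -nneseriesZl; last by move=> i _; apply: integral_ge0.
  by apply: lee_nneseries => // i _.
(* 4 is the inverse of the lower bound of [rem2] on a jump, 2 the factor in [integral_rem2_end]. *)
have -> : 8 = 4 * 2 :> R by ring.
rewrite EFinM -muleA lee_wpmul2l ?lee_fin//.
apply: le_trans integral_rem2_end.
rewrite -(integral_indic smallgap (fun w => rem2 (mart T w - mart 0 w))).
apply: ge0_subset_integral => //; first exact: measurable_funTS.
by rewrite -seqDU_bigcup_eq => w [i _ []].
Qed.

(** The dyadic grids are nested, so on [smallgap] the bound with factor 8 passes to the increasing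
    union over n; Markov's inequality at level 1/2 adds 2 off [smallgap]. *)
Lemma maximal_inequality : measurable (\bigcup_n \bigcup_i jump (grid n i)) /\
  (P mu (\bigcup_n \bigcup_i jump (grid n i)) <= 10%:E * (pairing (PP r gap) mu)%:E)%E.
Proof.
have mj n i : measurable (jump (grid n i)) by exact: mjumpT.
have mU : measurable (\bigcup_n \bigcup_i jump (grid n i)).
  by apply: bigcup_measurable => n _; exact: bigcup_measurable.
split => //; pose S n : set (path_space E) := \bigcup_i (smallgap `&` jump (grid n i)).
have mS n : measurable (S n) by apply: bigcup_measurable => i _; exact: measurableI.
have mSU : measurable (\bigcup_n S n) by exact: bigcup_measurable.
have SU : (P mu (\bigcup_n S n) <= 8%:E * (pairing (PP r gap) mu)%:E)%E.
  have ndS : nondecreasing_seq S.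
    apply/nondecreasing_seqP => n; apply/subsetPset => w [i _ [sw jw]].
    exists i.*2 => //; split => //; suff <- : grid n i = grid n.+1 i.*2 by [].
    rewrite /grid; congr Num.min; rewrite -muln2 natrM exprS.
    by rewrite invfM mulrA mulfK ?pnatr_eq0.
  have cS := nondecreasing_cvg_mu (mu := P mu) mS mSU ndS.
  by apply: (cvge_to_le cS); apply: nearW => n; exact: grid_maximal.
have big : (P mu (~` smallgap) <= 2%:E * (pairing (PP r gap) mu)%:E)%E.
  have mC := measurableC msmallT.
  rewrite -integral_gap -ge0_integralZl//; last 2 first.
  - exact/measurable_EFinP.
  - by move=> w _; rewrite lee_fin.
  have m2 : measurable_fun [set: path_space E] (fun w : path_space E => 2%:E * (pairing gap (traj w (r + 0)))%:E)%E.
    by apply/measurable_EFinP; exact: measurable_funM (measurable_cst _) mgap.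
  have p2 (w : path_space E) : setT w -> (0 <= 2%:E * (pairing gap (traj w (r + 0)))%:E)%E.
    by move=> _; rewrite -EFinM lee_fin; apply: mulr_ge0 (gap_ge0 w).
  apply: (@le_trans _ _ (\int[P mu]_(w in ~` smallgap) (2%:E * (pairing gap (traj w (r + 0)))%:E))%E).
    rewrite -[leLHS]mul1e -(integral_cst (P mu) mC).
    apply: (ge0_le_integral _ mC) => //; first exact: measurable_funTS.
    move=> w /negP; rewrite /smallgap /= -ltNge -EFinM lee_fin => /ltW.
    by rewrite -ler_pdivrMl// mulr1.
  apply: ge0_subset_integral => //; exact: measurable_funTS.
apply: (@le_trans _ _ (P mu ((\bigcup_n S n) `|` ~` smallgap))).
  apply: le_measure; rewrite ?inE//; first by apply: measurableU => //; exact: measurableC.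
  move=> w [n _ [i _ jw]]; have [sw|sw] := pselect (smallgap w); last by right.
  by left; exists n => //; exists i.
apply: le_trans (measureU2 _ _ _) _ => //; first exact: measurableC.
apply: le_trans (leeD SU big) _; rewrite -muleDl//.
have -> : 10 = 8 + 2 :> R by ring.
by rewrite EFinD.
Qed.

End maximal_inequality.

(** * From dyadic to real times, and approximation from below by countably many functions *)

(** Grid times come arbitrarily close to u from the right, where [a] is right continuous. The bound
    is asked only at grid times not before u, because in [continuous_limit] it holds near the end of
    a window only. *)
Lemma right_dyadic_le (R : realType) (a : R -> R) (r T u c b : R) : r <= u -> u < r + T ->
  a x @[x --> u^'+] --> a u ->
  (forall k i, u <= r + Num.min (i%:R / 2 ^+ k) T ->
     `|a (r + Num.min (i%:R / 2 ^+ k) T) - c| <= b) ->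
  `|a u - c| <= b.
Proof.
move=> ru urT au H; apply/ler_addgt0Pr => e e0.
have /cvgrPdist_lt/(_ e e0) := au; move=> [d /= d0 Hd].
pose d' := Num.min d (r + T - u).
have d'0 : 0 < d' by rewrite lt_min d0 subr_gt0.
have [k Hk] : exists k, 1 / 2 ^+ k < d'.
  have [k _ Hk] := near_infty_natSinv_expn_lt (PosNum d'0).
  by exists k; apply: Hk => /=.
have k0 : 0 < 2 ^+ k :> R by exact: exprn_gt0.
have ur0 : 0 <= (u - r) * 2 ^+ k by rewrite mulr_ge0 ?subr_ge0// ltW.
pose i := (Num.truncn ((u - r) * 2 ^+ k)).+1; pose t : R := i%:R / 2 ^+ k.
have t1 : u - r < t by rewrite ltr_pdivlMr//; exact: truncnS_gt.
have t2 : t <= u - r + 1 / 2 ^+ k.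
  rewrite -(ler_pM2r k0) divfK ?gt_eqF// mulrDl divfK ?gt_eqF// /i -natr1 lerD2r.
  by rewrite truncn_le.
move: Hk; rewrite lt_min => /andP[kd kT].
have tT : t < T by lra.
have Et : Num.min t T = t by apply/min_idPl/ltW.
have ut : u < r + t by lra.
have h1 : `|a (r + t) - c| <= b by rewrite -Et; apply: H; rewrite Et ltW.
have h2 : `|a u - a (r + t)| < e.
  apply: Hd => //; rewrite /ball /= ltr0_norm; last by lra.
  by lra.
have -> : a u - c = (a u - a (r + t)) + (a (r + t) - c) by ring.
by apply: le_trans (ler_normD _ _) _; rewrite addrC lerD// ltW.
Qed.

Section right_continuous_paths.
Context {R : realType} {E : pmetricType R}.

Lemma right_cvg_pairing (w : mpath E) (f : E -> R) (t : R) : continuous f ->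
  bounded_fct f -> 0 <= t -> pairing f (w s) @[s --> t^'+] --> pairing f (w t).
Proof.
move=> cf bf t0.
exact: cvg_comp (@traj_right _ _ w t t0) (@pairing_continuous _ _ _ cf bf (w t)).
Qed.

End right_continuous_paths.

Section lower_envelopes.
Context {R : realType} {E : pmetricType R}.
Hypothesis E_lc : locally_compact [set: E].
Variable s : nat -> E.
Hypothesis dense_s : forall U : set E, open U -> U !=set0 -> exists n, U (s n).
Implicit Types (f g : E -> R) (x y : E).

Lemma C0_max f g : C0 f -> C0 g -> C0 (fun y => Num.max (f y) (g y)).
Proof.
move=> [cf [K fK] ef] [cg [L gL] eg]; split.
- by move=> x; apply: cvg_maxr; [exact: cf|exact: cg].
- exists (Num.max K L) => x; rewrite /Num.max /Order.max.
  by case: ifP => _; rewrite le_max ?fK ?gL ?orbT.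
- have -> : ext (fun y => Num.max (f y) (g y)) = (fun z => Num.max (ext f z) (ext g z)).
    by apply/funext => -[y|]//=; rewrite maxxx.
  by move=> z; exact: cvg_maxr (ef z) (eg z).
Qed.

Lemma C0_cst0 : C0 (cst 0 : E -> R).
Proof.
split; first by move=> x; exact: cvg_cst.
  by exists 0 => x; rewrite normr0.
have -> : ext (cst 0 : E -> R) = cst 0 by apply/funext => -[].
exact: (@cst_continuous (Ed E) R).
Qed.

Lemma C0_compact_support f (K : set E) : continuous f -> bounded_fct f ->
  compact K -> closed K -> (forall x, ~ K x -> f x = 0) -> C0 f.
Proof.
move=> cf bf cK clK fK; split => // -[x|]; first exact: cf.
move=> A /= /nbhs_singleton A0; exists K => // -[y|//] /=.
by case=> [[z nKz [<-]]|//]; rewrite /= fK.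
Qed.

(* the truncated cone of height a, slope k and radius 2 r around s_n *)
Definition cone (b : nat * rat * rat * nat) y : R :=
  let: (n, r, a, k) := b in
  Num.max 0 (Num.min (ratr a) (k%:R * (ratr r + ratr r - mdist (s n) y))).

(** Rational and natural parameters make the family countable. When the ball is not compact the cone
    is replaced by 0, so that every parameter yields a function in [C0]. *)
Definition bump (b : nat * rat * rat * nat) y : R :=
  if `[< compact (cball (s b.1.1.1) (ratr b.1.1.2 + ratr b.1.1.2 : R)) >] then cone b y else 0.

Lemma C0_bump b : C0 (bump b).
Proof.
rewrite /bump; case: asboolP => [|_]; last exact: C0_cst0.
case: b => [[[n r] a] k] /= cK.
apply: (C0_compact_support (K := cball (s n) (ratr r + ratr r))) => //; last 2 first.
- exact: closed_cball.
- move=> x /negP; rewrite /cball /= -ltNge => rx.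
  have kx : k%:R * (ratr r + ratr r - mdist (s n) x) <= 0 :> R.
    by rewrite mulr_ge0_le0// subr_le0 ltW.
  by apply/max_idPl; rewrite ge_min kx orbT.
- move=> x; apply: cvg_maxr; first exact: cvg_cst.
  apply: cvg_minr; first exact: cvg_cst.
  apply: cvgMr; apply: cvgB; first exact: cvg_cst.
  exact: mdist_continuous.
- exists `|ratr a| => x; rewrite [leLHS]ger0_norm ?le_max ?lexx//.
  by rewrite ge_max normr_ge0 ge_min ler_norm.
Qed.

Lemma bump_ge0 b y : 0 <= bump b y.
Proof. by rewrite /bump; case: ifP => // _; case: b => [[[n r] a] k]; rewrite le_max lexx. Qed.

(** Lists over a countable type form a countable type, so these maxima of bumps are a countable
    family in [C0], fixed before f is known. *)
Definition envelope l y : R := foldr (fun b z => Num.max (bump b y) z) 0 l.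

Lemma C0_envelope l : C0 (envelope l).
Proof.
elim: l => [|b l IH]; first exact: C0_cst0.
exact: C0_max (C0_bump b) IH.
Qed.

Lemma envelope_ge0 l y : 0 <= envelope l y.
Proof. by elim: l => //= b l IH; rewrite le_max IH orbT. Qed.

Lemma envelope_le l f : (forall y, 0 <= f y) ->
  (forall b y, b \in l -> bump b y <= f y) -> forall y, envelope l y <= f y.
Proof.
move=> f0; elim: l => [|b l IH] bf y /=; first exact: f0.
rewrite ge_max bf ?inE ?eqxx//= IH// => c z cl.
by apply: bf; rewrite inE cl orbT.
Qed.

Lemma bump_le_envelope l b y : b \in l -> bump b y <= envelope l y.
Proof.
elim: l => // c l IH; rewrite inE => /predU1P[->|bl] /=; rewrite le_max ?lexx//.
by rewrite IH ?orbT.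
Qed.

(** A rational height a between f x - e and f x is exceeded by f near x. In this neighbourhood lies
    a ball of radius 2r whose centre is within r of x; a slope k >= a/r lets the cone reach a at x,
    and off the ball it vanishes while f >= 0. *)
Lemma bump_approx f x (e : R) : (forall y, 0 <= f y) -> {for x, continuous f} -> 0 < e ->
  exists b, (forall y, bump b y <= f y) /\ f x - e <= bump b x.
Proof.
move=> f0 cf e0; have [fe|fe] := leP (f x) e.
  exists (0%N, 0%Q, 0%Q, 0%N); split => [y|].
    rewrite /bump; case: ifP => // _ /=.
    by rewrite rmorph0 mul0r minxx maxxx.
  by apply: le_trans (bump_ge0 _ _); rewrite subr_le0.
have [a] : exists a : rat, ratr a \in `]f x - e, f x[.
  by apply: rat_in_itvoo; rewrite gtrBl.
rewrite in_itv /= => /andP[a1 a2].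
have : nbhs x [set y | ratr a < f y].
  by have /cvgr_gt := cf; apply.
rewrite nbhsE => -[U [oU Ux] Ua].
have [n [r [nx cr rU]]] := compact_ball_basis E_lc dense_s oU Ux.
have r0 : 0 < ratr r :> R by apply: le_lt_trans nx; exact: mdist_ge0.
pose k := (Num.truncn (ratr a / ratr r : R)).+1.
have ka : ratr a <= k%:R * ratr r :> R.
  by rewrite -ler_pdivrMr// ltW// truncnS_gt.
exists (n, r, a, k); split => [y|].
  rewrite /bump; case: ifP => // _ /=; rewrite ge_max f0/= ge_min.
  have [yU|yU] := pselect (cball (s n) (ratr r + ratr r) y).
    by rewrite ltW// Ua//; exact: rU.
  apply/orP; right; apply: le_trans (f0 y).
  by rewrite mulr_ge0_le0// subr_le0 ltW// ltNge; apply/negP.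
rewrite /bump asboolT//= le_max le_min (ltW a1) /=; apply/orP; right.
apply: le_trans (ltW a1) _; apply: le_trans ka _; rewrite ler_wpM2l//.
by rewrite -addrA lerDl subr_ge0 ltW.
Qed.

(** Keeping, among the first n codes, the bumps that lie below f gives envelopes that converge to f
    at each continuity point, hence almost everywhere; f k dominates. *)
Lemma envelope_integral (m : {measure set (borel E) -> \bar R}) (k f : E -> R) (M e : R) :
  m.-integrable setT (EFin \o k) -> (forall y, 0 <= k y) ->
  measurable_fun [set: borel E] f -> (forall y, 0 <= f y <= M) ->
  (\forall x \ae m, {for x, continuous f}) -> 0 < e ->
  exists l, (forall y, envelope l y <= f y) /\
    \int[m]_y (f y * k y) - e <= \int[m]_y (envelope l y * k y).
Proof.
move=> ik k0 mf fM cf e0; have f0 y : 0 <= f y by have /andP[] := fM y.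
have mk : measurable_fun [set: borel E] k by apply/measurable_EFinP; exact: measurable_int ik.
pose L n := [seq b <- pmap unpickle (iota 0 n) | `[< forall y, bump b y <= f y >]].
have Lf n y : envelope (L n) y <= f y.
  apply: envelope_le => // b z; rewrite mem_filter => /andP[/asboolP + _]; exact.
have mE n : measurable_fun [set: borel E] (envelope (L n)).
  by apply: continuous_borel; have [] := C0_envelope (L n).
have cE x : {for x, continuous f} -> envelope (L n) x @[n --> \oo] --> f x.
  move=> cfx; apply/cvgrPdist_le => d d0.
  have [b [bf bx]] := bump_approx f0 cfx d0.
  exists (pickle b).+1 => // n /= bn.
  rewrite ger0_norm ?subr_ge0// lerBlDr -lerBlDl; apply: le_trans bx _.
  apply: bump_le_envelope; rewrite mem_filter; apply/andP; split; first exact/asboolP.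
  rewrite mem_pmap; apply/mapP; exists (pickle b); first by rewrite mem_iota add0n.
  by rewrite pickleK.
pose fk y : R := f y * k y.
have ifk : m.-integrable setT (EFin \o fk).
  have iM := integrableZl measurableT M ik.
  apply: le_integrable iM => //; first by apply/measurable_EFinP; exact: measurable_funM.
  move=> y _; have /andP[fy0 fyM] := fM y; rewrite /= lee_fin !normrM.
  by rewrite ler_wpM2r// ger0_norm// (le_trans fyM)// ler_norm.
have mF n : measurable_fun [set: borel E] (fun y => (envelope (L n) y * k y)%:E).
  by apply/measurable_EFinP; exact: measurable_funM.
have mfk : measurable_fun [set: borel E] (EFin \o fk).
  by apply/measurable_EFinP; exact: measurable_funM.
have Ff : {ae m, forall y, setT y ->
    (envelope (L n) y * k y)%:E @[n --> \oo] --> (EFin \o fk) y}.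
  have [A [mA A0 sub]] := cf; exists A; split => //.
  apply: subset_trans sub => y nF cfy; apply: nF => _; apply: cvg_EFin; first exact: nearW.
  by apply: cvgMl; exact: cE.
have Fm : {ae m, forall y n, setT y ->
    (`|(envelope (L n) y * k y)%:E| <= (EFin \o fk) y)%E}.
  apply/aeW => y n _; rewrite lee_fin ger0_norm ?mulr_ge0 ?envelope_ge0//.
  by rewrite ler_wpM2r.
have [_ _] := dominated_convergence measurableT mF mfk Ff ifk Fm.
have fin := integrable_fin_num measurableT ifk.
rewrite -(fineK fin) => /fine_cvgP[_ cI].
have /cvgrPdist_le/(_ e e0)[N _ HN] := cI.
exists (L N); split => //; have := HN N (leqnn N).
by move=> /ler_normlW; rewrite lerBlDl -lerBlDr.
Qed.

End lower_envelopes.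

(** * Linearity of the mean semigroup, first moments and semigroup laws *)

Section mean_density_linearity.
Context {R : realType} {E : pmetricType R}.
Variables (m : {sigma_finite_measure set (borel E) -> \bar R})
  (PP : R -> (E -> R) -> E -> R) (pp : R -> E -> E -> \bar R)
  (pp_dens : mean_density m PP pp).
Hypothesis PP0 : forall f x, Bb f -> PP 0 f x = f x.
Implicit Types (f g : E -> R) (t c : R) (x : E).

Lemma integrable_pp f t x : Bb f -> 0 < t ->
  m.-integrable setT (fun y => pp t x y * (f y)%:E)%E.
Proof.
move=> [mf [K fK]] t0; have [mpp pp0 ppE] := pp_dens t0.
have mx : measurable_fun [set: borel E] (pp t x).
  exact: measurableT_comp mpp (measurable_pair1 (x : borel E)).
have K0 : 0 <= K by exact: le_trans (fK point).
apply/integrableP; split.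
  by apply: emeasurable_funM => //; apply/measurable_EFinP.
apply: (@le_lt_trans _ _ (\int[m]_y (pp t x y * (cst K y)%:E))%E).
  apply: ge0_le_integral => //.
  - apply: measurableT_comp => //; apply: emeasurable_funM => //; exact/measurable_EFinP.
  - by apply: emeasurable_funM => //; exact/measurable_EFinP/measurable_cst.
  - by move=> y _; rewrite abseM (gee0_abs (pp0 _ _)) lee_wpmul2l// lee_fin.
by rewrite -ppE ?ltry//; exact: Bb_cst.
Qed.

(** Linearity is read off the density, which exists at positive times only; time 0 is settled by
    [PP0]. *)
Lemma meanD f g t x : Bb f -> Bb g -> 0 <= t ->
  PP t (fun y => f y + g y) x = PP t f x + PP t g x.
Proof.
move=> bf bg; rewrite le_eqVlt => /predU1P[<-|t0].
  by rewrite !PP0//; exact: BbD.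
have [_ _ ppE] := pp_dens t0; apply: EFin_inj.
rewrite EFinD !ppE//; last exact: BbD.
rewrite -integralD//; [|exact: integrable_pp..].
(* The density may take the value +oo, but its integral is finite, so it is finite almost
   everywhere; distributivity is invoked only there. *)
have i1 := integrable_pp x (Bb_cst 1) t0.
apply: ae_eq_integral => //.
- by case/integrableP: (integrable_pp x (BbD bf bg) t0).
- by apply: emeasurable_funD; [case/integrableP: (integrable_pp x bf t0)|
    case/integrableP: (integrable_pp x bg t0)].
- apply: filterS (integrable_ae measurableT i1) => y /(_ I); rewrite mule1 => fy _.
  by rewrite EFinD muleDr// fin_num_adde_defl.
Qed.

Lemma meanZ c f t x : Bb f -> 0 <= t -> PP t (fun y => c * f y) x = c * PP t f x.
Proof.
move=> bf; rewrite le_eqVlt => /predU1P[<-|t0].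
  by rewrite !PP0//; exact: BbZ.
have [_ _ ppE] := pp_dens t0; apply: EFin_inj.
rewrite EFinM !ppE//; last exact: BbZ.
rewrite -integralZl//; last exact: integrable_pp.
by apply: eq_integral => y _; rewrite EFinM muleCA.
Qed.

Lemma meanB f g t x : Bb f -> Bb g -> 0 <= t ->
  PP t (fun y => f y - g y) x = PP t f x - PP t g x.
Proof.
move=> bf bg t0; have bN : Bb (fun y => -1 * g y) by exact: BbZ.
rewrite -mulN1r -meanZ// -meanD//; congr (PP t _ x).
by apply/funext => y; rewrite mulN1r.
Qed.

Lemma mean_ge0 f t x : Bb f -> (forall y, 0 <= f y) -> 0 <= t -> 0 <= PP t f x.
Proof.
move=> bf f0; rewrite le_eqVlt => /predU1P[<-|t0]; first by rewrite PP0.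
have [_ pp0 ppE] := pp_dens t0; rewrite -lee_fin ppE//.
by apply: integral_ge0 => y _; rewrite mule_ge0// lee_fin.
Qed.

Lemma le_mean f g t x : Bb f -> Bb g -> (forall y, f y <= g y) -> 0 <= t ->
  PP t f x <= PP t g x.
Proof.
move=> bf bg fg t0; rewrite -subr_ge0 -meanB//; apply: mean_ge0 => //.
  exact: BbB.
by move=> y; rewrite subr_ge0.
Qed.

End mean_density_linearity.

Section superprocess_moments.
Context {R : realType} {E : pmetricType R} {d} {Omega : measurableType d}.
Variable xi : hunt_process E Omega.
Hypothesis E_lc : locally_compact [set: E].
Variable s : nat -> E.
Hypothesis dense_s : forall U : set E, open U -> U !=set0 -> exists n, U (s n).
Variables (br : branching_mechanism E) (gamma : R.-fker (borel E) ~> (borel E)).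
Hypothesis gammaE : nonlocal_kernel br gamma.
Variables (V PP : R -> (E -> R) -> E -> R).
Hypotheses (V_cum : cumulant_semigroup br xi V) (PP_mean : mean_semigroup br xi gamma PP).
Variables (m : {sigma_finite_measure set (borel E) -> \bar R})
  (pp : R -> E -> E -> \bar R) (pp_dens : mean_density m PP pp).
Variable P : R.-pker (borel (fmeas E)) ~> (path_space E).
Hypothesis P_sup : is_superprocess V P.
Implicit Types (f g : E -> R) (r t c K : R) (x y : E) (mu : fmeas E).

Lemma mean0 f x : Bb f -> PP 0 f x = f x.
Proof.
move=> bf; rewrite (mean_evol E_lc dense_s PP_mean x bf (lexx 0) (lexx 0)).
by rewrite time_integral0 addr0 (Pt0 xi E_lc dense_s)//; case: bf.
Qed.

Let Plty mu : (P mu setT < +oo)%E.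
Proof. by rewrite P_setT ltry. Qed.

Let laplace_integrable mu f c t : Bbplus f -> 0 <= c -> 0 <= t ->
  (P mu).-integrable setT
    (EFin \o (fun w : path_space E => expR (- (c * pairing f (traj w t))))).
Proof.
move=> bf c0 t0; apply: (integrable_bounded measurableT (Plty mu) (M := 1)).
  apply: measurableT_comp => //; apply: measurableT_comp => //.
  apply: measurable_funM => //; exact: measurable_pairing_traj bf.2.1 t0.
move=> w _; rewrite ger0_norm ?expR_ge0// expR_le1 oppr_le0 mulr_ge0//.
by rewrite pairing_ge0//; exact: bf.2.2.
Qed.

Lemma laplaceZ mu f c t : Bbplus f -> 0 <= c -> 0 <= t ->
  \int[P mu]_w expR (- (c * pairing f (traj w t)))
  = expR (- pairing (V t (fun y => c * f y)) mu).
Proof.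
move=> bf c0 t0; rewrite -(super_laplace P_sup mu t0 (Bbplus_scale bf c0)).
by apply: eq_Rintegral => w _; rewrite pairingZ//; exact: bf.1.
Qed.

Lemma measurable_fct_pairing_traj f t : Bb f -> 0 <= t ->
  measurable_fun [set: path_space E] (fun w : path_space E => (pairing f (traj w t))%:E).
Proof. by move=> bf t0; apply/measurable_EFinP; exact: measurable_pairing_traj bf.1 t0. Qed.

Let th n : R := n.+1%:R^-1.

(** This is [cvg_mean_cum] integrated against [mu]; after rescaling, the a priori bounds are uniform
    in n and justify bounded convergence. *)
Let cvg_scaled_cumulant mu f t : Bbplus f -> 0 <= t ->
  n.+1%:R * pairing (V t (fun y => th n * f y)) mu @[n --> \oo]
    --> pairing (PP t f) mu.
Proof.
move=> bf t0; have [C C0 HC] := drift_bound br gamma.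
have [K fK'] := bf.1.2; have K0 : 0 <= K by exact: le_trans (fK' point).
have fK y : f y <= K by exact: le_trans (ler_norm _) (fK' y).
have th0 n : 0 <= th n by rewrite /th invr_ge0.
have bfn n : Bbplus (fun y => th n * f y) by exact: Bbplus_scale.
have bV n := (cum_Bbplus V_cum (bfn n) t0).
have bP : Bb (PP t f) by exact: (mean_Bb PP_mean bf.1).
pose D n y := n.+1%:R * (PP t (fun y => th n * f y) y - V t (fun y => th n * f y) y).
have Dc y : D n y @[n --> \oo] --> (0 : R) by exact: (cvg_mean_cum E_lc dense_s gammaE V_cum PP_mean y bf t0).
have DE n y : D n y = PP t f y - n.+1%:R * V t (fun y => th n * f y) y.
  rewrite /D mulrBr (meanZ pp_dens mean0)//; last exact: bf.1.
  by rewrite /th mulVKf// pnatr_eq0.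
pose L := 2 * K * expR ((2 * C + 1) * t).
have VL n y : n.+1%:R * V t (fun y => th n * f y) y <= L.
  rewrite -ler_pdivlMl ?ltr0Sn//.
  have -> : n.+1%:R^-1 * L = 2 * (th n * K) * expR ((2 * C + 1) * t).
    by rewrite /L /th; ring.
  apply: (cum_apriori E_lc dense_s gammaE V_cum y HC C0 (bfn n) _ t0) => z.
  by rewrite ler_wpM2l.
have PL y : `|PP t f y| <= L.
  exact: (mean_apriori E_lc dense_s PP_mean y HC C0 bf.1 fK' t0).
have DL n y : `|D n y| <= L + L.
  rewrite DE; apply: le_trans (ler_normB _ _) (lerD (PL y) _).
  by rewrite ger0_norm// mulr_ge0//; exact: (bV n).2.2.
have bD n : Bb (D n).
  split; last by exists (L + L).
  have -> : D n = fun y => PP t f y - n.+1%:R * V t (fun y => th n * f y) y.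
    by apply/funext => y; exact: DE.
  by apply: (BbB bP _).1; exact: BbZ (bV n).1.
have c0 : pairing (D n) mu @[n --> \oo] --> (0 : R).
  have -> : 0 = pairing (cst 0) mu by rewrite pairing_cst mul0r.
  refine (@cvg_Rintegral_bounded _ _ _ mu _ measurableT _ _ _ (L + L) _ _ _) => //.
  - exact: fmeas_lty.
  - by move=> n; exact: (bD n).1.
have -> : (fun n => n.+1%:R * pairing (V t (fun y => th n * f y)) mu) =
    (fun n => pairing (PP t f) mu - pairing (D n) mu).
  apply/funext => n; rewrite -pairingZ; last exact: (bV n).1.
  have -> : pairing (D n) mu = pairing (fun y => PP t f y - n.+1%:R * V t (fun y => th n * f y) y) mu.
    by congr (pairing _ mu); apply/funext => y; exact: DE.
  rewrite pairingB//; last exact: BbZ (bV n).1.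
  by rewrite opprB addrC subrK.
by rewrite -[X in _ --> X]subr0; apply: cvgB => //; exact: cvg_cst.
Qed.

(** The difference quotient (1 - e^{-theta Y}) / theta at theta = 1/(n+1), which is at most Y and
    tends to Y. *)
Let scaled (Y : R) n := n.+1%:R * (1 - expR (- (th n * Y))).

Let scaled_ge0 Y n : 0 <= Y -> 0 <= scaled Y n.
Proof.
move=> Y0; rewrite mulr_ge0// subr_ge0 expR_le1 oppr_le0 mulr_ge0//.
by rewrite /th invr_ge0.
Qed.

Let scaled_le Y n : scaled Y n <= Y.
Proof.
rewrite /scaled /th -ler_pdivlMl ?ltr0Sn//.
by move: (n.+1%:R^-1 * Y) => z; have := expR_ge1Dx (- z); lra.
Qed.

Let cvg_scaled (a : nat -> R) (l : R) : (forall n, 0 <= a n) ->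
  n.+1%:R * a n @[n --> \oo] --> l ->
  n.+1%:R * (1 - expR (- a n)) @[n --> \oo] --> l.
Proof.
move=> a0 al; have lo : n.+1%:R * a n - (n.+1%:R * a n) * ((n.+1%:R * a n) * th n) @[n --> \oo] --> l.
  rewrite -[X in _ --> X]subr0; apply: cvgB => //.
  rewrite -(mulr0 l); apply: cvgM => //; rewrite -(mulr0 l); apply: cvgM => //.
  exact: cvg_harmonic.
apply: (squeeze_cvgr _ lo al); apply: nearW => n.
have n0 : n.+1%:R != 0 :> R by rewrite pnatr_eq0.
have -> : n.+1%:R * a n - n.+1%:R * a n * (n.+1%:R * a n * th n) = n.+1%:R * (a n - a n ^+ 2).
  by rewrite /th [n.+1%:R * a n * _^-1]mulrAC mulfV// mul1r mulrBr expr2 mulrA.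
have := rem2_le_sqr (a0 n); have := expR_ge1Dx (- a n); rewrite /rem2 => h1 h2.
by apply/andP; split; rewrite ler_wpM2l//; lra.
Qed.

(** The Laplace functional is differentiated at 0. Fatou's lemma first shows that <f, X_t> is
    integrable; being itself a majorant of its difference quotients, it then gives equality by
    dominated convergence. *)
Lemma super_moment mu f t : Bbplus f -> 0 <= t ->
  (\int[P mu]_w (pairing f (traj w t))%:E = (pairing (PP t f) mu)%:E)%E.
Proof.
move=> bf t0; have bf1 := bf.1; have f0 := bf.2.2.
pose Y (w : path_space E) := pairing f (traj w t); pose l := pairing (PP t f) mu.
have Y0 w : 0 <= Y w by exact: pairing_ge0.
have mY : measurable_fun setT Y by exact: measurable_pairing_traj bf.2.1 t0.
have mS n : measurable_fun [set: path_space E] (fun w => (scaled (Y w) n)%:E).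
  apply/measurable_EFinP; apply: measurable_funM => //; apply: measurable_funB => //.
  by apply: measurableT_comp => //; apply: measurableT_comp => //; exact: measurable_funM.
have th0 n : 0 <= th n by rewrite /th invr_ge0.
have intS n : (\int[P mu]_w (scaled (Y w) n)%:E =
    (n.+1%:R * (1 - expR (- pairing (V t (fun y => th n * f y)) mu)))%:E)%E.
  have i1 : (P mu).-integrable setT (EFin \o (cst 1 : path_space E -> R)).
    by apply: (integrable_bounded measurableT (Plty mu) (M := 1)) => //= *; rewrite normr1.
  have i2 := laplace_integrable mu bf (th0 n) t0.
  have i3 := integrableB measurableT i1 i2.
  rewrite -laplaceZ// (_ : _ * _ = \int[P mu]_w scaled (Y w) n); last first.
    rewrite (RintegralZl n.+1%:R (f := fun w => 1 - expR (- (th n * Y w))) measurableT i3).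
    rewrite (RintegralB measurableT i1 i2) Rintegral_cst//.
    by rewrite mul1r /= (P_setT P mu).
  rewrite /Rintegral fineK//; apply: integrable_fin_num => //.
  exact: (integrableZl measurableT n.+1%:R i3).
have cS : (\int[P mu]_w (scaled (Y w) n)%:E @[n --> \oo] --> l%:E)%E.
  under eq_fun do rewrite intS.
  apply: cvg_EFin; first exact: nearW.
  apply: cvg_scaled; last exact: cvg_scaled_cumulant.
  by move=> n; apply: pairing_ge0; apply: (cum_Bbplus V_cum _ t0).2.2; exact: Bbplus_scale.
have cY w : (scaled (Y w) n)%:E @[n --> \oo] --> (Y w)%:E.
  apply: cvg_EFin; first exact: nearW.
  apply: cvg_scaled; first by move=> n; rewrite mulr_ge0.
  have -> : (fun n => n.+1%:R * (th n * Y w)) = (fun=> Y w).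
    by apply/funext => n; rewrite /th mulVKf// pnatr_eq0.
  exact: cvg_cst.
have Yl : (\int[P mu]_w (Y w)%:E <= l%:E)%E.
  have := fatou (P mu) measurableT mS (fun n w _ => scaled_ge0 n (Y0 w) : (0 <= (scaled (Y w) n)%:E)%E).
  rewrite (cvg_limn_einf_sup cS).1; apply: le_trans; rewrite le_eqVlt; apply/orP; left.
  by apply/eqP/eq_integral => w _; rewrite (cvg_limn_einf_sup (cY w)).1.
have iY : (P mu).-integrable setT (EFin \o Y).
  apply/integrableP; split; first exact/measurable_EFinP.
  under eq_integral do rewrite /= ger0_norm//.
  by apply: le_lt_trans Yl (ltry _).
have Fm : {ae P mu, forall w n, setT w -> (`|(scaled (Y w) n)%:E| <= (EFin \o Y) w)%E}.
  by apply/aeW => w n _; rewrite lee_fin ger0_norm ?scaled_ge0// scaled_le.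
have mY' : measurable_fun setT (EFin \o Y) by exact/measurable_EFinP.
have [_ _ cD] := dominated_convergence measurableT mS mY' (aeW _ (fun w _ => cY w)) iY Fm.
exact: cvg_unique cD cS.
Qed.

Lemma dirac_fmeas x : exists mu : fmeas E,
  forall f, measurable_fun [set: borel E] f -> pairing f mu = f x.
Proof.
exists (\d_(x : borel E) : probability (borel E) R) => f mf.
by rewrite /pairing /Rintegral integral_dirac ?diracT ?mul1e//; exact/measurable_EFinP.
Qed.

Lemma integrable_pairing_traj mu f t : Bbplus f -> 0 <= t ->
  (P mu).-integrable setT (EFin \o (fun w : path_space E => pairing f (traj w t))).
Proof.
move=> bf t0; apply/integrableP; split.
  by apply: measurable_fct_pairing_traj => //; exact: bf.1.
under eq_integral => w _ do rewrite /= ger0_norm ?(pairing_ge0 _ bf.2.2)//.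
by rewrite super_moment// ltry.
Qed.

Lemma mean_Bbplus f t : Bbplus f -> 0 <= t -> Bbplus (PP t f).
Proof.
move=> bf t0; have bP := mean_Bb PP_mean bf.1 t0; split => //; split; first exact: bP.1.
by move=> y; apply: (mean_ge0 pp_dens mean0) => //; [exact: bf.1|exact: bf.2.2].
Qed.

(** The semigroup law is the Markov property started from a Dirac mass, read through first moments;
    [cum_add] reads it through Laplace functionals. Uniqueness for the evolution equations is not
    invoked. *)
Lemma mean_add f r t x : Bbplus f -> 0 <= r -> 0 <= t ->
  PP (r + t) f x = PP r (PP t f) x.
Proof.
move=> bf r0 t0; have rt0 : 0 <= r + t by rewrite addr_ge0.
have bt := mean_Bbplus bf t0; have [mu muE] := dirac_fmeas x; apply: EFin_inj.
rewrite -(muE _ (mean_Bbplus bf rt0).2.1) -(super_moment mu bf rt0).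
rewrite -(muE _ (mean_Bbplus bt r0).2.1) -(super_moment mu bt r0).
rewrite (markov_past P_sup _ r0 t0 (F := fun z => (pairing f z.2)%:E)).
- by apply: eq_integral => w _; rewrite super_moment.
- apply/measurable_EFinP.
  exact: measurableT_comp (measurable_pairing bf.2.1) measurable_snd.
- by move=> z; rewrite lee_fin pairing_ge0//; exact: bf.2.2.
Qed.

Let laplaceE mu f t : Bbplus f -> 0 <= t ->
  (\int[P mu]_w (expR (- pairing f (traj w t)))%:E = (expR (- pairing (V t f) mu))%:E)%E.
Proof.
move=> bf t0; rewrite -(super_laplace P_sup)// /Rintegral fineK//.
apply: integrable_fin_num => //.
have := laplace_integrable mu bf ler01 t0; apply: eq_integrable => // w _.
by rewrite /= mul1r.
Qed.

Lemma cum_add f r t x : Bbplus f -> 0 <= r -> 0 <= t ->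
  V (r + t) f x = V r (V t f) x.
Proof.
move=> bf r0 t0; have rt0 : 0 <= r + t by rewrite addr_ge0.
have bt := cum_Bbplus V_cum bf t0; have [mu muE] := dirac_fmeas x.
apply: oppr_inj; apply: expR_inj; apply: EFin_inj.
rewrite -(muE _ (cum_Bbplus V_cum bf rt0).2.1) -(laplaceE mu bf rt0).
rewrite -(muE _ (cum_Bbplus V_cum bt r0).2.1) -(laplaceE mu bt r0).
rewrite (markov_past P_sup _ r0 t0 (F := fun z => (expR (- pairing f z.2))%:E)).
- by apply: eq_integral => w _; rewrite laplaceE.
- apply/measurable_EFinP; apply: measurableT_comp => //; apply: measurableT_comp => //.
  exact: measurableT_comp (measurable_pairing bf.2.1) measurable_snd.
- by move=> z; rewrite lee_fin expR_ge0.
Qed.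

(* Jensen's inequality, from the tangent to exp at the mean *)
Lemma cum_le_mean f t x : Bbplus f -> 0 <= t -> V t f x <= PP t f x.
Proof.
move=> bf t0; set a := PP t f x; pose Y (w : path_space E) := pairing f (traj w t).
have [mu muE] := dirac_fmeas x.
have iY : (P mu).-integrable setT (EFin \o Y) by exact: integrable_pairing_traj.
have EY : \int[P mu]_w Y w = a.
  by rewrite /Rintegral super_moment// muE//; exact: (mean_Bbplus bf t0).2.1.
have i1 : (P mu).-integrable setT (EFin \o (cst (expR (- a) * (1 + a)) : path_space E -> R)).
  by apply: (integrable_bounded measurableT (Plty _) (M := `|expR (- a) * (1 + a)|)).
have i2 := integrableZl measurableT (expR (- a)) iY.
have i3 := laplace_integrable mu bf ler01 t0.
suff : expR (- a) <= expR (- V t f x) by rewrite ler_expR lerN2.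
rewrite -(muE _ (cum_Bbplus V_cum bf t0).2.1) -(super_laplace P_sup mu t0 bf).
have -> : expR (- a) = \int[P mu]_w (expR (- a) * (1 + a) - expR (- a) * Y w).
  rewrite (RintegralB measurableT i1 i2) (RintegralZl _ measurableT iY) EY.
  rewrite Rintegral_cst// (_ : fine _ = 1) ?mulr1; last exact: (congr1 fine (P_setT P _)).
  by ring.
apply: le_Rintegral => //.
- exact: (integrableB measurableT i1 i2).
- by apply: eq_integrable i3 => // w _; rewrite /= mul1r.
- move=> w _; rewrite -/(Y w).
  have -> : expR (- Y w) = expR (- a) * expR (a - Y w) by rewrite -expRD; congr expR; ring.
  rewrite -mulrBr ler_wpM2l ?expR_ge0//.
  by have := expR_ge1Dx (a - Y w); lra.
Qed.

(** * Ergodicity and the eigenfunction h *)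

Variables (lambda1 : R) (h hhat : E -> R).
Hypotheses (lambda_lt0 : lambda1 < 0) (mh : measurable_fun [set: borel E] h)
  (mhhat : measurable_fun [set: borel E] hhat)
  (h_pos : forall x, 0 < h x /\ 0 < hhat x) (h_bnd : bounded_fct h)
  (hhat1 : ip m h hhat = 1).
Hypothesis ergodic :
  ereal_sup (range (fun x : E => ess_sup m (fun y : borel E =>
    `|normalized_density lambda1 h hhat pp t x y - 1|)))%E @[t --> +oo] --> 0%E.

Let h0 x : 0 <= h x. Proof. by have [/ltW] := h_pos x. Qed.

Let bh : Bbplus h. Proof. by split; split. Qed.

Let integrable_hhhat : m.-integrable setT (fun y => (h y * hhat y)%:E).
Proof.
apply/integrableP; split; first by apply/measurable_EFinP; exact: measurable_funM.
have e : (\int[m]_y `|(h y * hhat y)%:E| = \int[m]_y (h y * hhat y)%:E)%E.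
  by apply: eq_integral => y _; rewrite /= ger0_norm// mulr_ge0// ltW//; case: (h_pos y).
(* An infinite integral would be sent to 0 by [fine], so the value 1 of [ip m h hhat] proves
   integrability. *)
rewrite e ltNge leye_eq; apply/negP => /eqP oo.
by have := hhat1; rewrite /ip /Rintegral oo /= => /eqP; rewrite eq_sym oner_eq0.
Qed.

(** The almost everywhere bound on the normalized density is multiplied by h(x) f h hhat and
    integrated, h hhat having integral 1. The error is proportional to h(x), hence controlled by W^h
    after pairing with X_t. *)
Lemma mean_ergodic (e : R) : 0 < e -> exists2 T, 0 < T & forall t f M x, T <= t ->
  Bb f -> (forall y, `|f y| <= M) ->
  `|expR (lambda1 * t) * PP t (fun y => f y * h y) x - h x * ip m (fun y => f y * h y) hhat|
    <= e * M * h x.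
Proof.
move=> e0; have : \forall t \near +oo,
    (ereal_sup (range (fun x : E => ess_sup m (fun y : borel E =>
      `|normalized_density lambda1 h hhat pp t x y - 1|))) <= e%:E)%E.
  have /fine_cvgP[fin] := ergodic.
  move=> /cvgr_le => /(_ e e0) le_e; near=> t.
  have ft : (ereal_sup (range (fun x : E => ess_sup m (fun y : borel E =>
      `|normalized_density lambda1 h hhat pp t x y - 1|))) \is a fin_num)%E by near: t.
  by rewrite -(fineK ft) lee_fin; near: t.
move=> [T0 [_ HT]]; pose T := Num.max T0 0 + 1.
have T00 : 0 < T by rewrite ltr_wpDl// le_max lexx orbT.
have TT0 : T0 < T by rewrite (@le_lt_trans _ _ (Num.max T0 0)) ?le_max ?lexx// ltrDl.
exists T => // t f M x Tt bf fM; have t0 : 0 < t := lt_le_trans T00 Tt.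
have M0 : 0 <= M by exact: le_trans (fM point).
have esse : (ess_sup m (fun y : borel E =>
    `|normalized_density lambda1 h hhat pp t x y - 1|) <= e%:E)%E.
  by apply: le_trans (HT t (lt_le_trans TT0 Tt)); apply: ereal_sup_ubound; exists x.
have {esse} aee := ess_supP esse.
have [_ pp0 ppE] := pp_dens t0.
have bfh : Bb (fun y => f y * h y) by exact: BbM bf bh.1.
have ipp := integrable_pp pp_dens x bfh t0.
pose A y := ((expR (lambda1 * t))%:E * (pp t x y * (f y * h y)%:E))%E.
pose B y := ((h x * (f y * h y * hhat y))%:E).
have iA : m.-integrable setT A by exact: integrableZl.
have iB : m.-integrable setT B.
  have i1 := integrableZl measurableT (h x * M) integrable_hhhat.
  apply: (le_integrable _ _ _ i1) => //.
    apply/measurable_EFinP; apply: measurable_funM => //.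
    by apply: measurable_funM => //; exact: bfh.1.
  move=> y _; rewrite /= lee_fin !normrM -!mulrA ler_wpM2l//.
  by rewrite ler_wpM2r ?mulr_ge0// (le_trans (fM y)) ?ler_norm.
have EA : (\int[m]_y A y = (expR (lambda1 * t) * PP t (fun y => f y * h y) x)%:E)%E.
  by rewrite EFinM ppE// -integralZl.
have EB : (\int[m]_y B y = (h x * ip m (fun y => f y * h y) hhat)%:E)%E.
  rewrite /ip -RintegralZl//; first by rewrite /Rintegral fineK//; exact: integrable_fin_num.
  have i1 := integrableZl measurableT (h x)^-1 iB.
  apply: eq_integrable i1 => // y _; rewrite /= /B -EFinM mulKf//.
  by rewrite gt_eqF//; case: (h_pos x).
have iAB := integrableB measurableT iA iB.
rewrite -lee_fin -abse_EFin EFinB -EA -EB -integralB//.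
apply: le_trans (le_abse_integral _ measurableT (measurable_int _ iAB)) _.
have -> : (e * M * h x)%:E = (\int[m]_y (e * M * h x * (h y * hhat y))%:E)%E.
  under [RHS]eq_integral do rewrite EFinM.
  rewrite integralZl// -[LHS]mule1; congr (_ * _)%E.
  have := hhat1; rewrite /ip /Rintegral => h1; rewrite -[LHS]/(1%:E) -h1 fineK//.
  exact: integrable_fin_num.
apply: ae_ge0_le_integral => //.
- apply: measurableT_comp => //; exact: (measurable_int _ iAB).
- move=> y _; rewrite lee_fin !mulr_ge0// ?(ltW e0)//; by case: (h_pos y) => ? /ltW.
- by apply/measurable_EFinP; apply: measurable_funM => //; exact: measurable_funM.
apply: filterS aee => y + _; rewrite /normalized_density /A /B.
have [hx _] := h_pos x; have [hy hhy] := h_pos y.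
move: (pp0 x y); case: (pp t x y) => [r r0|_|//].
  rewrite -!EFinM -!EFinB !abse_EFin !lee_fin => H.
  have -> : expR (lambda1 * t) * (r * (f y * h y)) - h x * (f y * h y * hhat y) =
     f y * ((expR (lambda1 * t) / (h x * hhat y) * r - 1) * (h x * (h y * hhat y))).
    by field; rewrite !gt_eqF.
  rewrite normrM (_ : e * M * h x * (h y * hhat y) = M * (e * (h x * (h y * hhat y)))); last by ring.
  apply: ler_pM => //; rewrite normrM [X in _ * X]ger0_norm; last by rewrite !mulr_ge0 ?(ltW hx) ?(ltW hy) ?(ltW hhy).
  by rewrite ler_wpM2r// !mulr_ge0 ?(ltW hx) ?(ltW hy) ?(ltW hhy).
(* An infinite density would contradict the bound. *)
by rewrite gt0_muley ?lte_fin ?divr_gt0 ?expR_gt0 ?mulr_gt0.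
Unshelve. all: by end_near.
Qed.

(** Write g_r for e^{lambda1 r} PP_r h. For T large, g_T is within e' h of h; applying e^{lambda1 t}
    PP_t, g_{t+T} is within e' g_t of g_t, while it is also within e' h of h. As e' is arbitrary,
    g_t = h. *)
Lemma mean_h t x : 0 <= t -> expR (lambda1 * t) * PP t h x = h x.
Proof.
move=> t0; pose g r y := expR (lambda1 * r) * PP r h y.
have eh e : 0 < e -> exists2 T, 0 < T & forall r y, T <= r -> `|g r y - h y| <= e * h y.
  move=> /mean_ergodic[T T0 HT]; exists T => // r y Tr.
  have := HT r (cst 1) 1 y Tr (Bb_cst 1) (fun=> _).
  have -> : (fun y => cst 1 y * h y) = h by apply/funext => z; rewrite mul1r.
  by rewrite hhat1 !mulr1; apply => z; rewrite normr1.
have bg r : 0 <= r -> Bbplus (g r).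
  by move=> r0; apply: Bbplus_scale; [exact: mean_Bbplus|exact: expR_ge0].
apply/eqP; rewrite -subr_eq0 -normr_le0; apply/ler_addgt0Pr => e e0; rewrite add0r.
pose c := h x + g t x.
have c0 : 0 < c + 1 by rewrite ltr_wpDl// addr_ge0//; exact: (bg t t0).2.2.
have [T T0 HT] := eh (e / (c + 1)) (divr_gt0 e0 c0); set e' := e / (c + 1) in HT.
have e'0 : 0 <= e' by rewrite divr_ge0// ltW.
have h1 := HT (t + T) x _; have Tt : T <= t + T by rewrite lerDr.
have {h1} h1 := h1 Tt.
have gE : g (t + T) x = expR (lambda1 * t) * PP t (g T) x.
  rewrite /g mean_add ?(ltW T0)//; rewrite (meanZ pp_dens mean0)//; last exact: (mean_Bbplus bh (ltW T0)).1.
  by rewrite mulrA -expRD -mulrDr.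
have h2 : `|g (t + T) x - g t x| <= e' * g t x.
  rewrite gE (_ : g t x = expR (lambda1 * t) * PP t h x)// -mulrBr.
  rewrite -(meanB pp_dens mean0 x (bg _ (ltW T0)).1 bh.1 t0).
  rewrite normrM ger0_norm ?expR_ge0// mulrCA ler_wpM2l ?expR_ge0//.
  have bD : Bb (fun y => g T y - h y) by apply: BbB; [exact: (bg _ (ltW T0)).1|exact: bh.1].
  have be : Bb (fun y => e' * h y) by exact: BbZ bh.1.
  rewrite -(meanZ pp_dens mean0 e' x bh.1 t0).
  rewrite ler_norml; apply/andP; split; last first.
    apply: (le_mean pp_dens mean0) => // y; apply: le_trans (ler_norm _) (HT T y (lexx _)).
  rewrite lerNl -[leLHS]mulN1r -(meanZ pp_dens mean0)//.
  apply: (le_mean pp_dens mean0) => //; first exact: BbZ.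
  move=> y; rewrite mulN1r; apply: le_trans (ler_norm _) _; rewrite normrN; exact: HT.
rewrite -/(g t x) distrC.
apply: le_trans (ler_distD (g (t + T) x) _ _) _; rewrite distrC.
apply: le_trans (lerD h1 h2) _; rewrite -mulrDr -/c /e' mulrAC ler_pdivrMr//.
by rewrite (ler_wpM2l (ltW e0))// lerDl.
Qed.

(** * The gap between PP and V to the order q *)

Variable q : R.
Hypotheses (q1 : 1 < q) (q2 : q <= 2)
  (h_moment : (ereal_sup (range (fun x : E => ((h x)^-1)%:E *
     \int[brH br x]_(nu in @nonzero R E) (pairing h nu `^ q)%:E)) < +oo)%E).

Lemma mean_hE t x : 0 <= t -> PP t h x = expR (- lambda1 * t) * h x.
Proof. by move=> t0; rewrite -(mean_h x t0) mulrA -expRD mulNr addNr expR0 mul1r. Qed.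

Let Rem_h : exists2 D, 0 <= D & forall f (A : R) x, Bbplus f -> 0 <= A <= 1 ->
  (forall y, f y <= A * h y) -> Rem br x f <= A `^ q * D * h x.
Proof.
have [C C0 HC] : exists2 C, 0 <= C & forall x,
    (\int[brH br x]_(nu in @nonzero R E) (pairing h nu `^ q)%:E <= (C * h x)%:E)%E.
  have := h_moment; set S := ereal_sup _ => Soo.
  have S0 : (0 <= S)%E.
    apply: (le_trans _ (ereal_sup_ubound _)); last by exists point.
    by rewrite mule_ge0 ?lee_fin ?invr_ge0// integral_ge0// => nu _; rewrite lee_fin powR_ge0.
  have Sfin : S \is a fin_num by rewrite ge0_fin_numE.
  exists (fine S) => [|x]; first exact: fine_ge0.
  have [hx _] := h_pos x; rewrite mulrC EFinM fineK//.
  rewrite -lee_pdivrMl//; apply: ereal_sup_ubound; by exists x.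
have [B B0 HB] := brb_bound br; have [K hK] := h_bnd.
have K0 : 0 <= K by exact: le_trans (hK point).
pose L := B + K; exists (L * L + C) => [|f A x bf A01 fA].
  by rewrite addr_ge0// mulr_ge0// addr_ge0.
rewrite -mulrA; apply: (Rem_le_powR (h := h)) => //.
- exact: bf.1.
- exact: bf.2.2.
- by move=> y; have /andP[b0 b1] := HB y; rewrite b0 (le_trans b1)// lerDl.
- by move=> y; rewrite (le_trans (ler_norm _))// (le_trans (hK y))// lerDr.
Qed.

(** The evolution equation read backwards: P_t h differs from PP_t h = e^{-lambda1 t} h by the time
    integral of a bounded drift. *)
Let Pt_h (T : R) : 0 <= T -> exists2 C, 0 <= C & forall t x, 0 <= t -> t <= T ->
  Pt xi t h x <= expR (- lambda1 * T) * h x + C * t.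
Proof.
move=> T0; have [C C0 HC] := drift_bound br gamma; have [K hK] := h_bnd.
have K0 : 0 <= K by exact: le_trans (hK point).
have lT t : t <= T -> expR (- lambda1 * t) <= expR (- lambda1 * T).
  by move=> tT; rewrite ler_expR ler_wpM2l// oppr_ge0 ltW.
exists (C * (expR (- lambda1 * T) * K)) => [|t x t0 tT]; first by rewrite !mulr_ge0 ?expR_ge0.
have [mP _] := mean_clip PP_mean bh.1 T0.
have PK r y : `|clip T (PP ^~ h) r y| <= expR (- lambda1 * T) * K.
  apply: clip_bound => // {}r {}y r0 rT; rewrite mean_hE// normrM ger0_norm ?expR_ge0//.
  by apply: ler_pM => //; exact: lT.
have mPr := jmeasurable_rev t mP.
pose g r := drift br gamma (clip T (PP ^~ h) (t - r)).
have mg : measurable_fun setT (fun z : R * borel E => g z.1 z.2).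
  exact: (@jmeasurable_drift _ _ br gamma (fun r => clip T (PP ^~ h) (t - r)) mPr).
have gK r y : `|g r y| <= C * (expR (- lambda1 * T) * K).
  by apply: normr_drift_le => //; exact: jmeasurable_section.
have e := mean_evol E_lc dense_s PP_mean x bh.1 t0 tT.
have -> : Pt xi t h x = PP t h x + time_integral xi t (fun r y => -1 * g r y) x.
  rewrite (time_integralZ xi E_lc dense_s x (-1) mg (fun r y _ _ => gK r y)) e.
  by rewrite /g; ring.
rewrite mean_hE//; apply: lerD; first by rewrite ler_wpM2r// lT.
apply: (time_integral_le_cst xi E_lc dense_s (M := C * (expR (- lambda1 * T) * K))) => //.
- by rewrite !mulr_ge0// expR_ge0.
- exact: measurable_funM.
- by move=> r y _ _; rewrite mulN1r normrN.
- by move=> r y _ _; rewrite mulN1r (le_trans (ler_norm _))// normrN.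
Qed.

Lemma cum_le_h (T a : R) f r x : Bbplus f -> 0 <= a -> (forall y, f y <= a * h y) ->
  0 <= r -> r <= T -> V r f x <= a * expR (- lambda1 * T) * h x.
Proof.
move=> bf a0 fa r0 rT; apply: le_trans (cum_le_mean x bf r0) _.
apply: le_trans (le_mean pp_dens mean0 x bf.1 (BbZ a bh.1) fa r0) _.
rewrite (meanZ pp_dens mean0 a x bh.1 r0).
rewrite mean_hE// -mulrA ler_wpM2l// ler_wpM2r// ler_expR ler_wpM2l//.
by rewrite oppr_ge0 ltW.
Qed.

(* over a time step delta, the second-order term costs O(delta * h) and all
   the other contributions are O(delta^2) *)
Let one_step (T : R) : 0 <= T -> exists2 C, 0 <= C & exists2 D, 0 <= D &
  forall g (A delta : R) x, Bbplus g -> 0 <= A <= 1 -> 0 <= delta -> delta <= T ->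
    (forall u y, 0 <= u -> u <= delta -> PP u g y <= expR (- lambda1 * T) * h y) ->
    (forall u y, 0 <= u -> u <= delta -> V u g y <= A * h y) ->
  PP delta g x - V delta g x <= C * delta ^+ 2 + A `^ q * D * delta * h x.
Proof.
move=> T0; have [C C0 HC] := drift_bound br gamma; have [K hK] := h_bnd.
have K0 : 0 <= K by exact: le_trans (hK point).
have [D D0 HD] := Rem_h; have [Cp Cp0 HP] := Pt_h T0.
pose eT := expR (- lambda1 * T); have eT0 : 0 <= eT by exact: expR_ge0.
have eT1 : 1 <= eT by rewrite -expR0 ler_expR mulr_ge0// oppr_ge0 ltW.
pose L := eT * K; have L0 : 0 <= L by exact: mulr_ge0.
pose C1 := C * L + D * K; have C10 : 0 <= C1 by rewrite addr_ge0// mulr_ge0.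
exists (C * C1 + D * Cp); first by rewrite addr_ge0// mulr_ge0.
exists (D * eT); first exact: mulr_ge0.
move=> g A delta x bg A01 d0 dT PPh VA.
have [A0 A1] := andP A01.
have Aq : 0 <= A `^ q <= 1.
  rewrite powR_ge0/=; apply: le_trans (ge0_ler_powR _ _ _ A1) _ => //; rewrite ?nnegrE//.
    by apply: le_trans (ltW q1).
  by rewrite powR1.
have /andP[Aq0 Aq1] := Aq.
have hK' y : h y <= K by exact: le_trans (ler_norm _) (hK y).
have [mP _] := mean_clip PP_mean bg.1 d0; have [mV _] := cum_clip V_cum bg d0.
pose p := clip delta (PP ^~ g); pose v := clip delta (V ^~ g).
have pL r y : 0 <= p r y <= L.
  have t0 : 0 <= Num.min (Num.max r 0) delta by rewrite le_min d0 le_max lexx orbT.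
  rewrite (mean_Bbplus bg t0).2.2/=; apply: le_trans (PPh _ y t0 _) _.
    by rewrite ge_min lexx orbT.
  by rewrite ler_wpM2l.
have vA r y : v r y <= A * h y.
  apply: VA; first by rewrite le_min d0 le_max lexx orbT.
  by rewrite ge_min lexx orbT.
have v0 r y : 0 <= v r y by apply: clip_ge0 => // *; exact: (cum_ge0 V_cum).
have vp r y : v r y <= p r y.
  by apply: cum_le_mean => //; rewrite le_min d0 le_max lexx orbT.
have m_p r : measurable_fun [set: borel E] (p r) by exact: jmeasurable_section.
have m_v r : measurable_fun [set: borel E] (v r) by exact: jmeasurable_section.
have bv r : Bbplus (v r).
  split; split => //; exists L => y; rewrite ger0_norm//.
  by apply: le_trans (vp r y) _; have /andP[] := pL r y.
have mpv r : measurable_fun [set: borel E] (fun y => p r y - v r y) by exact: measurable_funB.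
pose k r := drift br gamma (fun z => p r z - v r z).
have mk : measurable_fun setT (fun z : R * borel E => k z.1 z.2).
  apply: (@jmeasurable_drift _ _ br gamma (fun r z => p r z - v r z)).
  exact: measurable_funB.
have mR : measurable_fun setT (fun z : R * borel E => Rem br z.2 (v z.1)).
  exact: measurable_Rem mV.
have RA r y : Rem br y (v r) <= A `^ q * D * h y by exact: HD.
have pvL r y : `|p r y - v r y| <= L.
  rewrite ger0_norm ?subr_ge0// (le_trans _ (andP (pL r y)).2)// gerBl//.
have kL r y : `|k r y| <= C * L by exact: normr_drift_le.
have RL r y : `|Rem br y (v r)| <= D * K.
  rewrite ger0_norm ?Rem_ge0// (le_trans (RA r y))// ler_pM ?mulr_ge0//.
  by rewrite ler_piMl.
have evol u y : 0 <= u -> u <= delta -> PP u g y - V u g y =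
    time_integral xi u (fun r z => k (u - r) z + Rem br z (v (u - r))) y.
  by move=> u0 ud; rewrite (mean_cum_evol E_lc dense_s gammaE V_cum PP_mean y bg u0 ud).
(* A first bound of order u, from bounded integrands; put back into the drift it makes the drift
   term of order delta^2 after integration. *)
have crude u y : 0 <= u -> u <= delta -> PP u g y - V u g y <= C1 * u.
  move=> u0 ud; rewrite evol//.
  apply: (time_integral_le_cst xi E_lc dense_s (M := C1)) => //.
  - apply: measurable_funD.
      exact: (@jmeasurable_rev _ _ u k mk).
    exact: (@jmeasurable_rev _ _ u (fun r z => Rem br z (v r)) mR).
  - by move=> r z _ _; rewrite (le_trans (ler_normD _ _))// lerD.
  - move=> r z _ _; apply: lerD; first exact: le_trans (ler_norm _) (kL _ _).
    exact: le_trans (ler_norm _) (RL _ _).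
have kc r y : 0 <= r -> r <= delta -> k r y <= C * (C1 * delta).
  move=> r0 rd; apply: le_trans (ler_norm _) _; apply: normr_drift_le => // z.
  rewrite ger0_norm ?subr_ge0// /p /v !clipE//.
  by apply: le_trans (crude r z r0 rd) _; rewrite ler_wpM2l.
pose c0 := C * (C1 * delta); have c00 : 0 <= c0 by rewrite !mulr_ge0.
pose b := A `^ q * D; have b0 : 0 <= b by exact: mulr_ge0.
rewrite evol//.
have mbh : measurable_fun setT (fun z : R * borel E => (fun r y => b * h y) z.1 z.2).
  apply: measurable_funM => //; exact: measurableT_comp mh measurable_snd.
have bhK r y : 0 <= r -> r <= delta -> `|(fun (r : R) y => b * h y) r y| <= b * K.
  by move=> _ _; rewrite ger0_norm ?mulr_ge0// ler_wpM2l.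
have mc0 : measurable_fun setT (fun z : R * borel E => (fun (r : R) (y : E) => c0) z.1 z.2) by exact: measurable_cst.
have c0b (r : R) (y : E) : 0 <= r -> r <= delta -> `|(fun (r : R) (y : E) => c0) r y| <= c0.
  by move=> _ _; rewrite ger0_norm.
have m12 := measurable_funD mc0 mbh.
apply: (@le_trans _ _ (time_integral xi delta (fun r y => c0 + b * h y) x)).
  apply: (le_time_integral xi E_lc dense_s x (M1 := C1) (M2 := c0 + b * K)) => //.
  - apply: measurable_funD.
      exact: (@jmeasurable_rev _ _ delta k mk).
    exact: (@jmeasurable_rev _ _ delta (fun r z => Rem br z (v r)) mR).
  - by move=> r z _ _; rewrite (le_trans (ler_normD _ _))// lerD.
  - move=> r z r0 rd; rewrite (le_trans (ler_normD _ _))// lerD//; first by rewrite ger0_norm.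
    exact: (bhK r z r0 rd).
  - move=> r z r0 rd; apply: lerD; last exact: RA.
    by apply: kc; [rewrite subr_ge0|rewrite lerBlDr lerDl].
rewrite (time_integralD xi E_lc dense_s x mc0 mbh c0b bhK).
have -> : (C * C1 + D * Cp) * delta ^+ 2 + A `^ q * (D * eT) * delta * h x =
  c0 * delta + (D * Cp * delta ^+ 2 + b * eT * h x * delta) by rewrite /c0 /b; ring.
apply: lerD.
  by apply: (time_integral_le_cst xi E_lc dense_s (M := c0)).
have mhj : measurable_fun setT (fun z : R * borel E => (fun (r : R) y => h y) z.1 z.2).
  exact: measurableT_comp mh measurable_snd.
rewrite (time_integralZ xi E_lc dense_s x b mhj (fun r y _ _ => hK y)).
pose cc := eT * h x + Cp * delta.
have cc0 : 0 <= cc by rewrite addr_ge0// mulr_ge0.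
have : time_integral xi delta (fun r y => h y) x <= cc * delta.
  have mcc := @measurable_cst _ _ R R setT cc.
  apply: le_trans (time_integral_le_int E_lc dense_s mhj (fun r y _ _ => hK y) mcc (MB := cc) _ _) _.
  - by move=> r _ _; rewrite ger0_norm.
  - move=> r r0 rd; apply: le_trans (HP r x r0 (le_trans rd dT)) _.
    by rewrite lerD// ler_wpM2l.
  - rewrite (_ : Rintegral _ _ _ = cc * fine (@lebesgue_measure R `[0, delta]%classic)); last exact: Rintegral_cst.
    rewrite lebesgue_measure_itv /= lte_fin.
    by case: ltP => /=; rewrite ?mulr0 ?mulr_ge0//= subr0.
move=> /(ler_wpM2l b0) => H; apply: le_trans H _.
rewrite /cc [leLHS](_ : _ = b * Cp * delta ^+ 2 + b * eT * h x * delta); last by ring.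
by rewrite lerD2r ler_wpM2r ?sqr_ge0// ler_wpM2r// ler_piMl.
Qed.

Lemma cum0 f x : Bbplus f -> V 0 f x = f x.
Proof.
move=> bf; rewrite (cum_evol E_lc dense_s gammaE V_cum x bf (lexx 0) (lexx 0)).
by rewrite time_integral0 addr0 (Pt0 xi E_lc dense_s)//; exact: bf.2.1.
Qed.

(* telescoping over N steps of length T / N, then N -> oo *)
Lemma mean_cum_le (T : R) : 0 <= T -> exists2 C, 0 <= C & forall g (a : R) x,
  Bbplus g -> 0 <= a -> a * expR (- lambda1 * T) <= 1 -> (forall y, g y <= a * h y) ->
  PP T g x - V T g x <= C * a `^ q * h x.
Proof.
move=> T0; have [C C0 [D D0 step]] := one_step T0; pose eT := expR (- lambda1 * T).
have eT0 : 0 <= eT by exact: expR_ge0.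
have eT1 : 1 <= eT by rewrite -expR0 ler_expR mulr_ge0// oppr_ge0 ltW.
have [B B0 HB] := drift_bound br gamma.
pose M := 2 * 1 * expR ((2 * B + 1) * T).
have M0 : 0 <= M by rewrite !mulr_ge0 ?expR_ge0.
have PM u y : 0 <= u -> u <= T -> PP u (cst 1) y <= M.
  move=> u0 uT; apply: le_trans (ler_norm _) _.
  apply: le_trans (mean_apriori E_lc dense_s PP_mean y HB B0 (Bb_cst 1) (K := 1) _ u0) _.
    by move=> z; rewrite normr1.
  by rewrite ler_wpM2l ?mulr_ge0// ler_expR ler_wpM2l// addr_ge0// mulr_ge0.
exists (eT `^ q * D * T * eT); first by rewrite !mulr_ge0// powR_ge0.
move=> g a x bg a0 aT ga; pose A := a * eT.
have A0 : 0 <= A by exact: mulr_ge0.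
have A01 : 0 <= A <= 1 by rewrite A0.
have Aq0 : 0 <= A `^ q by exact: powR_ge0.
have bV r : 0 <= r -> Bbplus (V r g) by move=> r0; exact: (cum_Bbplus V_cum bg r0).
have lT r : r <= T -> expR (- lambda1 * r) <= eT.
  by move=> rT; rewrite ler_expR ler_wpM2l// oppr_ge0 ltW.
have PPh r u y : 0 <= r -> 0 <= u -> r + u <= T -> PP u (V r g) y <= eT * h y.
  move=> r0 u0 ruT; pose c := a * expR (- lambda1 * r).
  have c0 : 0 <= c by rewrite mulr_ge0 ?expR_ge0.
  have Vc z : V r g z <= c * h z by exact: cum_le_h.
  apply: le_trans (le_mean pp_dens mean0 y (bV r r0).1 (BbZ c bh.1) Vc u0) _.
  rewrite (meanZ pp_dens mean0 c y bh.1 u0) mean_hE// mulrA ler_wpM2r// /c -mulrA -expRD -mulrDr.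
  apply: (@le_trans _ _ (a * eT)); first by rewrite ler_wpM2l// lT.
  exact: le_trans aT eT1.
have Vadd u r : 0 <= u -> 0 <= r -> V u (V r g) = V (u + r) g.
  by move=> u0 r0; apply/funext => y; rewrite -cum_add.
have VA r u y : 0 <= r -> 0 <= u -> r + u <= T -> V u (V r g) y <= A * h y.
  move=> r0 u0 ruT; rewrite Vadd//; apply: cum_le_h => //; first by rewrite addr_ge0.
  by rewrite addrC.
have claim (dl : R) n r y : 0 <= dl -> 0 <= r -> r + n%:R * dl <= T ->
    PP (n%:R * dl) (V r g) y - V (n%:R * dl) (V r g) y <=
    n%:R * (C * dl ^+ 2 * M + A `^ q * D * dl * eT * h y).
  move=> dl0; elim: n r y => [|n IH] r y r0 rT.
    by rewrite !mul0r mean0 ?cum0 ?subrr//; [exact: bV|exact: (bV r r0).1].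
  have nd0 : 0 <= n%:R * dl by exact: mulr_ge0.
  have En : n.+1%:R * dl = n%:R * dl + dl by rewrite -addn1 natrD mulrDl mul1r.
  rewrite En in rT *; have rdT : r + dl <= T by apply: le_trans rT; rewrite lerD2l lerDr.
  have ndT : n%:R * dl <= T by apply: le_trans rT; rewrite addrCA lerDl addr_ge0.
  rewrite (mean_add y (bV r r0) nd0 dl0) (cum_add y (bV r r0) nd0 dl0).
  have bPV := mean_Bbplus (bV r r0) dl0.
  have bVV := cum_Bbplus V_cum (bV r r0) dl0.
  (* The cross term PP_{n dl} V_dl is inserted: PP_{n dl}(PP_dl - V_dl) is bounded by [step] and the
     growth of PP on 1 and h, and (PP_{n dl} - V_{n dl}) V_dl by induction from the start r + dl. *)
  rewrite -(subrK (PP (n%:R * dl) (V dl (V r g)) y) (PP (n%:R * dl) (PP dl (V r g)) y)) -addrA.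
  rewrite -(meanB pp_dens mean0 y bPV.1 bVV.1 nd0).
  rewrite -natr1 mulrDl mul1r addrC; apply: lerD.
    rewrite (Vadd dl r)//; apply: IH; first by rewrite addr_ge0.
    by rewrite -addrA addrCA [dl + _]addrC.
  pose b1 := C * dl ^+ 2; pose b2 := A `^ q * D * dl.
  have b10 : 0 <= b1 by rewrite mulr_ge0// sqr_ge0.
  have b20 : 0 <= b2 by rewrite !mulr_ge0.
  have bb1 : @Bb R E (fun z => b1 * cst 1 z) by apply: BbZ; exact: Bb_cst.
  have bb2 : Bb (fun z => b2 * h z) by exact: BbZ bh.1.
  apply: le_trans (le_mean pp_dens mean0 y (BbB bPV.1 bVV.1) (BbD bb1 bb2) _ nd0) _.
    move=> z; rewrite mulr1; apply: step => //.
    - exact: bV.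
    - by apply: le_trans rdT; rewrite lerDr.
    - by move=> u w u0 ud; apply: PPh => //; apply: le_trans rdT; rewrite lerD2l.
    - by move=> u w u0 ud; apply: VA => //; apply: le_trans rdT; rewrite lerD2l.
  rewrite (meanD pp_dens mean0 y bb1 bb2 nd0) (meanZ pp_dens mean0 b1 y (Bb_cst 1) nd0).
  rewrite (meanZ pp_dens mean0 b2 y bh.1 nd0) mean_hE//; apply: lerD.
    by rewrite ler_wpM2l// PM.
  by rewrite -[leRHS]mulrA ler_wpM2l// ler_wpM2r// lT.
have V0 : V 0 g = g by apply/funext => y; exact: cum0.
have bound N : PP T g x - V T g x <=
    C * T ^+ 2 * M * N.+1%:R^-1 + eT `^ q * D * T * eT * a `^ q * h x.
  have N0 : N.+1%:R != 0 :> R by rewrite pnatr_eq0.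
  have := claim (T / N.+1%:R) N.+1 0 x; rewrite V0 [_ * (T / _)]mulrC divfK// add0r => H.
  apply: le_trans (H _ (lexx 0) (lexx T)) _; first by rewrite divr_ge0.
  rewrite /A powRM// le_eqVlt; apply/orP; left; apply/eqP.
  by move: (N.+1%:R) N0 => z z0; field.
pose w := eT `^ q * D * T * eT * a `^ q * h x.
have cw : C * T ^+ 2 * M * N.+1%:R^-1 + w @[N --> \oo] --> w.
  rewrite -[X in _ --> X]add0r -(mulr0 (C * T ^+ 2 * M)).
  by apply: cvgD; [apply: cvgMr; exact: cvg_harmonic|exact: cvg_cst].
apply: (ler_cvg_to (cvg_cst (PP T g x - V T g x)) cw).
by apply: nearW => N; exact: bound.
Qed.

(** * Almost sure smallness of the fluctuations *)

(** With theta = e^{(lambda1 + rate) s}, theta^q e^{-lambda1 s} has exponent lambda1 (q - 1) + rate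
    q. This is negative for rate < - lambda1 (q - 1) / q, and half of the threshold is taken. Then
    lambda1 + rate < 0 as well, so theta tends to 0. *)
Definition rate : R := - lambda1 * (q - 1) / (2 * q).

Let q0 : 0 < q. Proof. exact: lt_trans ltr01 q1. Qed.

Lemma rate_gt0 : 0 < rate.
Proof. by rewrite divr_gt0 ?mulr_gt0 ?oppr_gt0 ?subr_gt0. Qed.

Let lr : lambda1 + rate < 0.
Proof.
have -> : lambda1 + rate = lambda1 * ((q + 1) / (2 * q)) by rewrite /rate; field; rewrite gt_eqF.
by rewrite pmulr_llt0// divr_gt0 ?mulr_gt0// addr_gt0.
Qed.

Let nneseries_geometric_lty (a z : R) : 0 <= a -> 0 <= z -> z < 1 ->
  (\sum_(n <oo) (a * z ^+ n)%:E < +oo)%E.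
Proof.
move=> a0 z0 z1; apply: (@le_lt_trans _ _ (a / (1 - z))%:E); last exact: ltry.
have u0 n : (0 <= (a * z ^+ n)%:E)%E by rewrite lee_fin mulr_ge0// exprn_ge0.
apply: lime_le; first by apply: is_cvg_nneseries => n _ _.
apply: nearW => n; rewrite sumEFin lee_fin.
rewrite (_ : \sum_(0 <= i < n) _ = series (geometric a z) n)// geometric_seriesE ?lt_eqF//.
rewrite ler_wpM2r ?invr_ge0 ?subr_ge0 ?(ltW z1)//.
by rewrite ler_piMr// gerBl exprn_ge0.
Qed.

(* Borel-Cantelli with the normalization theta_n = e^{(lambda1 + rate) s_n}:
   E <gap_n, X_{s_n}> = O(theta_n^q e^{- lambda1 s_n}) is summable *)
Lemma ae_small_jumps mu f (K sigma T : R) : Bbplus f -> 0 <= K ->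
  (forall y, f y <= K * h y) -> 0 < sigma -> 0 <= T ->
  \forall w \ae P mu, exists N, forall n k i, (N <= n)%N ->
    expR (lambda1 * (n%:R * sigma)) *
      `|pairing (PP (T - Num.min (i%:R / 2 ^+ k) T) f)
           (traj w (n%:R * sigma + Num.min (i%:R / 2 ^+ k) T))
        - pairing (PP T f) (traj w (n%:R * sigma))|
    <= expR (- rate * (n%:R * sigma)).
Proof.
move=> bf K0 fK s0 T0; pose sn n : R := n%:R * sigma.
have sn0 n : 0 <= sn n by rewrite mulr_ge0// ltW.
pose tn n := expR ((lambda1 + rate) * sn n); have tn0 n : 0 <= tn n by exact: expR_ge0.
have [C C0 HC] := mean_cum_le T0.
pose K' := K * expR (- lambda1 * T); have K'0 : 0 <= K' by rewrite mulr_ge0 ?expR_ge0.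
(* From [n0] on, theta_n K e^{-lambda1 T} <= 1, the smallness required by [mean_cum_le]; it comes
   from e^x >= 1 + x. *)
pose n0 := (Num.truncn (K' / (- (lambda1 + rate) * sigma))).+1.
have small n : (n0 <= n)%N -> tn n * K * expR (- lambda1 * T) <= 1.
  move=> nn; have cs : 0 < - (lambda1 + rate) * sigma by rewrite mulr_gt0// oppr_gt0.
  have : K' <= - (lambda1 + rate) * sn n.
    rewrite /sn [n%:R * _]mulrC mulrA -ler_pdivrMl// mulrC.
    apply: ltW; apply: lt_le_trans (truncnS_gt _) _.
    by rewrite ler_nat.
  move=> Kn; rewrite -mulrA -/K' mulrC /tn -[_ * sn n]opprK expRN.
  rewrite ler_pdivrMr ?expR_gt0// mul1r -mulNr.
  apply: le_trans Kn _; apply: le_trans (expR_ge1Dx _); by rewrite lerDr.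
pose g n y := tn n * f y; have bg n : Bbplus (g n) by exact: Bbplus_scale.
pose J n : set (path_space E) := \bigcup_k \bigcup_i [set w |
  1 <= `|mart PP (g n) (sn n) T (Num.min (i%:R / 2 ^+ k) T) w - mart PP (g n) (sn n) T 0 w|].
have HJ n := maximal_inequality P_sup mean_Bbplus (cum_Bbplus V_cum) mean0 cum_le_mean
  super_moment mu (bg n) (sn0 n) T0.
have mJ n : measurable (J n) by have [] := HJ n.
(* The ratio of the geometric bound, since (lambda1 + rate) q - lambda1 = lambda1 (q - 1) / 2. *)
pose z := expR (lambda1 * (q - 1) / 2 * sigma).
have z1 : z < 1.
  rewrite -expR0 ltr_expR; do 2 (rewrite pmulr_llt0//).
  by rewrite pmulr_llt0// subr_gt0.
pose B := 10 * (C * K `^ q * pairing h mu).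
have B0 : 0 <= B by rewrite !mulr_ge0 ?powR_ge0 ?pairing_ge0.
have PJ n : (n0 <= n)%N -> (P mu (J n) <= (B * z ^+ n)%:E)%E.
  move=> nn; have [_ le] := HJ n; apply: le_trans le _; rewrite -EFinM lee_fin.
  rewrite /B -mulrA ler_wpM2l//.
  have gap_le y : gap V PP (g n) T y <= C * (tn n * K) `^ q * h y.
    apply: HC => //; [exact: mulr_ge0|exact: small|].
    by move=> w; rewrite /g -mulrA ler_wpM2l.
  have bgap : Bb (gap V PP (g n) T).
    by apply: BbB; [exact: (mean_Bbplus (bg n) T0).1|exact: (cum_Bbplus V_cum (bg n) T0).1].
  set c := C * (tn n * K) `^ q in gap_le; have c0 : 0 <= c by rewrite mulr_ge0 ?powR_ge0.
  have bch : Bb (fun y => c * h y) by exact: BbZ bh.1.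
  have le2 y : PP (sn n) (gap V PP (g n) T) y <= c * expR (- lambda1 * sn n) * h y.
    apply: le_trans (le_mean pp_dens mean0 y bgap bch gap_le (sn0 n)) _.
    by rewrite (meanZ pp_dens mean0 c y bh.1 (sn0 n)) mean_hE// mulrA.
  apply: le_trans (le_pairing mu (mean_Bb PP_mean bgap (sn0 n)) (BbZ _ bh.1) le2) _.
  rewrite pairingZ; last exact: bh.1.
  rewrite (_ : c * _ = C * K `^ q * z ^+ n); first by rewrite mulrAC.
  rewrite /c powRM// /tn /z -expRM_natl -expRM.
  rewrite (_ : n%:R * (lambda1 * (q - 1) / 2 * sigma) =
    (lambda1 + rate) * sn n * q + - lambda1 * sn n); first by rewrite expRD; ring.
  by rewrite /rate /sn; field; rewrite gt_eqF.
(* The estimate [PJ] holds from [n0] on, hence the shift. *)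
pose F n := J (n + n0)%N; have mF n : measurable (F n) by exact: mJ.
have z0 : 0 <= z by exact: expR_ge0.
have sumF : (\sum_(n <oo) P mu (F n) < +oo)%E.
  apply: le_lt_trans (nneseries_geometric_lty B0 z0 z1).
  apply: lee_nneseries => [n _ _|n _]; first exact: measure_ge0.
  apply: le_trans (PJ _ (leq_addl n n0)) _; rewrite lee_fin ler_wpM2l//.
  by rewrite exprD ler_piMr ?exprn_ge0// exprn_ile1// ltW.
exists (lim_sup_set F); split.
- by apply: bigcapT_measurable => n; apply: bigcup_measurable => k _.
- exact: lim_sup_set_cvg0.
move=> w nw; apply: contrapT => nF; apply: nw.
have [N HN] : exists N, forall j, (N <= j)%N -> ~ F j w.
  apply: contrapT => nN; apply: nF => N _; apply: contrapT => nF; apply: nN.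
  by exists N => j Nj Fj; apply: nF; exists j.
exists (N + n0)%N => n k i Nn; set t := Num.min _ T.
have tT : t <= T by rewrite ge_min lexx orbT.
have t0 : 0 <= t by rewrite le_min T0 andbT divr_ge0// exprn_ge0.
have n0n : (n0 <= n)%N by exact: leq_trans (leq_addl _ _) Nn.
have nJ : ~ J n w by rewrite -(subnK n0n); apply: HN; rewrite leq_subRL// addnC.
have {nJ} : `|mart PP (g n) (sn n) T t w - mart PP (g n) (sn n) T 0 w| < 1.
  by rewrite ltNge; apply/negP => le1; apply: nJ; exists k => //; exists i.
have martE u : 0 <= u -> u <= T -> mart PP (g n) (sn n) T u w =
    tn n * pairing (PP (T - u) f) (traj w (sn n + u)).
  move=> u0 uT; have Tu0 : 0 <= T - u by rewrite subr_ge0.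
  rewrite /mart -pairingZ; last exact: (mean_Bbplus bf Tu0).1.
  congr (pairing _ _); apply/funext => y.
  exact: (meanZ pp_dens mean0 (tn n) y bf.1 Tu0).
rewrite (martE _ t0 tT) (martE _ (lexx 0) T0) -mulrBr subr0 addr0 normrM ger0_norm// => /ltW H.
rewrite -/(sn n) (_ : expR (lambda1 * sn n) = expR (- rate * sn n) * tn n); last first.
  by rewrite -expRD; congr expR; ring.
by rewrite -mulrA ler_piMr ?expR_ge0.
Qed.

(** * Deterministic limits along a path with small jumps *)

Hypothesis ch : continuous h.

Local Notation W := (Wh lambda1 h).

(** The conclusion of [ae_small_jumps] as a property of one path: what follows about limits is
    deterministic. *)
Definition small_jumps f (sigma T : R) (w : mpath E) : Prop :=
  exists N, forall n k i, (N <= n)%N ->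
    expR (lambda1 * (n%:R * sigma)) *
      `|pairing (PP (T - Num.min (i%:R / 2 ^+ k) T) f)
           (traj w (n%:R * sigma + Num.min (i%:R / 2 ^+ k) T))
        - pairing (PP T f) (traj w (n%:R * sigma))|
    <= expR (- rate * (n%:R * sigma)).

Let pairing_mean_h t (nu : fmeas E) : 0 <= t ->
  pairing (PP t h) nu = expR (- lambda1 * t) * pairing h nu.
Proof.
move=> t0; rewrite -pairingZ; last exact: bh.1.
by congr (pairing _ nu); apply/funext => y; exact: mean_hE.
Qed.

Lemma Wh_ge0 w t : 0 <= W w t.
Proof. by rewrite /Wh mulr_ge0 ?expR_ge0// pairing_ge0. Qed.

Let right_cvg_exp (w : mpath E) f t : continuous f -> bounded_fct f -> 0 <= t ->
  expR (lambda1 * x) * pairing f (w x) @[x --> t^'+] --> expR (lambda1 * t) * pairing f (w t).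
Proof.
move=> cf bf t0; apply: cvgM; last exact: right_cvg_pairing.
apply: cvg_at_right_filter; apply: continuous_comp; last exact: continuous_expR.
by apply: cvgMr; exact: cvg_id.
Qed.

Let expl_le1 t : 0 <= t -> expR (lambda1 * t) <= 1.
Proof. by move=> t0; rewrite expR_le1 mulr_le0_ge0// ltW. Qed.

(** As PP_{1-t} h is a multiple of h, the mean martingale of h is a multiple of W^h, whose
    increments over a unit interval thus inherit the bound on jumps. *)
Let Wh_step w : small_jumps h 1 1 w -> exists N, forall n u, (N <= n)%N ->
  n%:R <= u -> u <= n.+1%:R -> `|W w u - W w n%:R| <= expR (- rate) ^+ n.
Proof.
move=> [N HN]; exists N => n u Nn nu un1.
have grid k i : let t := Num.min (i%:R / 2 ^+ k) 1 in
    `|W w (n%:R + t) - W w n%:R| <= expR (- rate) ^+ n.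
  move=> t; have t1 : t <= 1 by rewrite ge_min lexx orbT.
  have t0 : 0 <= t by rewrite le_min ler01 andbT divr_ge0// exprn_ge0.
  have := HN n k i Nn; rewrite mulr1 -/t !pairing_mean_h ?subr_ge0//.
  move=> H; rewrite -expRM_natl mulrC; apply: le_trans H.
  rewrite -[X in X <= _]mul1r -[leRHS]mulrC -[expR (lambda1 * n%:R)](ger0_norm (expR_ge0 _)) -normrM.
  have -> : (expR (- lambda1 * (1 - t)) * pairing h (w (n%:R + t)) -
      expR (- lambda1 * 1) * pairing h (w n%:R)) * expR (lambda1 * n%:R) =
      expR (- lambda1) * (W w (n%:R + t) - W w n%:R).
    have e1 : expR (- lambda1 * (1 - t)) = expR (- lambda1) * expR (lambda1 * t).
      by rewrite -expRD; congr expR; ring.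
    have e2 : expR (lambda1 * (n%:R + t)) = expR (lambda1 * n%:R) * expR (lambda1 * t).
      by rewrite -expRD; congr expR; ring.
    by rewrite /Wh e1 e2 mulr1; ring.
  rewrite normrM ger0_norm ?expR_ge0// ler_wpM2r//.
  by rewrite -expR0 ler_expR oppr_ge0 ltW.
(* The right end of the interval is not covered by [right_dyadic_le]; it is the grid point with k =
   0 and i = 1. *)
move: un1; rewrite le_eqVlt => /predU1P[->|un1].
  have := grid 0 1; rewrite expr0 divr1 min_l// -natr1; exact.
apply: (@right_dyadic_le R (W w) n%:R 1) => //; first by rewrite natr1.
- apply: right_cvg_exp => //; exact: le_trans nu.
Qed.

(** The bounds e^{-rate n} are summable, which gives convergence along the integers, and each
    controls the oscillation over a whole unit interval. *)
Lemma Wh_is_cvg w : small_jumps h 1 1 w -> cvg (W w t @[t --> +oo]).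
Proof.
move=> /Wh_step[N HN]; pose z := expR (- rate).
have z0 : 0 <= z by exact: expR_ge0.
have z1 : z < 1 by rewrite -expR0 ltr_expR oppr_lt0 rate_gt0.
pose a n := W w (n + N)%:R.
have ca : cvgn a.
  have -> : a = (fun n => a 0 + series (telescope a) n).
    by apply/funext => n; rewrite -eq_sum_telescope.
  apply: is_cvgD; first exact: is_cvg_cst.
  apply: normed_cvg; apply: (@series_le_cvg _ _ (geometric (z ^+ N) z)).
  - by move=> n /=.
  - by move=> n; rewrite /= mulr_ge0// exprn_ge0.
  - move=> n; rewrite /= -exprD [(N + n)%N]addnC; apply: HN.
    + exact: leq_addl.
    + by rewrite ler_nat addSn.
    + by rewrite addSn.
  - by apply: is_cvg_geometric_series; rewrite ger0_norm.
apply/cvg_ex; exists (limn a); apply/cvgrPdist_le => e e0.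
have e20 : 0 < e / 2 by rewrite divr_gt0.
have [N1 _ H1] := (cvgrPdist_le _ _).1 ca _ e20.
have cz : z ^+ n @[n --> \oo] --> (0 : R) by apply: cvg_expr; rewrite ger0_norm.
have [N2 _ H2] := (cvgrPdist_le _ _).1 cz _ e20.
near=> t; pose n := Num.truncn t.
have t0 : 0 <= t by near: t; apply: nbhs_pinfty_ge; rewrite num_real.
have nM : (N + maxn N1 N2 <= n)%N.
  rewrite truncn_ge_nat//; near: t; apply: nbhs_pinfty_ge; rewrite num_real//.
have nt : n%:R <= t by rewrite truncn_le.
have tn : t <= n.+1%:R by rewrite ltW// truncnS_gt.
have Nn : (N <= n)%N by exact: leq_trans (leq_addr _ _) nM.
have := HN n t Nn nt tn; rewrite -/z => h1.
have N12 : (maxn N1 N2 <= n - N)%N by rewrite leq_subRL.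
have := H1 (n - N)%N (leq_trans (leq_maxl _ _) N12); rewrite /= /a subnK// => h2.
have N2n : (N2 <= n)%N by rewrite (leq_trans (leq_maxr N1 N2))// (leq_trans N12)// leq_subr.
have := H2 n N2n; rewrite /= sub0r normrN ger0_norm ?exprn_ge0// => h3.
have -> : limn a - W w t = (limn a - W w n%:R) - (W w t - W w n%:R) by ring.
apply: le_trans (ler_normB _ _) _.
by apply: le_trans (lerD h2 (le_trans h1 h3)) _; rewrite -splitr.
Unshelve. all: by end_near.
Qed.

(** Strong continuity multiplied by h(x), on a mesh 1/(k+1) so that countably many meshes suffice.
    The one-sided limit says nothing at v = 0, which [mean0] supplies. *)
Let step_close (phi : E -> R) (e : R) : Bb phi ->
  supnorm (normalized_semigroup lambda1 h PP t phi \- phi) @[t --> 0^'+] --> 0%E ->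
  0 < e -> exists2 k : nat, True & forall v x, 0 <= v -> v <= k.+1%:R^-1 ->
    `|expR (lambda1 * v) * PP v (fun y => phi y * h y) x - phi x * h x| <= e * h x.
Proof.
move=> bphi H e0; have bf : Bb (fun y => phi y * h y) by exact: BbM bphi bh.1.
have [dl dl0 Hd] : exists2 dl : R, 0 < dl & forall v, 0 < v -> v < dl ->
    (supnorm (normalized_semigroup lambda1 h PP v phi \- phi)%R <= e%:E)%E.
  have /fine_cvgP[[d1 /= d10 fin]] := H.
  move=> /cvgr_le/(_ e e0)[d2 /= d20 le_e].
  exists (Num.min d1 d2) => [|v v0]; first by rewrite lt_min d10.
  rewrite lt_min => /andP[v1 v2].
  have bl (c : R) : v < c -> ball_ [eta Num.Def.normr] 0 c v.
    by rewrite /ball_ /= sub0r normrN ger0_norm// ltW.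
  have := le_e v (bl _ v2) v0; have := fin v (bl _ v1) v0 => /fineK => fE.
  by rewrite -[X in (X <= _)%E]fE lee_fin.
pose k := Num.truncn dl^-1; exists k => // v x; rewrite le_eqVlt => /predU1P[<- _|v0 vk].
  by rewrite mulr0 expR0 mul1r mean0// subrr normr0 mulr_ge0// ltW.
have vd : v < dl.
  apply: le_lt_trans vk _; rewrite -[ltRHS]invrK ltf_pV2 ?posrE ?invr_gt0//.
  exact: truncnS_gt.
have := Hd v v0 vd; have hx : 0 < h x by case: (h_pos x).
move=> /(le_trans (ereal_sup_ubound _)) => /(_ (`|(normalized_semigroup lambda1 h PP v phi \- phi) x|%:E)).
rewrite lee_fin => /(_ _) Hx.
have {Hx} : `|(normalized_semigroup lambda1 h PP v phi \- phi) x| <= e by apply: Hx; exists x.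
rewrite /normalized_semigroup /= -(ler_pM2r hx); apply: le_trans.
rewrite -[X in _ <= _ * X](ger0_norm (h0 x)) -normrM mulrBl le_eqVlt; apply/orP; left; apply/eqP.
by congr (`| _ - _ |); rewrite mulrAC divfK// gt_eqF.
Qed.

(** At a grid time in the last mesh of a window from sn to sn + T, e^{lambda1 u} <f, X_u> is
    compared with the rescaled <PP_{T-t} f, X_{sn+t}> (strong continuity), with <PP_T f, X_sn>
    (small jumps), with c W_sn (ergodicity) and with c L. T is a multiple of the mesh, so the last
    meshes of successive windows cover all large times. *)
Lemma continuous_limit w phi : continuous phi -> Bb phi -> (forall y, 0 <= phi y) ->
  supnorm (normalized_semigroup lambda1 h PP t phi \- phi) @[t --> 0^'+] --> 0%E ->
  small_jumps h 1 1 w ->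
  (forall k M, small_jumps (fun y => phi y * h y) k.+1%:R^-1 (M%:R * k.+1%:R^-1) w) ->
  expR (lambda1 * t) * pairing (fun y => phi y * h y) (w t) @[t --> +oo] -->
    ip m (fun y => phi y * h y) hhat * Wh_infty lambda1 h w.
Proof.
move=> cphi bphi phi0 H7 /Wh_is_cvg cW Hphi; set L := Wh_infty lambda1 h w.
have WL : W w t @[t --> +oo] --> L by exact: cW.
have L0 : 0 <= L by apply: (cvgr_to_ge WL); apply: nearW => t; exact: Wh_ge0.
have [B phiB] := bphi.2; have B0 : 0 <= B by exact: le_trans (phiB point).
pose f y := phi y * h y; have bf : Bb f by exact: BbM bphi bh.1.
have f0 y : 0 <= f y by rewrite mulr_ge0.
have bf' : Bbplus f by split => //; split => //; exact: bf.1.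
pose c := ip m f hhat; pose a t := expR (lambda1 * t) * pairing f (w t).
have a_right t : 0 <= t -> a x @[x --> t^'+] --> a t.
  move=> t0; apply: right_cvg_exp => //; last exact: bf.2.
  by move=> y; apply: cvgM; [exact: cphi|exact: ch].
(* The sum of the four errors divided by e: L + 1 for strong continuity, B (L + 1) for ergodicity,
   and 1 each for the jumps and for the convergence of W. *)
pose D := (1 + B) * (L + 1) + 2.
have D0 : 0 < D by rewrite ltr_wpDl// mulr_ge0// addr_ge0.
apply/cvgrPdist_le => e' e'0; pose e := e' / D; have e0 : 0 < e by rewrite divr_gt0.
have [k _ Hk] := step_close bphi H7 e0; pose sg : R := k.+1%:R^-1.
have sg0 : 0 < sg by rewrite invr_gt0.
have [T1 T10 HT1] := mean_ergodic e0.
pose M := (Num.truncn (T1 * k.+1%:R)).+1; pose T := M%:R * sg.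
have T1T : T1 <= T by rewrite ler_pdivlMr// ltW// truncnS_gt.
have T0 : 0 <= T by rewrite mulr_ge0// ltW.
have sgT : sg <= T by rewrite (ler_peMl (ltW sg0))// ler1n.
have [N HN] := Hphi k M.
have [X HX] : exists X, forall t, X <= t ->
    [/\ W w t <= L + 1, `|c| * `|W w t - L| <= e & expR (- rate * t) <= e].
  have c1 : 0 < e / (`|c| + 1) by rewrite divr_gt0// ltr_wpDl.
  have [X1 [_ h1]] := (cvgrPdist_le _ _).1 WL _ (@ltr01 R).
  have [X2 [_ h2]] := (cvgrPdist_le _ _).1 WL _ c1.
  exists (Num.max (Num.max X1 X2 + 1) (e^-1 / rate)) => t.
  rewrite ge_max => /andP[tX te].
  have Xt : Num.max X1 X2 < t by apply: lt_le_trans tX; rewrite ltrDl.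
  move: Xt; rewrite gt_max => /andP[X1t X2t]; split.
  - have := h1 t X1t; rewrite /= distrC => /ler_normlW.
    by rewrite lerBlDl.
  - have := h2 t X2t; rewrite /= distrC => H; apply: le_trans (ler_wpM2l _ H) _ => //.
    rewrite mulrCA ler_piMr// ?(ltW e0)//.
    by rewrite ler_pdivrMr ?mul1r ?lerDl// ltr_wpDl.
  - have et : e^-1 <= rate * t by rewrite mulrC -ler_pdivrMr// rate_gt0.
    rewrite mulNr expRN -[leRHS]invrK lef_pV2 ?posrE ?expR_gt0 ?invr_gt0//.
    apply: le_trans et _; apply: le_trans (expR_ge1Dx _); by rewrite lerDr.
have key n t : (N <= n)%N -> X <= n%:R * sg -> n%:R * sg + (T - sg) <= n%:R * sg + t ->
    (exists k' i, t = Num.min (i%:R / 2 ^+ k') T) -> `|a (n%:R * sg + t) - c * L| <= e * D.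
  set sn := n%:R * sg => Nn Xn; rewrite lerD2l => tsg [k' [i tE]].
  have sn0 : 0 <= sn by rewrite mulr_ge0// ltW.
  have tT : t <= T by rewrite tE ge_min lexx orbT.
  have t0 : 0 <= t by rewrite tE le_min T0 andbT divr_ge0// exprn_ge0.
  have v0 : 0 <= T - t by rewrite subr_ge0.
  have vk : T - t <= sg by move: tsg; rewrite lerBlDr lerBlDl addrC.
  have [Wt _ _] := HX (sn + t) (le_trans Xn (ler_wpDr t0 (lexx sn))).
  have [Wn cWn rn] := HX sn Xn.
  have bPv : Bbplus (PP (T - t) f) by exact: mean_Bbplus.
  have bPT : Bbplus (PP T f) by exact: mean_Bbplus.
  pose a1 := expR (lambda1 * (sn + t)) * (expR (lambda1 * (T - t)) * pairing (PP (T - t) f) (w (sn + t))).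
  pose a2 := expR (lambda1 * T) * (expR (lambda1 * sn) * pairing (PP T f) (w sn)).
  have norm_pairing (g : E -> R) (b : R) (nu : fmeas E) : Bb g -> (forall y, `|g y| <= b * h y) ->
      `|pairing g nu| <= b * pairing h nu.
    move=> bg gb; have bbh := BbZ b bh.1; rewrite -pairingZ; last exact: bh.1.
    rewrite ler_norml; apply/andP; split; last first.
      by apply: le_pairing => // y; exact: le_trans (ler_norm _) (gb y).
    rewrite lerNl -[leLHS]mulN1r -pairingZ//; apply: le_pairing => //; first exact: BbZ.
    by move=> y; rewrite mulN1r; apply: le_trans (ler_norm _) _; rewrite normrN.
  have d1 : `|a (sn + t) - a1| <= e * (L + 1).
    rewrite /a /a1 -mulrBr normrM ger0_norm ?expR_ge0// -pairingZ; last exact: bPv.1.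
    have bz := BbZ (expR (lambda1 * (T - t))) bPv.1.
    rewrite -pairingB//; apply: (@le_trans _ _ (e * W w (sn + t))); last first.
      by rewrite ler_wpM2l// ltW.
    rewrite /Wh mulrCA ler_wpM2l ?expR_ge0//; apply: norm_pairing; first exact: BbB.
    by move=> y; rewrite distrC; exact: Hk.
  have d2 : `|a1 - a2| <= e.
    apply: le_trans rn; apply: le_trans (HN n k' i Nn); rewrite -tE -/sn -/T.
    have -> : a1 - a2 = expR (lambda1 * T) * (expR (lambda1 * sn) *
        (pairing (PP (T - t) f) (w (sn + t)) - pairing (PP T f) (w sn))).
      rewrite /a1 /a2 mulrA -expRD (_ : lambda1 * (sn + t) + lambda1 * (T - t) =
        lambda1 * T + lambda1 * sn); last by ring.
      by rewrite expRD; ring.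
    rewrite normrM ger0_norm ?expR_ge0// normrM (ger0_norm (expR_ge0 _)).
    rewrite ler_piMl ?expl_le1// mulr_ge0// expR_ge0.
  have d3 : `|a2 - c * W w sn| <= e * B * (L + 1).
    have -> : a2 - c * W w sn = expR (lambda1 * sn) *
        pairing (fun y => expR (lambda1 * T) * PP T f y - c * h y) (w sn).
      rewrite pairingB; [|exact: BbZ bPT.1|exact: BbZ bh.1].
      rewrite !pairingZ; [|exact: bh.1|exact: bPT.1].
      by rewrite /a2 /Wh; ring.
    apply: (@le_trans _ _ (e * B * W w sn)); last by rewrite ler_wpM2l// mulr_ge0// ltW.
    rewrite normrM (ger0_norm (expR_ge0 _)) /Wh [leRHS]mulrCA ler_wpM2l ?expR_ge0//.
    apply: norm_pairing; first by apply: BbB; [exact: BbZ bPT.1|exact: BbZ bh.1].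
    by move=> y; rewrite [c * _]mulrC; exact: HT1.
  have d4 : `|c * W w sn - c * L| <= e by rewrite -mulrBr normrM.
  have -> : a (sn + t) - c * L = (a (sn + t) - a1) + (a1 - a2) + (a2 - c * W w sn) + (c * W w sn - c * L) by ring.
  apply: le_trans (ler_normD _ _) _.
  apply: le_trans (lerD (le_trans (ler_normD _ _) (lerD (le_trans (ler_normD _ _) (lerD d1 d2)) d3)) d4) _.
  by rewrite le_eqVlt; apply/orP; left; apply/eqP; rewrite /D; ring.
near=> u.
have u0 : 0 <= u by near: u; apply: nbhs_pinfty_ge; rewrite num_real.
have uX : Num.max X 0 + T <= u by near: u; apply: nbhs_pinfty_ge; rewrite num_real.
have uN : (N + M)%:R * sg <= u by near: u; apply: nbhs_pinfty_ge; rewrite num_real.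
pose j := Num.truncn (u * k.+1%:R).
have uk0 : 0 <= u * k.+1%:R by rewrite mulr_ge0.
have ju : j%:R * sg <= u by rewrite ler_pdivrMr// truncn_le.
have uj : u < j.+1%:R * sg by rewrite ltr_pdivlMr// truncnS_gt.
have NMj : (N + M <= j)%N.
  by rewrite truncn_ge_nat// -ler_pdivrMr.
(* The window of length T = M sg starting at n sg ends at (j + 1) sg, the first mesh point after
   u. *)
pose n := (j.+1 - M)%N.
have nM : (n + M = j.+1)%N by rewrite subnK// (leq_trans (leq_addl N M))// ltnW.
have Nn : (N <= n)%N by rewrite -(leq_add2r M) nM ltnW.
have snT : n%:R * sg + T = j.+1%:R * sg by rewrite /T -mulrDl -natrD nM.
have snu : n%:R * sg + (T - sg) <= u.
  by rewrite addrA snT -natr1 mulrDl mul1r addrK.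
have Xn : X <= n%:R * sg.
  have : Num.max X 0 + T < n%:R * sg + T by rewrite snT; exact: le_lt_trans uX uj.
  by rewrite ltrD2r gt_max => /andP[/ltW].
have -> : e' = e * D by rewrite /e divfK// gt_eqF.
rewrite distrC; apply: (@right_dyadic_le R a (n%:R * sg) T) => //.
- by apply: le_trans snu; rewrite lerDl subr_ge0.
- by rewrite snT.
- exact: a_right.
- move=> k' i ut; apply: key => //; last by exists k', i.
  exact: le_trans snu ut.
Unshelve. all: by end_near.
Qed.

(** * Extension to all almost everywhere continuous functions *)

Hypothesis strong_feller : forall phi, C0 phi ->
  supnorm (normalized_semigroup lambda1 h PP t phi \- phi) @[t --> 0^'+] --> 0%E.

Let envelope_h l y : R := envelope s l y * h y.

(** Only countably many conditions, indexed by codes of envelopes, meshes and window lengths, and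
    none of them mentions a starting measure or f. *)
Definition good_path (w : mpath E) : Prop := small_jumps h 1 1 w /\
  forall l k M, small_jumps (envelope_h l) k.+1%:R^-1 (M%:R * k.+1%:R^-1) w.

Let bE l : Bb (envelope s l).
Proof. by have [cf bf _] := C0_envelope s l; split => //; exact: continuous_borel. Qed.

Let bEh l : Bbplus (envelope_h l).
Proof.
have b := BbM (bE l) bh.1; split => //; split; first exact: b.1.
by move=> y; rewrite mulr_ge0// envelope_ge0.
Qed.

Lemma ae_good_path mu : \forall w \ae P mu, good_path w.
Proof.
pose Q n w := if @unpickle (seq (nat * rat * rat * nat) * nat * nat)%type n is Some (l, k, M)
  then small_jumps (envelope_h l) k.+1%:R^-1 (M%:R * k.+1%:R^-1) w else True.
have hQ n : \forall w \ae P mu, Q n w.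
  rewrite /Q; case: unpickle => [[[l k] M]|]; last exact: aeW.
  have [B HB] := (bE l).2.
  apply: (ae_small_jumps mu (K := B)) => //.
  - exact: le_trans (HB point).
  - by move=> y; rewrite ler_wpM2r// (le_trans (ler_norm _)).
have h1 : \forall w \ae P mu, small_jumps h 1 1 w.
  apply: (ae_small_jumps mu (K := 1)) => // y; by rewrite mul1r.
(* Index 0 is reserved for the condition on h, so that one countable intersection carries
   everything. *)
have hQ' n : \forall w \ae P mu, if n is n'.+1 then Q n' w else small_jumps h 1 1 w.
  by case: n.
have [A [mA A0 sub]] := ae_foralln hQ'; exists A; split => //.
apply: subset_trans sub => w ng H; apply: ng; split; first exact: (H 0).
by move=> l k M; have := H (pickle (l, k, M)).+1; rewrite /Q pickleK.
Qed.

Let good_limit w l : good_path w ->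
  expR (lambda1 * t) * pairing (envelope_h l) (w t) @[t --> +oo] -->
    ip m (envelope_h l) hhat * Wh_infty lambda1 h w.
Proof.
move=> [w1 w2]; have [cf _ _] := C0_envelope s l.
apply: continuous_limit => //.
- exact: envelope_ge0.
- by apply: strong_feller; exact: C0_envelope.
- exact: w2.
Qed.

Let hhat_ip f : ip m f hhat = \int[m]_y (f y / h y * (h y * hhat y)).
Proof.
by apply: eq_Rintegral => y _; rewrite mulrA divfK// gt_eqF//; case: (h_pos y).
Qed.

(* applied to c h + f and to c h - f, this gives both halves of the limit *)
Let pairing_lower w f (M e : R) : good_path w -> measurable_fun [set: borel E] f ->
  (\forall x \ae m, {for x, continuous f}) -> (forall y, 0 <= f y / h y <= M) -> 0 < e ->
  \forall t \near +oo, ip m f hhat * Wh_infty lambda1 h w - e <= expR (lambda1 * t) * pairing f (w t).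
Proof.
move=> gw mf cf fM e0; set L := Wh_infty lambda1 h w.
have L0 : 0 <= L.
  by apply: (cvgr_to_ge (Wh_is_cvg gw.1)); apply: nearW => t; exact: Wh_ge0.
have hx x : 0 < h x by case: (h_pos x).
have mfh : measurable_fun [set: borel E] (fun y => f y / h y).
  apply: measurable_funM => //; apply: (continuous_borel (f := fun y => (h y)^-1)) => x.
  by apply: cvgV; [rewrite gt_eqF|exact: ch].
have cfh : \forall x \ae m, {for x, continuous (fun y => f y / h y)}.
  have [A [mA A0 sub]] := cf; exists A; split => //.
  apply: subset_trans sub => y nF cfy; apply: nF; apply: cvgM => //.
  by apply: cvgV; [rewrite gt_eqF|exact: ch].
(* Half of e pays for the envelope, whose integral is multiplied by L; the other half pays for the
   limit along that envelope. L + 1 avoids division by 0. *)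
pose e1 := e / 2 / (L + 1).
have L1 : 0 < L + 1 by rewrite ltr_wpDl.
have e10 : 0 < e1 by rewrite !divr_gt0.
have k0 y : 0 <= h y * hhat y by rewrite mulr_ge0// ltW//; case: (h_pos y).
have [l [lf lI]] := envelope_integral E_lc dense_s integrable_hhhat k0 mfh fM cfh e10.
have bf : Bb f.
  split => //; have [K hK] := h_bnd; have /andP[M0 M1] := fM point.
  exists (M * K) => y; have /andP[fy0 fy1] := fM y.
  rewrite -[f y](divfK (lt0r_neq0 (hx y))) normrM ler_pM// ger0_norm//.
have elf y : envelope_h l y <= f y.
  by rewrite -[f y](divfK (lt0r_neq0 (hx y))) ler_wpM2r.
have e20 : 0 < e / 2 by rewrite divr_gt0.
have [X [_ HX]] := (cvgrPdist_le _ _).1 (good_limit (l := l) gw) _ e20.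
exists X; split; first exact: num_real.
move=> t Xt; have := HX t Xt; rewrite -/L => /ler_normlW; rewrite lerBlDr -lerBlDl => H.
apply: (@le_trans _ _ (expR (lambda1 * t) * pairing (envelope_h l) (w t))); last first.
  by rewrite ler_wpM2l ?expR_ge0//; apply: le_pairing => //; exact: (bEh l).1.
apply: le_trans H.
have ipE : ip m (envelope_h l) hhat = \int[m]_y (envelope s l y * (h y * hhat y)).
  by apply: eq_Rintegral => y _; rewrite mulrA.
have : (ip m f hhat - ip m (envelope_h l) hhat) * L <= e / 2.
  apply: (@le_trans _ _ (e1 * (L + 1))); last by rewrite /e1 divfK// gt_eqF.
  apply: (@le_trans _ _ (e1 * L)); last by rewrite (ler_wpM2l (ltW e10))// lerDl.
  by rewrite ler_wpM2r// hhat_ip ipE lerBlDr -lerBlDl.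
by rewrite mulrBl; lra.
Qed.

Lemma good_path_limit w f : good_path w -> measurable_fun [set: borel E] f ->
  (\forall x \ae m, {for x, continuous f}) -> bounded_fct (fun x => f x / h x) ->
  expR (lambda1 * t) * pairing f (w t) @[t --> +oo] -->
    ip m f hhat * Wh_infty lambda1 h w.
Proof.
move=> gw mf cf [c fc]; set L := Wh_infty lambda1 h w.
have WL : W w t @[t --> +oo] --> L by exact: (Wh_is_cvg gw.1).
have hx x : 0 < h x by case: (h_pos x).
have c0 : 0 <= c by exact: le_trans (fc point).
have bf : Bb f.
  split => //; have [K hK] := h_bnd; exists (c * K) => y.
  by rewrite -[f y](divfK (lt0r_neq0 (hx y))) normrM ler_pM.
have ifh : m.-integrable setT (EFin \o (fun y => f y * hhat y)).
  have i1 := integrableZl measurableT c integrable_hhhat.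
  apply: le_integrable i1 => //; first by apply/measurable_EFinP; exact: measurable_funM.
  move=> y _; have [_ hy] := h_pos y; rewrite /= lee_fin.
  have -> : f y * hhat y = f y / h y * (h y * hhat y) by rewrite mulrA divfK ?lt0r_neq0.
  rewrite [leLHS]normrM [leRHS]normrM ler_wpM2r//.
  exact: le_trans (fc y) (ler_norm _).
have lower (sg : R) : `|sg| = 1 -> forall e, 0 < e -> \forall t \near +oo,
    (c + sg * ip m f hhat) * L - e <= c * W w t + sg * (expR (lambda1 * t) * pairing f (w t)).
  move=> sg1 e e0; pose g y := c * h y + sg * f y.
  have mg : measurable_fun [set: borel E] g by apply: measurable_funD; exact: measurable_funM.
  have cg : \forall x \ae m, {for x, continuous g}.
    have [A [mA A0 sub]] := cf; exists A; split => //.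
    apply: subset_trans sub => y nF cfy; apply: nF.
    by apply: cvgD; [apply: cvgMr; exact: ch|exact: cvgMr].
  have gb y : 0 <= g y / h y <= c + c.
    rewrite /g mulrDl mulfK ?lt0r_neq0// -mulrA.
    have := fc y; rewrite -[X in X <= _]mul1r -sg1 -normrM ler_norml => /andP[f1 f2].
    by apply/andP; split; lra.
  have H := pairing_lower gw mg cg gb e0.
  have ipg : ip m g hhat = c + sg * ip m f hhat.
    have i2 := integrableZl measurableT c integrable_hhhat.
    have i3 := integrableZl measurableT sg ifh.
    rewrite -[X in X + _]mulr1 -hhat1 /ip -!RintegralZl// -RintegralD//.
    by apply: eq_Rintegral => y _; rewrite /g; ring.
  apply: filterS H => t; rewrite ipg -/L; congr (_ <= _).
  rewrite /g pairingD; [|exact: BbZ bh.1|exact: BbZ].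
  rewrite (pairingZ c); last exact: bh.1.
  rewrite (pairingZ sg)//.
  by rewrite /Wh; ring.
apply/cvgrPdist_le => e e0; have e20 : 0 < e / 2 by rewrite divr_gt0.
have e30 : 0 < e / 2 / (c + 1) by rewrite divr_gt0// ltr_wpDl.
near=> t.
have h1 : (c + 1 * ip m f hhat) * L - e / 2 <=
    c * W w t + 1 * (expR (lambda1 * t) * pairing f (w t)).
  by near: t; apply: lower => //; rewrite normr1.
have h2 : (c + -1 * ip m f hhat) * L - e / 2 <=
    c * W w t + -1 * (expR (lambda1 * t) * pairing f (w t)).
  by near: t; apply: lower => //; rewrite normrN1.
(* The term c h added for positivity costs nothing in the limit: its rescaled pairing is c W, which
   tends to c L. *)
have h3 : c * (W w t - L) <= e / 2.
  have : `|L - W w t| <= e / 2 / (c + 1) by near: t; exact: (cvgrPdist_le _ _).1 WL _ e30.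
  rewrite distrC => /ler_normlW => H; apply: le_trans (ler_wpM2l c0 H) _.
  by rewrite mulrCA ler_piMr ?(ltW e20)// ler_pdivrMr ?ltr_wpDl// mul1r lerDl.
move: h1 h2 h3; rewrite ler_norml !mulN1r !mul1r mulrBr.
move: (expR _ * _) (W w t) (ip m f hhat) => x y z h1 h2 h3.
by apply/andP; split; lra.
Unshelve. all: by end_near.
Qed.

End superprocess_moments.

(** * A dense sequence, and the theorem with one event for all starting measures *)

(** The injection of S into the naturals is inverted by choice; indices outside its range receive
    the base point, which does no harm to density. *)
Lemma countable_dense_seq (T : ptopologicalType) (S : set T) : countable S -> dense S ->
  exists s : nat -> T, forall U : set T, open U -> U !=set0 -> exists n, U (s n).
Proof.
move=> /countable_injP[f finj] dS; exists (fun n => xget point [set x | S x /\ f x = n]).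
move=> U oU U0; have [x [Ux Sx]] := dS U U0 oU; exists (f x).
have [Sy fy] := @xgetPex _ point [set y | S y /\ f y = f x] (ex_intro _ x (conj Sx erefl)).
by rewrite (finj _ _ _ _ fy) ?inE.
Qed.

Theorem theorem3p4 (R : realType) (E : pmetricType R)
  (E_lc : locally_compact [set: E])
  (E_sep : exists2 S : set E, countable S & dense S)
  (m : {sigma_finite_measure set (borel E) -> \bar R})
  (m_supp : forall U : set E, open U -> U !=set0 -> (0 < m U)%E)
  (d : measure_display) (Omega : measurableType d)
  (xi : hunt_process E Omega) (xi_sym : m_symmetric m xi)
  (D : dirichlet_form m) (D_reg : regular_form D) (D_xi : associated xi D)
  (p : R -> E -> E -> \bar R) (p_dens : transition_density m xi p)
  (p_sym : symmetric_density p)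
  (br : branching_mechanism E)
  (gamma : R.-fker (borel E) ~> (borel E)) (gammaE : nonlocal_kernel br gamma)
  (V : R -> (E -> R) -> E -> R) (V_cum : cumulant_semigroup br xi V)
  (P : R.-pker (borel (fmeas E)) ~> (path_space E)) (P_sup : is_superprocess V P)
  (PP : R -> (E -> R) -> E -> R) (PP_mean : mean_semigroup br xi gamma PP)
  (pp : R -> E -> E -> \bar R) (pp_dens : mean_density m PP pp)
  (H1 : kato m xi p (kmix m gamma))
  (H2 : L2 m (bra br) /\ L2 m (fun x => fine (gamma x setT)))
  (lambda1 : R) (h hhat : E -> R)
  (H3_lambda : lambda1 < 0)
  (H3_dom : dom D h /\ dom D hhat)
  (H3_pos : forall x, 0 < h x /\ 0 < hhat x)
  (H3_h : bounded_fct h /\ continuous h)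
  (H3_norm : Lnorm m 2%:E (EFin \o h) = 1%E /\ ip m h hhat = 1)
  (H3_eigen : forall v, dom D v -> Qform br D gamma h v = lambda1 * ip m h v)
  (H3_coeigen : forall v, dom D v -> quasi_continuous D v ->
     Qform br D gamma v hhat = lambda1 * ip m v hhat)
  (H4_psi : forall f, Cb_fine xi f -> (forall x, 0 <= f x) ->
     Cb_fine xi (fun x => psi br x f))
  (H4_gamma : forall f, Cb_fine xi f ->
     Cb_fine xi (fun x => \int[gamma x]_y f y - bra br x * f x))
  (H5 : exists q : R, [/\ 1 < q, q <= 2 &
     (ereal_sup (range (fun x : E =>
        ((h x)^-1)%:E *
        \int[brH br x]_(nu in @nonzero R E) (pairing h nu `^ q)%:E)) < +oo)%E])
  (H6 : ereal_sup (range (fun x : E =>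
          ess_sup m (fun y : borel E =>
            `|normalized_density lambda1 h hhat pp t x y - 1|)))%E
        @[t --> +oo] --> 0%E)
  (H7 : forall phi, C0 phi ->
     supnorm (normalized_semigroup lambda1 h PP t phi \- phi)
       @[t --> 0^'+] --> 0%E) :
  exists Omega0 : set (mpath E),
    (forall mu : fmeas E, \forall w \ae P mu, Omega0 w) /\
    forall w, Omega0 w ->
      cvg (Wh lambda1 h w t @[t --> +oo]) /\
      forall f : E -> R,
        measurable_fun [set: borel E] f ->
        (\forall x \ae m, {for x, continuous f}) ->
        bounded_fct (fun x => f x / h x) ->
        expR (lambda1 * t) * pairing f (traj w t) @[t --> +oo]
          --> ip m f hhat * Wh_infty lambda1 h w.
Proof.
have [S cS dS] := E_sep; have [s dense_s] := countable_dense_seq cS dS.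
have [q [q1 q2 h_moment]] := H5.
have [mh _] := dom_L2 H3_dom.1; have [mhhat _] := dom_L2 H3_dom.2.
(* The event depends on the dense sequence and on the exponent q, both fixed above, but not on
   [mu]. *)
exists (good_path s PP lambda1 h q); split=> [mu|w gw].
  exact: (ae_good_path E_lc dense_s gammaE V_cum PP_mean pp_dens P_sup H3_lambda
    mh mhhat H3_pos H3_h.1 H3_norm.2 H6 q1 q2 h_moment mu).
split=> [|f mf cf fh].
  exact: (Wh_is_cvg E_lc dense_s gammaE V_cum PP_mean pp_dens P_sup H3_lambda
    mh mhhat H3_pos H3_h.1 H3_norm.2 H6 q1 H3_h.2 gw.1).
exact: (good_path_limit E_lc dense_s gammaE V_cum PP_mean pp_dens P_sup H3_lambda
  mh mhhat H3_pos H3_h.1 H3_norm.2 H6 q1 H3_h.2 H7 gw mf cf fh).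
Qed.
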